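(* Let $\alpha\in W^{1,\infty}(\mathbb{R},[0,1))$, let $T>0$ be fixed and let $0<\Delta x\le 1$. Suppose $(\bar u,\bar\mu,\bar\nu)\in\mathcal{D}_0^{\alpha}$ with $\bar u_x\in B_2^{\beta}$ for some $\beta\in(0,1]$. Let $(u,\mu,\nu)(t)=T_t((\bar u,\bar\mu,\bar\nu))$ be the $\alpha$-dissipative solution and let $(u_{\Delta x},\mu_{\Delta x},\nu_{\Delta x})(t)=T_{\Delta x,t}\circ P_{\Delta x}((\bar u,\bar\mu,\bar\nu))$ be the numerical $\alpha$-dissipative solution. Then there exists a constant $D$, dependent on $T$, $\|\alpha'\|_\infty$, $\|\bar u\|_\infty$, $\bar G_\infty=\bar\nu(\mathbb{R})$, $\beta$, and $|\bar u_x|_{2,\beta}$ (in particular, independent of $\Delta x$), such that $$\sup_{t\in[0,T]}\|u(t)-u_{\Delta x}(t)\|_\infty\le D\big(\Delta x^{1/8}+\Delta x^{\beta/4}\big).$$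
   Context: Norms: $\|\cdot\|_p$ is the norm of $L^p(\mathbb{R})$. **Initial data.** Let $\theta^{\pm}\in C^\infty(\mathbb{R})$ satisfy $\theta^++\theta^-=1$, $0\le\theta^\pm\le1$, $\mathrm{supp}(\theta^+)\subset(-1,\infty)$, $\mathrm{supp}(\theta^-)\subset(-\infty,1)$. $E_2$ is the set of functions $f+a\theta^++b\theta^-$ with $f\in H^1(\mathbb{R})$, $a,b\in\mathbb{R}$; $E_1^0$ is the set of functions $f+a\theta^+$ with $f\in L^2(\mathbb{R})$, $a\in\mathbb{R}$. $\mathcal{D}_0^\alpha$ is the set of triplets $(u,\mu,\nu)$ with $u\in E_2$, $\mu=\nu$ a finite positive Radon measure on $\mathbb{R}$, $d\mu_{\mathrm{ac}}=u_x^2dx$ and $\mu((-\infty,\cdot))\in E_1^0$. Write $F(x)=\mu((-\infty,x))$, $G(x)=\nu((-\infty,x))$, $F_{\mathrm{ac}}(x)=\mu_{\mathrm{ac}}((-\infty,x))$, $F_{\mathrm{sing}}=F-F_{\mathrm{ac}}$, $F_\infty=\mu(\mathbb{R})$, $G_\infty=\nu(\mathbb{R})$; triplets are identified with $(u,F,G)$. Bars denote the initial data. **Regularity class.** With $\delta_hf(x)=f(x+h)-f(x)$, $B_2^\beta=\{f\in L^2(\mathbb{R}): \exists C>0,\ \|\delta_hf\|_2\le Ch^\beta\ \forall h\in(0,2]\}$ and $|f|_{2,\beta}=\sup_{h\in(0,2]}h^{-\beta}\|\delta_hf\|_2$. **Projection $P_{\Delta x}:\mathcal{D}_0^\alpha\to\mathcal{D}_0^\alpha$.**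 Let $x_j=j\Delta x$, $f_j=f(x_j)$, $Df_{2j}=\frac{f_{2j+2}-f_{2j}}{2\Delta x}$, $q_{2j}=\sqrt{DF_{\mathrm{ac},2j}-(Du_{2j})^2}$. For each $j\in\mathbb{Z}$ pick a sign $s_j\in\{1,-1\}$ (any choice is allowed). Then $P_{\Delta x}((u,F,G))=(u_{\Delta x},F_{\Delta x},G_{\Delta x})$ with $u_{\Delta x}(x)=u_{2j}+(Du_{2j}-s_jq_{2j})(x-x_{2j})$ on $(x_{2j},x_{2j+1}]$, $u_{\Delta x}(x)=u_{2j+2}+(Du_{2j}+s_jq_{2j})(x-x_{2j+2})$ on $(x_{2j+1},x_{2j+2}]$; $G_{\Delta x}=F_{\Delta x}=F_{\Delta x,\mathrm{ac}}+F_{\Delta x,\mathrm{sing}}$, where $F_{\Delta x,\mathrm{ac}}(x)=F_{\mathrm{ac},2j}+(Du_{2j}-s_jq_{2j})^2(x-x_{2j})$ on $(x_{2j},x_{2j+1}]$, $F_{\Delta x,\mathrm{ac}}(x)=\frac12(F_{\mathrm{ac},2j+2}+F_{\mathrm{ac},2j})-2s_jDu_{2j}q_{2j}\Delta x+(Du_{2j}+s_jq_{2j})^2(x-x_{2j+1})$ on $(x_{2j+1},x_{2j+2}]$, and $F_{\Delta x,\mathrm{sing}}(x)=F_{\mathrm{sing},2j+2}$ on $(x_{2j},x_{2j+2}]$. **Map $L$.** For $(u,\mu,\nu)\in\mathcal{D}_0^\alpha$, $L((u,\mu,\nu))=(y,U,V,H)$ with $y(\xi)=\sup\{x: x+\nu((-\infty,x))<\xi\}$,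 $U(\xi)=u(y(\xi))$, $H(\xi)=\xi-y(\xi)$, $V=H$. **Exact Lagrangian evolution $S_t$.** $S_t(\bar X)=X(t)=(y,U,V,H)(t)$ is the unique global solution with $X(0)=\bar X=(\bar y,\bar U,\bar V,\bar H)$ of $y_t=U$, $U_t=\frac12V-\frac14V_\infty(t)$, $V(t,\xi)=\int_{-\infty}^\xi\big(1-\alpha(y(\tau(\eta),\eta))\chi_{\{\omega: t\ge\tau(\omega)>0\}}(\eta)\big)\bar V_\xi(\eta)\,d\eta$, $H_t=0$, where $V_\infty(t)=\lim_{\xi\to\infty}V(t,\xi)$ and $\tau(\xi)=0$ if $\bar y_\xi(\xi)=\bar U_\xi(\xi)=0$, $\tau(\xi)=-2\bar y_\xi(\xi)/\bar U_\xi(\xi)$ if $\bar U_\xi(\xi)<0$, and $\tau(\xi)=\infty$ otherwise. **Map $M$.** $M((y,U,V,H))=(u,\mu,\nu)$ with $u(x)=U(\xi)$ for any $\xi$ with $x=y(\xi)$, $\mu=y_\#(V_\xi d\xi)$, $\nu=y_\#(H_\xi d\xi)$ (push-forwards). The $\alpha$-dissipative solution is $T_t=M\circ S_t\circ L$. The numerical one uses $T_{\Delta x,t}=M\circ S_{\Delta x,t}\circ L$, with $S_{\Delta x,t}$ as follows. **Numerical evolution $S_{\Delta x,t}$, $t\in[0,T]$.** Let $\bar X_{\Delta x}=L\circ P_{\Delta x}((\bar u,\bar\mu,\bar\nu))$; its components are piecewise linear with nodes $\xi_{3j}=x_{2j}+\bar G_{\Delta x}(x_{2j})$, $\xi_{3j+1}=x_{2j}+\bar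 G_{\Delta x}(x_{2j}+)$, $\xi_{3j+2}=x_{2j+1}+\bar G_{\Delta x}(x_{2j+1})$. Let $\tau_{\Delta x}$ be the function $\tau$ above for $\bar X_{\Delta x}$; it is constant between consecutive nodes, and $\tau_{j+1/2}=\tau_{\Delta x}(\frac12(\xi_j+\xi_{j+1}))$. A finite increasing sequence $\{\tau_k^*\}_{k=0}^N$, extracted from the numerical breaking times $\{\tau_{j+1/2}\}$, is used as a (non-uniform) temporal discretization of $[0,T]$. Set $X_{\Delta x}(0)=\bar X_{\Delta x}$. Given $X_{\Delta x}$ up to time $\tau_k^*$, define iterates $X^n_{\Delta x}=(y^n_{\Delta x},U^n_{\Delta x},V^n_{\Delta x},H^n_{\Delta x})$, $n\ge1$, on $(\tau_k^*,\tau_{k+1}^*]$ by $X_{\Delta x}^n(\tau_k^* )=X_{\Delta x}(\tau_k^* )$ and $y^n_{\Delta x,t}=U^n_{\Delta x}$, $U^n_{\Delta x,t}=\frac12V^n_{\Delta x}-\frac14V^n_{\Delta x,\infty}(t)$, $V^n_{\Delta x}(t,\xi)=\int_{-\infty}^{\xi}\big(1-\beta^n_{\Delta x}(\eta)\chi_{\{s: s\ge\tau_{\Delta x}(\eta)>\tau_k^*\}}(t)\big)V_{\Delta x,\xi}(\tau_k^*,\eta)\,d\eta$, $H^n_{\Delta x,t}=0$, where $\beta^1_{\Delta x}=0$ and, for $n\ge2$ and $\xi\in(\xi_j,\xi_{j+1}]$, $\beta^n_{\Delta x}(\xi)=\alpha(y_{\Delta x}^{n-1}(\tau_{k+1}^*,\xi_j))$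 if $\tau_{j+1/2}\in(\tau_k^*,\tau_{k+1}^*]$ and $\beta_{\Delta x}^n(\xi)=0$ otherwise. The iteration stops at the first $n=M^k_{\mathrm{it}}$ with $\sup_{t\in[\tau_k^*,\tau_{k+1}^*]}\sup_{j}|y^n_{\Delta x}(t,\xi_j)-y^{n-1}_{\Delta x}(t,\xi_j)|\le\epsilon:=\Delta x^2/\|\alpha'\|_\infty$, and one sets $X_{\Delta x}(t)=X_{\Delta x}^{M^k_{\mathrm{it}}}(t)$ on $(\tau_k^*,\tau_{k+1}^*]$, $S_{\Delta x,t}(\bar X_{\Delta x})=X_{\Delta x}(t)$. If $\alpha$ is constant, $S_{\Delta x,t}=S_t$ on $\bar X_{\Delta x}$. The sequence $\{\tau_k^*\}$ is chosen as part of the (previously published) scheme so that the iteration is contractive; the following previously established property of the scheme (local error estimate) is part of the standing setting: with $(\widehat y_{\Delta x},\widehat U_{\Delta x},\widehat V_{\Delta x},\widehat H_{\Delta x})(t)=S_t(\bar X_{\Delta x})$ and $(y_{\Delta x},U_{\Delta x},V_{\Delta x},H_{\Delta x})(t)=S_{\Delta x,t}(\bar X_{\Delta x})$, there is a constant $C$ depending on $\|\alpha'\|_\infty$, $\|\bar u\|_\infty$, $\bar G_\infty$ and $T$ such that $\|\widehat y_{\Delta x}(t)-y_{\Delta x}(t)\|_\infty+\|\widehat U_{\Delta x}(t)-U_{\Delta x}(t)\|_\infty\le C\Delta x^{1/4}$ for all $t\in[0,T]$. *)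

(* Defs.v *)
From HB Require Import structures.
From mathcomp Require Import all_boot all_order all_algebra.
From mathcomp Require Import all_classical all_reals all_analysis.

Set Implicit Arguments.
Unset Strict Implicit.
Unset Printing Implicit Defensive.
Import Order.TTheory GRing.Theory Num.Theory.
Import numFieldNormedType.Exports.

Local Open Scope ring_scope.
Local Open Scope classical_set_scope.

Section FunctionSpaces.
Variable R : realType.
Notation leb := (@lebesgue_measure R).
Implicit Types (f u : R -> R) (p : \bar R).

Definition Lpnorm p f : \bar R := Lnorm leb p (EFin \o f).

(* [v] is the integral of [f] over [D], which is moreover required to exist. *)
Definition has_integral (D : set R) f (v : R) : Prop :=
  leb.-integrable D (EFin \o f) /\ v = \int[leb]_(x in D) f x.

(* Locally absolutely continuous functions. In dimension one these are the
   continuous representatives of the W^{1,1}_loc functions, the weak derivative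
   being the almost everywhere derivative [derive1 f]; wherever the difference
   quotient does not converge, [derive1 f] has a default value. *)
Definition loc_abs_cont f : Prop :=
  forall a b, a <= b -> has_integral `[a, b] (derive1 f) (f b - f a).

Definition H1 f : Prop :=
  [/\ loc_abs_cont f, f \in Lfun leb 2%:E & derive1 f \in Lfun leb 2%:E].

Definition W1infty f : Prop :=
  [/\ loc_abs_cont f, f \in Lfun leb +oo%E & derive1 f \in Lfun leb +oo%E].

Definition smooth f : Prop := forall n x, derivable (f^`(n)) x 1.

Definition supp f : set R := closure [set x | f x != 0].

Definition cutoff_pair (thetap thetam : R -> R) : Prop :=
  [/\ smooth thetap, smooth thetam,
      (forall x, thetap x + thetam x = 1),
      (forall x, 0 <= thetap x <= 1 /\ 0 <= thetam x <= 1) &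
      supp thetap `<=` `]-1, +oo[ /\ supp thetam `<=` `]-oo, 1[].

Definition E2 (thetap thetam : R -> R) u : Prop :=
  exists f a b, H1 f /\ forall x, u x = f x + a * thetap x + b * thetam x.

Definition E10 (thetap : R -> R) u : Prop :=
  exists f a, f \in Lfun leb 2%:E /\ forall x, u x = f x + a * thetap x.

Definition shift_diff (h : R) f : R -> R := fun x => f (x + h) - f x.

Definition B2 (beta : R) f : Prop :=
  f \in Lfun leb 2%:E /\
  exists C : R, 0 < C /\ forall h, 0 < h <= 2 ->
    (Lpnorm 2%:E (shift_diff h f) <= (C * h `^ beta)%:E)%E.

Definition B2_seminorm (beta : R) f : \bar R :=
  ereal_sup [set ((h `^ (- beta))%:E * Lpnorm 2%:E (shift_diff h f))%E
            | h in `]0, 2]].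

End FunctionSpaces.

Notation finmeas R :=
  {finite_measure set (measurableTypeR R) -> \bar R} (only parsing).

Section EulerianData.
Variable R : realType.
Notation leb := (@lebesgue_measure R).
Implicit Types (u : R -> R) (mu nu mu_ac : finmeas R).

(* Mass of the open half-line, hence left-continuous. *)
Definition cumul mu (x : R) : R := fine (mu `]-oo, x[).

Definition ac_part mu mu_ac : Prop :=
  mu_ac `<< leb /\
  exists mu_s : finmeas R,
    (exists N : set (measurableTypeR R),
        [/\ measurable N, leb N = 0%E & mu_s (~` N) = 0%E]) /\
    forall A : set (measurableTypeR R), measurable A ->
      mu A = (mu_ac A + mu_s A)%E.

(* [mu_ac] is determined by [mu]; it is an argument because the projection
   below uses its distribution function. *)
Definition D0 (thetap thetam : R -> R) u mu nu mu_ac : Prop :=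
  [/\ E2 thetap thetam u,
      (forall A : set (measurableTypeR R), measurable A -> mu A = nu A),
      ac_part mu mu_ac,
      (forall A : set (measurableTypeR R), measurable A ->
         mu_ac A = (\int[leb]_(x in A) ((derive1 u x) ^+ 2)%:E)%E) &
      E10 thetap (cumul mu)].

(* Triplets (u, mu, nu), with the measures replaced by their distribution
   functions. *)
Record euler := Euler { eu : R -> R ; eF : R -> R ; eG : R -> R }.

Definition euler_of u mu nu : euler := Euler u (cumul mu) (cumul nu).

Section Projection.
Variables (dx : R) (s : int -> R) (u F Fac : R -> R).

Definition mesh (j : int) : R := j%:~R * dx.

Definition Dq (f : R -> R) (j : int) : R :=
  (f (mesh (2 * j + 2)) - f (mesh (2 * j))) / (2 * dx).

Definition qd (j : int) : R := Num.sqrt (Dq Fac j - Dq u j ^+ 2).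

(* The j such that x lies in (x_{2j}, x_{2j+2}]. *)
Definition cell (x : R) : int := Num.ceil (x / (2 * dx)) - 1.

Definition proj_u (x : R) : R :=
  let j := cell x in
  if x <= mesh (2 * j + 1)
  then u (mesh (2 * j)) + (Dq u j - s j * qd j) * (x - mesh (2 * j))
  else u (mesh (2 * j + 2)) + (Dq u j + s j * qd j) * (x - mesh (2 * j + 2)).

Definition proj_Fac (x : R) : R :=
  let j := cell x in
  if x <= mesh (2 * j + 1)
  then Fac (mesh (2 * j)) + (Dq u j - s j * qd j) ^+ 2 * (x - mesh (2 * j))
  else (Fac (mesh (2 * j + 2)) + Fac (mesh (2 * j))) / 2
       - 2 * s j * Dq u j * qd j * dx
       + (Dq u j + s j * qd j) ^+ 2 * (x - mesh (2 * j + 1)).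

Definition proj_Fsing (x : R) : R :=
  F (mesh (2 * cell x + 2)) - Fac (mesh (2 * cell x + 2)).

Definition proj_F (x : R) : R := proj_Fac x + proj_Fsing x.

Definition proj_data : euler := Euler proj_u proj_F proj_F.

End Projection.

End EulerianData.

Section Lagrangian.
Variable R : realType.
Notation leb := (@lebesgue_measure R).

Record lagr :=
  Lagr { ly : R -> R ; lU : R -> R ; lV : R -> R ; lH : R -> R }.

Definition Lmap (P : euler R) : lagr :=
  let y xi := sup [set x | x + eG P x < xi] in
  let H xi := xi - y xi in
  Lagr y (fun xi => eu P (y xi)) H H.

Definition Mmap (X : lagr) (u : R -> R) (mu nu : finmeas R) : Prop :=
  [/\ (forall x xi, x = ly X xi -> u x = lU X xi),
      (forall A : set (measurableTypeR R), measurable A ->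
         mu A = (\int[leb]_(xi in ly X @^-1` A) (derive1 (lV X) xi)%:E)%E) &
      (forall A : set (measurableTypeR R), measurable A ->
         nu A = (\int[leb]_(xi in ly X @^-1` A) (derive1 (lH X) xi)%:E)%E)].

Definition tau (X : lagr) (xi : R) : \bar R :=
  if (derive1 (ly X) xi == 0) && (derive1 (lU X) xi == 0) then 0%E
  else if derive1 (lU X) xi < 0
  then (- 2 * derive1 (ly X) xi / derive1 (lU X) xi)%:E
  else +oo%E.

Definition Vinf (X : lagr) : R := lim (lV X xi @[xi --> +oo]).

(* y_t = U, U_t = V/2 - Vinf/4, H_t = 0, integrated from time [a] to time [t]:
   V jumps in time at the breaking times, so that U is in general only
   Lipschitz in time. *)
Definition transport (a t : R) (X : R -> lagr) : Prop :=
  forall xi,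
  [/\ has_integral `[a, t] (fun r => lU (X r) xi) (ly (X t) xi - ly (X a) xi),
      has_integral `[a, t] (fun r => lV (X r) xi / 2 - Vinf (X r) / 4)
                   (lU (X t) xi - lU (X a) xi) &
      lH (X t) xi = lH (X a) xi].

(* The energy remaining at time [t] when the cell eta, if it breaks in the time
   interval (a, t], loses the fraction [loss eta] of its energy at time [a]. *)
Definition energy (a t : R) (br : R -> \bar R) (loss : R -> R)
    (V0 V : R -> R) : Prop :=
  forall xi, has_integral `]-oo, xi]
    (fun eta =>
       (1 - loss eta * (if (a%:E < br eta <= t%:E)%E then 1 else 0))
       * derive1 V0 eta) (V xi).

(* If tau = +oo, the value [fine +oo = 0] is immaterial: no energy is lost. *)
Definition exact_evolution (alpha : R -> R) (Xbar : lagr) (X : R -> lagr)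
  : Prop :=
  X 0 = Xbar /\
  forall t, 0 <= t ->
    transport 0 t X /\
    energy 0 t (tau Xbar)
      (fun eta => alpha (ly (X (fine (tau Xbar eta))) eta))
      (lV Xbar) (lV (X t)).

(* xi_{3j}, xi_{3j+1}, xi_{3j+2}, indexed by a single integer. *)
Definition node (dx : R) (G : R -> R) (i : int) : R :=
  let j := (i %/ 3)%Z in
  if (i %% 3)%Z == 0 then mesh dx (2 * j) + G (mesh dx (2 * j))
  else if (i %% 3)%Z == 1
  then mesh dx (2 * j) + lim (G x @[x --> (mesh dx (2 * j))^'+])
  else mesh dx (2 * j + 1) + G (mesh dx (2 * j + 1)).

Definition tau_half (X : lagr) (nd : int -> R) (j : int) : \bar R :=
  tau X ((nd j + nd (j + 1)) / 2).

Definition time_grid (T : R) (br : int -> \bar R) (ts : seq R) : Prop :=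
  [/\ sorted <%R ts, ohead ts = Some 0, last 0 ts = T &
      forall x, x \in ts -> 0 < x < T -> exists j, br j = x%:E].

Section NumericalStep.
Variables (alpha : R -> R) (dx : R) (Xbar : lagr) (nd : int -> R).
(* [a] and [b] are consecutive points of the time grid. *)
Variables (a b : R).

Definition tolerance : R := dx ^+ 2 / fine (Lpnorm +oo%E (derive1 alpha)).

Definition iterate_eqs (X0 : lagr) (loss : R -> R) (X : R -> lagr) : Prop :=
  X a = X0 /\
  forall t, a <= t <= b ->
    transport a t X /\ energy a t (tau Xbar) loss (lV X0) (lV (X t)).

(* The loss coefficients used for the next iterate, from the iterate [X]. *)
Definition loss_update (X : R -> lagr) (loss : R -> R) : Prop :=
  forall j xi, nd j < xi <= nd (j + 1) ->
    loss xi = if (a%:E < tau_half Xbar nd j <= b%:E)%E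
              then alpha (ly (X b) (nd j)) else 0.

Definition converged (X X' : R -> lagr) : Prop :=
  forall t j, a <= t <= b ->
    `|ly (X t) (nd j) - ly (X' t) (nd j)| <= tolerance.

Definition numerical_step (X : R -> lagr) : Prop :=
  exists (Xn : nat -> R -> lagr) (loss : nat -> R -> R) (M : nat),
  [/\ (2 <= M)%N,
      (forall n, (1 <= n <= M)%N -> iterate_eqs (X a) (loss n) (Xn n)),
      (forall xi, loss 1%N xi = 0) /\
      (forall n, (2 <= n <= M)%N -> loss_update (Xn n.-1) (loss n)),
      converged (Xn M) (Xn M.-1) /\
      (forall n, (2 <= n < M)%N -> ~ converged (Xn n) (Xn n.-1)) &
      forall t, a < t <= b -> X t = Xn M t].

End NumericalStep.

Definition numerical_evolution (alpha : R -> R) (T dx : R) (P : euler R)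
    (ts : seq R) (X : R -> lagr) : Prop :=
  let Xbar := Lmap P in
  let nd := node dx (eG P) in
  ((exists c, forall x, alpha x = c) -> exact_evolution alpha Xbar X) /\
  (~ (exists c, forall x, alpha x = c) ->
   [/\ time_grid T (tau_half Xbar nd) ts,
       X 0 = Xbar &
       forall k, (k.+1 < size ts)%N ->
         numerical_step alpha dx Xbar nd ts`_k ts`_k.+1 X]).

(* The rule by which the scheme extracts the time grid, given alpha, T, dx and
   the projected initial data. *)
Definition grid_rule := (R -> R) -> R -> R -> euler R -> seq R.

Definition dissipative_solution (alpha u0 : R -> R) (mu0 nu0 : finmeas R)
    (u : R -> R -> R) (mu nu : R -> finmeas R) : Prop :=
  exists X, exact_evolution alpha (Lmap (euler_of u0 mu0 nu0)) X /\
    forall t, 0 <= t -> Mmap (X t) (u t) (mu t) (nu t).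

Definition numerical_solution (grid : grid_rule) (alpha : R -> R) (T dx : R)
    (P : euler R) (u : R -> R -> R) (mu nu : R -> finmeas R) : Prop :=
  exists X, numerical_evolution alpha T dx P (grid alpha T dx P) X /\
    forall t, 0 <= t <= T -> Mmap (X t) (u t) (mu t) (nu t).

Definition local_error_estimate (thetap thetam : R -> R) (grid : grid_rule)
  : Prop :=
  forall A U0 G0 T : R, 0 < T ->
  exists C : R,
  forall (alpha u0 : R -> R) (mu0 nu0 mu0_ac : finmeas R),
    W1infty alpha -> (forall x, 0 <= alpha x < 1) ->
    D0 thetap thetam u0 mu0 nu0 mu0_ac ->
    Lpnorm +oo%E (derive1 alpha) = A%:E -> Lpnorm +oo%E u0 = U0%:E ->
    nu0 setT = G0%:E ->
  forall (dx : R) (s : int -> R), 0 < dx <= 1 ->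
    (forall j, s j = 1 \/ s j = -1) ->
  forall Xhat X : R -> lagr,
    let P := proj_data dx s u0 (cumul mu0) (cumul mu0_ac) in
    exact_evolution alpha (Lmap P) Xhat ->
    numerical_evolution alpha T dx P (grid alpha T dx P) X ->
  forall t, 0 <= t <= T ->
    (Lpnorm +oo%E (ly (Xhat t) \- ly (X t))%R
     + Lpnorm +oo%E (lU (Xhat t) \- lU (X t))%R <= (C * dx `^ (1 / 4))%:E)%E.

End Lagrangian.

(* Main.v *)
(* Let L(x) be the fraction of its energy that the particle starting from x loses
   when it breaks. Once L is known, the Lagrangian system is integrated in time
   by Tonelli's theorem: y(t, xi) and U(t, xi) are explicit in terms of the
   initial data and of integrals, over the x to the left of the initial position
   of xi, of L(x) times a quadratic function of the initial slope. Exact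
   evolutions are thus the fixed points of L(x) = alpha(y(tau(x), x + F(x))).
   With the weight exp(lambda tau) this map is a contraction, which gives the
   exact evolution of the projected data, and, by the same estimate, compares it
   with the one of the original data. Besov regularity yields
   ||v - w||_2 = O(dx^beta) for the slopes v, w of the data and of their
   projection, and an energy O(|I|^(1/2) + |I|^beta) of v on short intervals I;
   hence the two exact evolutions differ by O(dx^(1/2) + dx^beta). The local
   error estimate holds for every label since the numerical evolution is
   continuous in the label. Finally u(t, .) is 1/2-Hoelder continuous, so that
   errors on the characteristics enter through their square root. *)

(* The assumption on the scheme compares the numerical evolution with an exact evolution of the
   projected data, which is not given: it has to be constructed before the assumption says anything.
   The loss of a particle depends on its position at breaking, hence on the losses at earlier
   breaking times. The kernel of this dependence is [ppart t (v x) ^+ 2 / 2], which after the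
   breaking time tau is [v x ^+ 2 * (t - tau) ^+ 2 / 2]. Against exp(lambda tau) it gains a factor
   lambda^-2, so that a large lambda gives a contraction on time intervals of any length. Singular
   energy has breaking time 0 and is never dissipated; losses can therefore be indexed by the
   position x instead of the label. Breaking times -2/v are singular at v = 0. But only slopes below
   -2/T break before T, and every loss carries the factor v^2; the difference of breaking times thus
   turns into |v| |v - w|, which is linear in v - w and integrable by the L^2 bound. As for the
   exponents, the square root of the local error dx^(1/4) is dx^(1/8), and that of dx^beta is
   dx^(beta/2), at most dx^(beta/4) because dx <= 1. *)
Require Import Defs.
From HB Require Import structures.
From mathcomp Require Import all_boot all_order all_algebra.
From mathcomp Require Import all_classical all_reals all_analysis.
From mathcomp Require Import ring lra measurable_realfun ess_sup_inf.
Import Order.TTheory GRing.Theory Num.Theory.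
Import numFieldNormedType.Exports.
Local Open Scope ring_scope.
Local Open Scope classical_set_scope.
Set Implicit Arguments.
Unset Strict Implicit.
Unset Printing Implicit Defensive.

(* [R] carries two convertible Borel structures in the library; these notations
   fix the one on which [lebesgue_measure] is defined. *)
Notation mset D := (@measurable _ (measurableTypeR _) D).
Notation mfun D f := (@measurable_fun _ _ (measurableTypeR _) (measurableTypeR _) D f).
Notation leb := (@lebesgue_measure _).

(** * Integrals and primitives *)

Section Ae.
Variable R : realType.
Implicit Types P Q : R -> Prop.

Lemma aeS P Q : (forall x, P x -> Q x) ->
  {ae (@lebesgue_measure R), forall x, P x} -> {ae (@lebesgue_measure R), forall x, Q x}.
Proof. by move=> PQ; apply: filterS; first exact: (ae_filter_ringOfSetsType (@lebesgue_measure R)). Qed.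

Lemma aeI P Q : {ae (@lebesgue_measure R), forall x, P x} ->
  {ae (@lebesgue_measure R), forall x, Q x} ->
  {ae (@lebesgue_measure R), forall x, P x /\ Q x}.
Proof. by move=> hP hQ; apply: filterI; first exact: (ae_filter_ringOfSetsType (@lebesgue_measure R)). Qed.

Lemma aeT P : (forall x, P x) -> {ae (@lebesgue_measure R), forall x, P x}.
Proof. by move=> h; exact: aeW. Qed.

End Ae.

Lemma mfunS (R : realType) (D E : set R) (f : R -> R) : mset E -> D `<=` E ->
  mfun E f -> mfun D f.
Proof. exact: measurable_funS. Qed.

Section HasIntegral.
Variable R : realType.
Implicit Types (f g : R -> R) (D : set R).

Lemma has_integral_EFin D f v : mset D -> has_integral D f v ->
  (\int[leb]_(x in D) (f x)%:E)%E = v%:E.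
Proof.
move=> mD [fi ->]; rewrite /Rintegral fineK//.
exact: integrable_fin_num.
Qed.

Lemma has_integral_measurable D f v : has_integral D f v -> mfun D f.
Proof. by move=> [/measurable_int/measurable_EFinP]. Qed.

Lemma has_integral_ge0P D f v : mset D -> mfun D f ->
  (forall x, D x -> 0 <= f x) ->
  (\int[leb]_(x in D) (f x)%:E)%E = v%:E -> has_integral D f v.
Proof.
move=> mD mf f0 fv; split; last by rewrite /Rintegral fv.
apply/integrableP; split; first exact/measurable_EFinP.
rewrite (@eq_integral _ _ _ (@lebesgue_measure R) _ (fun x => (f x)%:E)) ?fv ?ltry// => x /set_mem Dx /=.
by rewrite ger0_norm// f0.
Qed.

Lemma has_integral_uniq D f v w : has_integral D f v -> has_integral D f w -> v = w.
Proof. by move=> [_ ->] [_ ->]. Qed.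

Lemma has_integral_eq D f g v : mset D -> (forall x, D x -> f x = g x) ->
  has_integral D f v -> has_integral D g v.
Proof.
move=> mD fg [fi ->]; split.
  by apply: eq_integrable fi => // x /set_mem Dx; rewrite /= fg.
by apply: eq_Rintegral => x /set_mem Dx; rewrite fg.
Qed.

(** Measurability is Borel measurability, which does not pass to functions that are equal almost
    everywhere; hence the assumption on [g]. *)
Lemma has_integral_ae D f g v : mset D -> mfun D g ->
  {ae leb, forall x, D x -> f x = g x} ->
  has_integral D f v -> has_integral D g v.
Proof.
move=> mD mg fg fv; have mf := has_integral_measurable fv.
have aefg : ae_eq leb D (EFin \o f) (EFin \o g).
  by apply: aeS fg => x h Dx /=; rewrite h.
split.
  apply/integrableP; split; first exact/measurable_EFinP.
  case: fv => /integrableP[_ +] _.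
  rewrite (ae_eq_integral (mu:=leb) (abse \o (EFin \o g))) //.
    by apply: measurableT_comp => //; exact/measurable_EFinP.
    by apply: measurableT_comp => //; exact/measurable_EFinP.
  by apply: aeS fg => x h Dx /=; rewrite h.
rewrite /Rintegral -(ae_eq_integral (mu:=leb) _ _ mD _ _ aefg).
- by rewrite (has_integral_EFin mD fv).
- exact/measurable_EFinP.
- exact/measurable_EFinP.
Qed.

Lemma has_integralD D f g v w : mset D -> has_integral D f v ->
  has_integral D g w -> has_integral D (fun x => f x + g x) (v + w).
Proof.
move=> mD [fi ->] [gi ->]; split; last by rewrite RintegralD.
exact: (integrableD (mu:=leb) mD fi gi).
Qed.

Lemma has_integralZ D f v k : mset D -> has_integral D f v ->
  has_integral D (fun x => k * f x) (k * v).
Proof.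
move=> mD [fi ->]; split; last by rewrite RintegralZl.
exact: (integrableZl (mu:=leb) mD k fi).
Qed.

Lemma has_integralB D f g v w : mset D -> has_integral D f v ->
  has_integral D g w -> has_integral D (fun x => f x - g x) (v - w).
Proof.
move=> mD [fi ->] [gi ->]; split; last by rewrite RintegralB.
exact: (integrableB (mu:=leb) mD fi gi).
Qed.

Lemma has_integral_le D f g v w : mset D -> has_integral D f v ->
  has_integral D g w -> {ae leb, forall x, D x -> f x <= g x} -> v <= w.
Proof.
move=> mD fv gw fg.
suff: 0 <= w - v by rewrite subr_ge0.
have h := has_integralB mD gw fv.
have mh := has_integral_measurable h.
(* The truncation is nonnegative everywhere and differs from [g - f] on a null set only. *)
have hk : has_integral D (fun x => Num.max 0 (g x - f x)) (w - v).
  apply: has_integral_ae h => //.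
    exact: measurable_maxr.
  by apply: aeS fg => x xfg Dx; rewrite max_r// subr_ge0 xfg.
have [_ ->] := hk; apply: Rintegral_ge0 => x _.
by rewrite le_max lexx.
Qed.

Lemma has_integral_leT D f g v w : mset D -> has_integral D f v ->
  has_integral D g w -> (forall x, D x -> f x <= g x) -> v <= w.
Proof. by move=> mD fv gw fg; apply: has_integral_le fv gw _ => //; exact: aeW. Qed.

Lemma has_integral_ge0 D f v : has_integral D f v -> (forall x, D x -> 0 <= f x) ->
  0 <= v.
Proof. by move=> [_ ->] f0; apply: Rintegral_ge0. Qed.

Lemma has_integral_dom D f g w : mset D -> mfun D f ->
  has_integral D g w -> (forall x, D x -> `|f x| <= g x) ->
  exists v, has_integral D f v /\ `|v| <= w.
Proof.
move=> mD mf gw fg.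
have fi : leb.-integrable D (EFin \o f).
  apply: (le_integrable (mu:=leb) mD _ _ gw.1); first exact/measurable_EFinP.
  move=> x Dx /=; rewrite lee_fin (le_trans (fg x Dx))// ler_norm//.
exists (\int[leb]_(x in D) f x); split => //.
have fv : has_integral D f (\int[leb]_(x in D) f x) by split.
rewrite ler_norml; apply/andP; split.
  have : has_integral D (fun x => -1 * g x) (-1 * w) by exact: has_integralZ.
  move=> gN; rewrite mulN1r in gN; apply: (has_integral_leT mD gN fv) => x Dx.
  by rewrite mulN1r; have := fg x Dx; rewrite ler_norml => /andP[].
apply: (has_integral_leT mD fv gw) => x Dx.
by rewrite (le_trans _ (fg x Dx))// ler_norm.
Qed.

Lemma has_integralS D E f v : mset D -> mset E -> E `<=` D ->
  has_integral D f v -> exists w, has_integral E f w.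
Proof.
move=> mD mE ED [fi _]; exists (\int[leb]_(x in E) f x); split => //.
exact: (integrableS (mu:=leb) mD mE ED).
Qed.

Lemma has_integralS_ge0 D E f v : mset D -> mset E -> E `<=` D ->
  (forall x, D x -> 0 <= f x) ->
  has_integral D f v -> exists w, [/\ has_integral E f w, 0 <= w & w <= v].
Proof.
move=> mD mE ED f0 fv; have [w fw] := has_integralS mD mE ED fv.
exists w; split=> //; first by apply: has_integral_ge0 fw _ => x /ED/f0.
rewrite -lee_fin -(has_integral_EFin mD fv) -(has_integral_EFin mE fw).
apply: ge0_subset_integral => //.
by apply/measurable_EFinP; exact: has_integral_measurable fv.
Qed.

Lemma has_integralU D E f v w : mset D -> mset E -> [disjoint D & E] ->
  has_integral D f v -> has_integral E f w -> has_integral (D `|` E) f (v + w).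
Proof.
move=> mD mE DE fv fw.
have mf : mfun (D `|` E) f.
  apply/measurable_funU => //; split; [exact: has_integral_measurable fv|exact: has_integral_measurable fw].
have fi : leb.-integrable (D `|` E) (EFin \o f).
  apply/integrableP; split; first exact/measurable_EFinP.
  rewrite ge0_integral_setU//.
    by case: fv => /integrableP[_ h1] _; case: fw => /integrableP[_ h2] _; exact: lte_add_pinfty.
  by apply: measurableT_comp => //; exact/measurable_EFinP.
split => //; rewrite Rintegral_setU//.
by case: fv => _ ->; case: fw => _ ->.
Qed.

Lemma has_integral_mkcond D f v : mset D ->
  has_integral D f v <-> has_integral setT (fun x => f x * \1_D x) v.
Proof.
move=> mD.
have E : (EFin \o (fun x => f x * \1_D x)) = (EFin \o f) \_ D.
  apply/funext => x; rewrite /patch /= indicE.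
  by case: (x \in D); rewrite ?mulr1 ?mulr0.
split => -[h1 h2]; split.
- by rewrite E; apply/(integrable_mkcond (mu:=leb) (EFin \o f) mD).
- by rewrite h2 /Rintegral integral_mkcond -E.
- by apply/(integrable_mkcond (mu:=leb) (EFin \o f) mD); rewrite -E.
- by rewrite h2 /Rintegral [in RHS]integral_mkcond -E.
Qed.

Lemma has_integral_cst (a b k : R) : a <= b -> has_integral `[a, b] (fun=> k) (k * (b - a)).
Proof.
move=> ab.
have h1 : has_integral `[a, b] (fun=> 1) (b - a).
  apply: has_integral_ge0P => //.
  transitivity (1%E * leb `[a, b])%E; first exact: (integral_cst (@lebesgue_measure R) _ 1%E).
  rewrite lebesgue_measure_itv/= lte_fin.
  by case: ltrgtP ab => // [|->]; rewrite ?mul1e ?mule0 ?subrr.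
have := has_integralZ k (measurable_itv _) h1.
by apply: has_integral_eq => //= x _; rewrite mulr1.
Qed.

Lemma has_integral_null D f : mset D -> leb D = 0%E -> mfun D f ->
  has_integral D f 0.
Proof.
move=> mD D0 mf; split.
  by apply: null_set_integrable => //; exact/measurable_EFinP.
by rewrite /Rintegral null_set_integral//; exact/measurable_EFinP.
Qed.

Lemma has_integral_setae D E f v : mset D -> mset E -> mfun E f ->
  {ae (@lebesgue_measure R), forall x, D x <-> E x} ->
  has_integral D f v -> has_integral E f v.
Proof.
move=> mD mE mf DE /(has_integral_mkcond _ _ mD) h.
apply/(has_integral_mkcond _ _ mE); apply: has_integral_ae h => //.
  have -> : (fun x => f x * \1_E x) = f \_ E.
    by apply/funext => x; rewrite /patch indicE; case: (x \in E); rewrite ?mulr1 ?mulr0.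
  exact/(measurable_restrictT _ mE).
apply: aeS DE => x [DE ED] _; rewrite !indicE; congr (_ * (nat_of_bool _)%:R).
by apply/idP/idP => /set_mem ?; apply/mem_set; [exact: DE|exact: ED].
Qed.

Lemma ae_neq (a : R) : {ae (@lebesgue_measure R), forall x, x <> a}.
Proof.
exists [set a]; split => //; first exact: lebesgue_measure_set1.
by move=> x /= /contrapT ->.
Qed.

Lemma has_integral_itvcc_co (a b v : R) f :
  has_integral `[a, b] f v -> has_integral `[a, b[ f v.
Proof.
move=> h; have := has_integral_measurable h => mf; apply: has_integral_setae h => //.
  by apply: mfunS mf => // x /=; rewrite !in_itv/= => /andP[-> /ltW].
by apply: aeS (ae_neq b) => x xb /=; rewrite !in_itv/= lt_neqAle; move/eqP : xb => ->.
Qed.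

Lemma has_integral_itvco_cc (a b v : R) f : mfun setT f ->
  has_integral `[a, b[ f v -> has_integral `[a, b] f v.
Proof.
move=> mf h; apply: has_integral_setae h => //.
  by apply: measurable_funS mf.
by apply: aeS (ae_neq b) => x xb /=; rewrite !in_itv/= lt_neqAle; move/eqP : xb => ->.
Qed.

Lemma has_integral_itvNy_co (a v : R) f :
  has_integral `]-oo, a] f v -> has_integral `]-oo, a[ f v.
Proof.
move=> h; have := has_integral_measurable h => mf; apply: has_integral_setae h => //.
  by apply: mfunS mf => // x /=; rewrite !in_itv/= => /ltW.
by apply: aeS (ae_neq a) => x xb /=; rewrite !in_itv/= lt_neqAle; move/eqP : xb => ->.
Qed.

Lemma itv_cat_co (a b c : R) : a <= b -> b <= c -> `[a, c[%classic = `[a, b[ `|` `[b, c[ :> set R.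
Proof.
move=> ab bc; apply/seteqP; split => x /=; rewrite !in_itv/=.
  by case: (ltP x b) => xb /andP[h1 h2]; [left|right]; apply/andP.
case => /andP[h1 h2]; apply/andP; split => //.
  exact: lt_le_trans bc.
exact: le_trans h1.
Qed.

Lemma itv_disj_co (a b c : R) : [disjoint (`[a, b[ : set R) & (`[b, c[ : set R)].
Proof.
apply/disj_setPS => x [] /=; rewrite !in_itv/= => /andP[_ h1] /andP[h2 _].
by move: (lt_le_trans h1 h2); rewrite ltxx.
Qed.

Lemma has_integral_cat_co (a b c v w : R) f : a <= b -> b <= c ->
  has_integral `[a, b[ f v -> has_integral `[b, c[ f w -> has_integral `[a, c[ f (v + w).
Proof.
move=> ab bc fv fw; rewrite (itv_cat_co ab bc); apply: has_integralU => //.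
exact: itv_disj_co.
Qed.

Lemma has_integral_catNy (a b v w : R) f : a <= b ->
  has_integral `]-oo, a[ f v -> has_integral `[a, b[ f w -> has_integral `]-oo, b[ f (v + w).
Proof.
move=> ab fv fw.
have -> : `]-oo, b[%classic = `]-oo, a[ `|` `[a, b[ :> set R.
  apply/seteqP; split => x /=; rewrite !in_itv/=.
    by case: (ltP x a) => xa h; [left|right].
  by case => [h|/andP[]//]; exact: lt_le_trans ab.
apply: has_integralU => //.
apply/disj_setPS => x [] /=; rewrite !in_itv/= => h1 /andP[h2 _].
by move: (lt_le_trans h1 h2); rewrite ltxx.
Qed.

(** Monotone convergence; integrability over the union is a conclusion, drawn from the finiteness of
    the limit. *)
Lemma has_integral_lim (E : nat -> set (measurableTypeR R)) D f (v : nat -> R) w :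
  (forall n, mset (E n)) -> nondecreasing_seq E -> \bigcup_n E n = D ->
  mfun D f -> (forall x, D x -> 0 <= f x) ->
  (forall n, has_integral (E n) f (v n)) -> v @ \oo --> w -> has_integral D f w.
Proof.
move=> mE ndE ED mf f0 hE vw.
have mD : mset D by rewrite -ED; exact: bigcup_measurable.
have sub n : E n `<=` D by rewrite -ED; exact: bigcup_sup.
have := @ge0_nondecreasing_set_cvg_integral _ _ _ E (EFin \o f) (@lebesgue_measure R) ndE mE.
have mEf n : measurable_fun (E n) (EFin \o f).
  by apply/measurable_EFinP; exact: has_integral_measurable (hE n).
have E0 n x : E n x -> (0 <= (EFin \o f) x)%E by move=> /sub Dx; rewrite lee_fin f0.
move=> /(_ mEf E0); rewrite ED.
under eq_fun => n do rewrite (has_integral_EFin (mE n) (hE n)).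
move=> h; apply: has_integral_ge0P => //.
have h2 : (v n)%:E @[n --> \oo] --> w%:E by apply: cvg_EFin; [exact: nearW|].
exact: cvg_unique h h2.
Qed.

Lemma has_integral_bound (E : nat -> set (measurableTypeR R)) D f (w : R) :
  (forall n, mset (E n)) -> nondecreasing_seq E -> \bigcup_n E n = D ->
  mfun D f -> (forall x, D x -> 0 <= f x) ->
  (forall n, exists v, has_integral (E n) f v /\ v <= w) ->
  exists v, [/\ has_integral D f v, 0 <= v & v <= w].
Proof.
move=> mE ndE ED mf f0 /choice[v hv].
have hE n : has_integral (E n) f (v n) by have [] := hv n.
have mD : mset D by rewrite -ED; exact: bigcup_measurable.
have sub n : E n `<=` D by rewrite -ED; exact: bigcup_sup.
have vnd : nondecreasing_seq v.
  move=> n m nm; rewrite -lee_fin -(has_integral_EFin (mE n) (hE n)) -(has_integral_EFin (mE m) (hE m)).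
  apply: ge0_subset_integral => //.
  - by apply/measurable_EFinP; exact: has_integral_measurable (hE m).
  - by move=> x /sub Dx; rewrite lee_fin f0.
  - by apply/subsetPset; exact: ndE.
have vub : has_ubound (range v) by exists w => _ [n _ <-]; have [] := hv n.
have vc := nondecreasing_is_cvgn vnd vub.
exists (limn v); have hl : has_integral D f (limn v) by exact: (has_integral_lim mE ndE ED).
split => //; first exact: has_integral_ge0 hl _.
by apply: limr_le => //; apply: nearW => n; have [] := hv n.
Qed.

Lemma bigcup_itv_nat (T : R -> set R) : (forall r : R, `]-r, r[ `<=` T r) ->
  \bigcup_(n : nat) T n%:R = setT.
Proof.
move=> hT; apply/seteqP; split => // x _.
exists (Num.bound `|x|) => //; apply: hT; rewrite /= in_itv/= -ltr_norml.
exact/archi_boundP.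
Qed.

Lemma primitive_measurable (h F : R -> R) :
  (forall a b, a <= b -> has_integral `[a, b] h (F b - F a)) -> mfun setT h.
Proof.
move=> hF; rewrite -(@bigcup_itv_nat (fun r => `[-r, r])); last first.
  by move=> r; exact: subset_itvW.
apply/measurable_fun_bigcup => // n; apply: has_integral_measurable.
by apply: (hF (- n%:R)); have : 0 <= n%:R :> R by []; lra.
Qed.

Lemma primitive_locally_integrable (h F : R -> R) :
  (forall a b, a <= b -> has_integral `[a, b] h (F b - F a)) ->
  locally_integrable setT h.
Proof.
move=> hF; have mh := primitive_measurable hF.
split => //; first exact: openT.
move=> K _ cK; have [M [Mr hM]] := compact_bounded cK.
have hK : K `<=` `[- (`|M| + 1), `|M| + 1].
  by move=> x Kx; rewrite /= in_itv/= -ler_norml; apply: hM Kx; rewrite ltr_pwDr// ler_norm.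
apply: (@le_lt_trans _ _ (\int[leb]_(x in `[(- (`|M| + 1))%R, (`|M| + 1)%R]) `|(h x)%:E|)%E).
  apply: ge0_subset_integral => //; first exact: compact_measurable.
  by apply/measurable_EFinP; apply: measurableT_comp => //; exact: mfunS mh.
have /hF[/integrableP[_]] : - (`|M| + 1) <= `|M| + 1 by have := normr_ge0 M; lra.
by [].
Qed.

Lemma near_shift_derive1 (f g : R -> R) c x : derivable f x 1 ->
  {near x, (fun y => f y + c) =1 g} -> derivable g x 1 /\ derive1 g x = derive1 f x.
Proof.
move=> df fg; have d : is_derive x 1 (fun y => f y + c) (derive1 f x + 0).
  by apply: is_deriveD; rewrite derive1E; exact: derivableP.
have [dg gE] := near_eq_is_derive fg d; split => //.
by rewrite derive1E gE addr0.
Qed.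

(** Almost every x is a Lebesgue point of [h], and near x the function [F] differs by a constant
    from the integral of [h] started at x - 1. *)
Lemma ae_derive1 (h F : R -> R) :
  (forall a b, a <= b -> has_integral `[a, b] h (F b - F a)) ->
  {ae (@lebesgue_measure R), forall x, derivable F x 1 /\ derive1 F x = h x}.
Proof.
move=> hF; have := lebesgue_differentiation (primitive_locally_integrable hF).
apply: aeS => x lx.
have [hi _] : has_integral `[x - 1, x + 1] h (F (x + 1) - F (x - 1)) by apply: hF; lra.
have x1 : x < x + 1 by lra.
have xb : (BLeft (x - 1)%R < BRight x)%E by rewrite /Order.lt/=; lra.
have [dG G'] := FTC1_lebesgue_pt x1 hi xb lx.
set G := (fun y : R => _) in dG G'.
have FG : {near x, (fun y => G y + F (x - 1)) =1 F}.
  near=> y; rewrite /G.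
  have [] // := hF (x - 1) y; last by move=> _ <-; rewrite subrK.
  near: y; exists 1 => //= z; rewrite /ball_/= ltr_norml => /andP[_ ?]; lra.
by have := near_shift_derive1 dG FG; rewrite G'.
Unshelve. all: by end_near. Qed.

End HasIntegral.

(** * Measures with a density and their uniqueness on half-open intervals *)

Section Density.
Variable R : realType.
Variable w : R -> R.
Hypotheses (mw : mfun setT w) (w0 : forall x, 0 <= w x).

(** The two assumptions are arguments so that the term determines its measure structure, whose
    axioms rely on them. *)
Definition density (_ : mfun setT w) (_ : forall x, 0 <= w x)
    (S : set (measurableTypeR R)) : \bar R :=
  (\int[@lebesgue_measure R]_(x in S) (w x)%:E)%E.

Let density0 : density mw w0 set0 = 0%E.
Proof. by rewrite /density integral_set0. Qed.

Let density_ge0 S : (0 <= density mw w0 S)%E.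
Proof. by apply: integral_ge0 => x _; rewrite lee_fin. Qed.

Let density_sigma_additive : semi_sigma_additive (density mw w0).
Proof.
move=> /= F mF tF mUF; rewrite /density; apply: cvg_toP.
  apply: ereal_nondecreasing_is_cvgn => m n mn.
  by apply: lee_sum_nneg_natr => // k _ _; exact: density_ge0.
rewrite ge0_integral_bigcup//=.
- by apply/measurable_EFinP; exact: mfunS mw.
- by move=> x _; rewrite lee_fin.
Qed.

HB.instance Definition _ := isMeasure.Build _ _ _ (density mw w0)
  density0 density_ge0 density_sigma_additive.

Let integral_density_indic E : mset E ->
  (\int[density mw w0]_x (\1_E x)%:E = \int[@lebesgue_measure R]_x ((\1_E x)%:E * (w x)%:E))%E.
Proof.
move=> mE; rewrite integral_indic//= setIT /density integral_mkcond.
apply: eq_integral => x _; rewrite patchE indicE.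
by case: (x \in E); rewrite ?mul1e ?mul0e.
Qed.

Import HBNNSimple.

Let integral_density_nnsfun (f : {nnsfun (measurableTypeR R) >-> R}) :
  (\int[density mw w0]_x (f x)%:E = \int[@lebesgue_measure R]_x ((f x)%:E * (w x)%:E))%E.
Proof.
have mwE : measurable_fun setT (fun x : measurableTypeR R => (w x)%:E).
  exact/measurable_EFinP.
under [LHS]eq_integral do rewrite fimfunE -fsumEFin//.
rewrite [LHS]ge0_integral_fsum//; last 2 first.
  - by move=> r; exact/measurable_EFinP/measurableT_comp.
  - by move=> n x _; rewrite EFinM nnfun_muleindic_ge0.
under [RHS]eq_integral.
  move=> x xD; rewrite fimfunE -fsumEFin// ge0_mule_fsuml; last first.
    by move=> r; rewrite EFinM nnfun_muleindic_ge0.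
  over.
rewrite [RHS]ge0_integral_fsum//; last 2 first.
  - move=> r; apply: emeasurable_funM => //.
    by apply/measurable_EFinP; apply/measurableT_comp => //.
  - move=> n x _; rewrite mule_ge0//; last by rewrite lee_fin.
    by rewrite EFinM nnfun_muleindic_ge0.
apply: eq_fsbigr => r _.
rewrite integralZl_indic_nnsfun//= integral_density_indic//.
have [r0|r0] := leP 0 r; last first.
  have -> : f @^-1` [set r] = set0.
    by apply/seteqP; split => // x /= fr; move: r0; rewrite -fr ltNge => /negP; apply.
  under eq_integral do rewrite indic0 mul0e.
  rewrite integral0 mule0; under [RHS]eq_integral do rewrite indic0 mulr0 mul0e.
  by rewrite integral0.
rewrite -ge0_integralZl//.
- by apply: eq_integral => x _; rewrite muleA -EFinM.
- apply: emeasurable_funM => //; exact/measurable_EFinP/measurable_indic.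
- by move=> x _; rewrite mule_ge0// lee_fin.
Qed.

Lemma integral_density (f : R -> \bar R) :
  measurable_fun (setT : set (measurableTypeR R)) f -> (forall x, 0 <= f x)%E ->
  (\int[density mw w0]_x f x = \int[@lebesgue_measure R]_x (f x * (w x)%:E))%E.
Proof.
move=> mf f0.
have mwE : measurable_fun setT (fun x : measurableTypeR R => (w x)%:E).
  exact/measurable_EFinP.
pose f_ := nnsfun_approx measurableT mf.
transitivity (lim (\int[density mw w0]_x (f_ n x)%:E @[n --> \oo])%E).
  rewrite -monotone_convergence//=.
  - apply: eq_integral => ? /[!inE] xD; apply/esym/cvg_lim => //=.
    exact: cvg_nnsfun_approx.
  - by move=> n; exact/measurable_EFinP/measurable_funTS.
  - by move=> n ? _; rewrite lee_fin.
  - by move=> ? _ ? ? mn; rewrite lee_fin; exact/lefP/nd_nnsfun_approx.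
rewrite [RHS](_ : _ = lim
    (\int[@lebesgue_measure R]_x ((f_ n x)%:E * (w x)%:E) @[n --> \oo])%E); last first.
  rewrite -monotone_convergence//=.
  - apply: eq_integral => x _; apply/esym/cvg_lim => //=.
    apply: cvgeMr => //; exact: cvg_nnsfun_approx.
  - by move=> n; apply: emeasurable_funM => //; exact/measurable_EFinP/measurable_funTS.
  - by move=> n ? _; rewrite mule_ge0// lee_fin.
  - by move=> x _ m n mn; rewrite lee_wpmul2r ?lee_fin//; exact/lefP/nd_nnsfun_approx.
by apply: congr_lim; apply/funext => n /=; exact: integral_density_nnsfun.
Qed.

End Density.

(** The formula 1/f = f exp(- ln f^2) also holds where f vanishes, both sides being 0 there. *)
Lemma mfunV (R : realType) (f : R -> R) : mfun setT f -> mfun setT (fun x => (f x)^-1).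
Proof.
move=> mf; rewrite (_ : (fun x => (f x)^-1) = (fun x => f x * expR (- ln (f x ^+ 2)))).
  apply: measurable_funM => //; apply: measurableT_comp => //.
  apply: measurableT_comp => //; apply: measurableT_comp => //.
  exact: measurable_funX.
apply/funext => x; have [->|f0] := eqVneq (f x) 0; first by rewrite invr0 mul0r.
rewrite expRN lnK ?posrE ?exprn_even_gt0//.
by rewrite expr2 invfM mulrA divff// mul1r.
Qed.

Section HalfOpen.
Variable R : realType.

(** Intervals [[a, b[] are the convenient pi-system: distribution functions are taken over open
    half-lines, so that their increments are the masses of such intervals. *)
Lemma measure_unique_co (m1 m2 : {measure set (measurableTypeR R) -> \bar R}) :
  (forall a b : R, a <= b -> m1 `[a, b[ = m2 `[a, b[) ->
  (forall a b : R, (m1 `[a, b[ < +oo)%E) ->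
  forall A, mset A -> m1 A = m2 A.
Proof.
move=> m12 m1fin.
pose G : set (set R) := [set A | exists a b : R, A = `[a, b[%classic].
have GE : @measurable _ (measurableTypeR R) = <<s G >>.
  apply/seteqP; split.
    have -> : @measurable _ (measurableTypeR R) = (@RGenCInfty.G R).-sigma.-measurable.
      exact: RGenCInfty.measurableE.
    apply: smallest_sub; first exact: smallest_sigma_algebra.
    move=> _ [x ->].
    have -> : `[x, +oo[%classic = \bigcup_n `[x, x + n%:R[%classic :> set R.
      apply/seteqP; split => y /=; last by move=> [n _] /=; rewrite !in_itv/= => /andP[->].
      rewrite in_itv/= andbT => xy; exists (Num.bound (y - x)) => //=.
      rewrite in_itv/= xy/= -ltrBlDl; apply: archi_boundP; by rewrite subr_ge0.
    apply: sigma_algebra_bigcup => i; apply: sub_sigma_algebra.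
    by exists x, (x + i%:R).
  apply: smallest_sub; first exact: sigma_algebra_measurable.
  by move=> _ [a [b ->]]; exact: measurable_itv.
apply: (@measure_unique _ R (measurableTypeR R) G (fun n => `[- n%:R, n%:R[%classic)) => //.
- move=> _ _ [a [b ->]] [c [d ->]].
  exists (Num.max a c), (Num.min b d).
  by apply/seteqP; split => x /=; rewrite !in_itv/= ge_max lt_min;
    [case=> /andP[-> ->] /andP[-> ->]|move=> /andP[/andP[-> ->] /andP[-> ->]]].
- by move=> n; exists (- n%:R), n%:R.
- by apply: (bigcup_itv_nat (T:=fun r => `[-r, r[%classic)) => r x /=; rewrite !in_itv/= => /andP[/ltW-> ->].
- move=> _ [a [b ->]].
  have [ab|ba] := leP a b; first exact: m12.
  by rewrite set_itv_ge ?measure0// -leNgt bnd_simp ltW.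
Qed.

End HalfOpen.

(** * Initial data in Lagrangian coordinates *)

(* A function [u] with derivative [v] and a bounded function [F] of total mass
   [G0] whose measure is [v^2 dx] plus the singular measure [ms] carried by the
   null set [N]. *)
Record hs_data (R : realType) (u v F : R -> R) (G0 : R)
  (ms : {finite_measure set (measurableTypeR R) -> \bar R}) (N : set R) : Prop := {
  hs_mv : mfun setT v ;
  hs_u : forall a b, a <= b -> has_integral `[a, b] v (u b - u a) ;
  hs_F : forall a b, a <= b ->
    ((F b - F a)%:E = \int[@lebesgue_measure R]_(x in `[a, b[) (v x ^+ 2)%:E + ms `[a, b[)%E ;
  hs_F_ge0 : forall x, 0 <= F x ;
  hs_F_le : forall x, F x <= G0 ;
  hs_Fy : forall e, 0 < e -> exists x, G0 - e < F x ;
  hs_FNy : forall e, 0 < e -> exists x, F x < e ;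
  hs_mN : mset N ;
  hs_N0 : leb N = 0%E ;
  hs_msN : ms (~` N) = 0%E
}.

Section Inverse.
Variable R : realType.
Variables (u v F : R -> R) (G0 : R).
Variable ms : {finite_measure set (measurableTypeR R) -> \bar R}.
Variable N : set R.
Hypothesis hd : hs_data u v F G0 ms N.

(** The first component of [Lmap], that is, the generalized inverse of the strictly increasing map
    [x + F x]. *)
Definition yinit (xi : R) : R := sup [set x | x + F x < xi].

Let mv2 : mfun setT (fun x => v x ^+ 2).
Proof. by apply: measurable_funX; exact: (hs_mv hd). Qed.

Let v20 x : 0 <= v x ^+ 2. Proof. exact: sqr_ge0. Qed.

Lemma hs_F_nd a b : a <= b -> F a <= F b.
Proof.
move=> ab; rewrite -subr_ge0 -lee_fin (hs_F hd ab).
by apply: adde_ge0 => //; apply: integral_ge0 => x _; rewrite lee_fin.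
Qed.

(** Left continuity of [F] is continuity from below of the measure whose masses on [[a, b[] are the
    increments of [F]. It is what makes the supremum in [yinit] satisfy its defining inequality in
    the large sense. *)
Lemma hs_F_lc x e : 0 < e -> exists2 x', x' < x & F x < F x' + e.
Proof.
move=> e0.
pose k : {measure set (measurableTypeR R) -> \bar R} :=
  measure_add (density mv2 v20) ms.
have kE a b : a <= b -> k `[a, b[ = (F b - F a)%:E.
  by move=> ab; rewrite (hs_F hd ab); exact: measure_addE.
pose E (n : nat) : set (measurableTypeR R) := `[x - 1, x - n.+1%:R^-1[%classic.
have Eub : \bigcup_n E n = `[x - 1, x[%classic.
  apply/seteqP; split => y /=.
    move=> [n _]; rewrite /E/= !in_itv/= => /andP[->] /= /lt_le_trans; apply.
    by rewrite gerBl invr_ge0.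
  rewrite in_itv/= => /andP[xy yx].
  have h : 0 < x - y by rewrite subr_gt0.
  have := archi_boundP (ltW (_ : 0 < (x - y)^-1)); rewrite invr_gt0 => /(_ h) hn.
  exists (Num.bound (x - y)^-1) => //; rewrite /E/= in_itv/= xy/= ltrBrDl -ltrBrDr.
  rewrite -[X in _ < X]invrK ltf_pV2 ?posrE ?invr_gt0//.
  by rewrite (lt_le_trans hn)// ler_nat.
have ndE : nondecreasing_seq E.
  move=> n m nm; apply/subsetPset => y; rewrite /E/= !in_itv/= => /andP[-> /=] /lt_le_trans; apply.
  by rewrite lerB// lef_pV2 ?posrE// ler_nat.
have mE n : measurable (E n) by exact: measurable_itv.
have := @nondecreasing_cvg_mu _ _ _ k E mE _ ndE.
rewrite Eub => /(_ (measurable_itv _)).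
rewrite kE; last by lra.
have hk n : k (E n) = (F (x - n.+1%:R^-1) - F (x - 1))%:E.
  by rewrite kE// lerB// invf_le1// ler1n.
move=> /fine_cvgP[_]; rewrite /= => hc.
have : \forall n \near \oo, `|F x - F (x - 1) - fine (k (E n))| < e.
  by move/cvgrPdist_lt : hc => /(_ e e0).
case=> n _ /(_ n (leqnn n)) /=; rewrite hk/= => hlt.
exists (x - n.+1%:R^-1); first by rewrite gtrBl invr_gt0.
move: hlt; rewrite ltr_norml => /andP[_]; lra.
Qed.

Let A xi := [set x | x + F x < xi].
Let A0 xi : A xi !=set0.
Proof. by exists (xi - G0 - 1); rewrite /A/=; have := hs_F_le hd (xi - G0 - 1); lra. Qed.
Let Aub xi : ubound (A xi) xi.
Proof. by move=> x; rewrite /A/=; have := hs_F_ge0 hd x; lra. Qed.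

Lemma hs_e_lt a b : a < b -> a + F a < b + F b.
Proof. by move=> ab; rewrite ltr_leD// hs_F_nd// ltW. Qed.

Lemma lt_yinit xi x : x < yinit xi -> x + F x < xi.
Proof.
move=> /(sup_gt (A0 xi)) [z]; rewrite /A/= => hz xz.
exact: lt_trans (hs_e_lt xz) hz.
Qed.

Lemma yinit_le xi x : xi <= x + F x -> yinit xi <= x.
Proof. by move=> h; rewrite leNgt; apply/negP => /lt_yinit; rewrite ltNge h. Qed.

Lemma le_yinit xi x : x + F x < xi -> x <= yinit xi.
Proof.
move=> h; apply: sup_upper_bound => //; split; first exact: A0.
by exists xi; exact: Aub.
Qed.

Lemma yinit_lt_e xi x : yinit xi < x -> xi <= x + F x.
Proof. by move=> h; rewrite leNgt; apply/negP => /le_yinit; rewrite leNgt h. Qed.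

Lemma lt_e_yinit xi x : xi < x + F x -> yinit xi < x.
Proof.
move=> h; have [x' x'x Fx'] : exists2 x', x' < x & F x < F x' + (x + F x - xi) / 2.
  by apply: hs_F_lc; lra.
pose x2 := Num.max x' (x - (x + F x - xi) / 2).
have x2x : x2 < x by rewrite /x2 gt_max x'x/=; lra.
apply: le_lt_trans x2x; apply: yinit_le.
have F2 : F x' <= F x2 by apply: hs_F_nd; rewrite /x2 le_max lexx.
have : x - (x + F x - xi) / 2 <= x2 by rewrite /x2 le_max lexx orbT.
by lra.
Qed.

Lemma e_yinit_le xi : yinit xi + F (yinit xi) <= xi.
Proof. by rewrite leNgt; apply/negP => /lt_e_yinit; rewrite ltxx. Qed.

Lemma yinitK x : yinit (x + F x) = x.
Proof.
apply/eqP; rewrite eq_le yinit_le//=; rewrite leNgt; apply/negP => h.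
have z1 : yinit (x + F x) < (yinit (x + F x) + x) / 2 by lra.
have z2 : (yinit (x + F x) + x) / 2 < x by lra.
by have := yinit_lt_e z1; have := hs_e_lt z2; lra.
Qed.

Lemma yinit_nd : {homo yinit : a b / a <= b}.
Proof.
move=> a b ab; rewrite leNgt; apply/negP => h.
have h1 : yinit b < (yinit a + yinit b) / 2 by lra.
have h2 : (yinit a + yinit b) / 2 < yinit a by lra.
by have := yinit_lt_e h1; have := lt_yinit h2; lra.
Qed.

(** Since [F] is nondecreasing, [x + F x] does not shrink distances, and its inverse does not
    stretch them. *)
Lemma yinit_lip a b : a <= b -> yinit b - yinit a <= b - a.
Proof.
move=> ab; rewrite leNgt; apply/negP => h.
pose d := (yinit b - yinit a - (b - a)) / 3.
have h1 : yinit a < yinit a + d by rewrite /d; lra.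
have h2 : yinit b - d < yinit b by rewrite /d; lra.
have := yinit_lt_e h1; have := lt_yinit h2.
have : F (yinit a + d) <= F (yinit b - d) by apply: hs_F_nd; rewrite /d; lra.
by rewrite /d; lra.
Qed.

Lemma yinit_lip_abs a b : `|yinit a - yinit b| <= `|a - b|.
Proof.
wlog ab : a b / a <= b.
  move=> h; have [|/ltW] := leP a b; first exact: h.
  by rewrite distrC (distrC a); exact: h.
rewrite distrC (distrC a) !ger0_norm ?subr_ge0//; first exact: yinit_lip.
exact: yinit_nd.
Qed.

Lemma yinit_mono_energy a b : a <= b -> a - yinit a <= b - yinit b.
Proof. by move=> /yinit_lip; lra. Qed.

Lemma yinit_energy_ge xi : F (yinit xi) <= xi - yinit xi.
Proof. by have := e_yinit_le xi; lra. Qed.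

Lemma yinit_energy_le xi : xi - yinit xi <= G0.
Proof.
rewrite leNgt; apply/negP => h.
have h1 : yinit xi < (yinit xi + (xi - G0)) / 2 by lra.
by have := yinit_lt_e h1; have := hs_F_le hd ((yinit xi + (xi - G0)) / 2); lra.
Qed.

Lemma yinit_energy_ge0 xi : 0 <= xi - yinit xi.
Proof. exact: le_trans (hs_F_ge0 hd _) (yinit_energy_ge xi). Qed.

Lemma yinit_energy_cvgy : (fun xi => xi - yinit xi) @ +oo --> G0.
Proof.
apply/cvgrPdist_le => e e0; have [x hx] := hs_Fy hd e0.
near=> xi; have h1 : x + F x < xi by near: xi; apply: nbhs_pinfty_gt; exact: num_real.
have h2 := le_yinit h1; have h3 := hs_F_nd h2.
have := yinit_energy_ge xi; have := yinit_energy_le xi.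
by rewrite ler_norml; lra.
Unshelve. all: by end_near. Qed.

Lemma yinit_energy_small e : 0 < e -> exists a, forall xi, xi <= a -> xi - yinit xi <= e.
Proof.
move=> e0; have [x hx] := hs_FNy hd e0.
exists (x + F x) => xi hxi; rewrite leNgt; apply/negP => h.
have h1 : yinit xi < xi - e by lra.
have := yinit_lt_e h1 => h2; have : xi - e < x by lra.
move=> /ltW/hs_F_nd; lra.
Qed.

Lemma measurable_yinit : mfun setT yinit.
Proof. by apply: nondecreasing_measurable => //; exact: yinit_nd. Qed.

Lemma hs_e_nd : {homo (fun x => x + F x) : a b / a <= b}.
Proof. by move=> a b ab; rewrite lerD// hs_F_nd. Qed.

Lemma measurable_e : mfun setT (fun x => x + F x).
Proof. by apply: nondecreasing_measurable => //; exact: hs_e_nd. Qed.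

Let w x := 1 + v x ^+ 2.
Let mw : mfun setT w. Proof. exact: measurable_funD. Qed.
Let w0 x : 0 <= w x. Proof. by rewrite /w addr_ge0. Qed.

Let kappa : {measure set (measurableTypeR R) -> \bar R} :=
  measure_add (density mw w0) ms.

(** The preimage lies between the open and the closed interval with end points [a + F a] and
    [b + F b], which have the same length. *)
Lemma yinit_pushforward_co a b : a <= b ->
  leb (yinit @^-1` `[a, b[) = ((b + F b) - (a + F a))%:E.
Proof.
move=> ab; have eab := hs_e_nd ab.
have my := measurable_yinit measurableT (measurable_itv (Interval (BLeft a) (BLeft b))).
rewrite setTI in my.
have l1 : leb `]a + F a, b + F b[%classic = ((b + F b) - (a + F a))%:E.
  by rewrite lebesgue_measure_itv/= lte_fin; case: ltrgtP eab => // ->; rewrite subrr.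
have l2 : leb `[a + F a, b + F b]%classic = ((b + F b) - (a + F a))%:E.
  by rewrite lebesgue_measure_itv/= lte_fin; case: ltrgtP eab => // ->; rewrite subrr.
apply/eqP; rewrite eq_le; apply/andP; split.
  rewrite -l2; apply: le_measure; rewrite ?inE//.
  move=> xi /=; rewrite !in_itv/= => /andP[h1 /yinit_lt_e ->]; rewrite andbT.
  exact: le_trans (hs_e_nd h1) (e_yinit_le xi).
rewrite -l1; apply: le_measure; rewrite ?inE//.
by move=> xi /=; rewrite !in_itv/= => /andP[/le_yinit -> /lt_e_yinit ->].
Qed.

(** The change of variables between labels and positions: Lebesgue measure in the label becomes (1 +
    v^2) dx plus the singular part, because these are the increments of [x + F x]. *)
Lemma yinit_pushforward S : mset S -> leb (yinit @^-1` S) = kappa S.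
Proof.
pose py := measure_function_pushforward__canonical__measure_function_Measure
  (@lebesgue_measure R) measurable_yinit.
apply: (@measure_unique_co R py kappa).
  move=> a b ab; rewrite {1}/py/= /pushforward yinit_pushforward_co//.
  transitivity (density mw w0 `[a, b[ + ms `[a, b[)%E; last by symmetry; exact: measure_addE.
  have -> : density mw w0 `[a, b[ =
      (leb `[a, b[%classic + \int[@lebesgue_measure R]_(x in `[a, b[) (v x ^+ 2)%:E)%E.
    rewrite /density /w; under eq_integral do rewrite EFinD.
    rewrite ge0_integralD//=.
    - by rewrite (integral_cst (@lebesgue_measure R) _ 1%E)// mul1e.
    - by move=> x _; rewrite lee_fin.
    - by apply/measurable_EFinP; exact: mfunS mv2.
  rewrite -addeA -(hs_F hd ab) lebesgue_measure_itv/= lte_fin.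
  case: ltrgtP ab => // [ab _|-> _]; last by rewrite !subrr addr0.
  by rewrite -EFinD; congr (_%:E); lra.
move=> a b; rewrite {1}/py/= /pushforward.
have [ab|ba] := leP a b; first by rewrite yinit_pushforward_co// ltry.
by rewrite set_itv_ge ?preimage_set0 ?measure0// -leNgt bnd_simp ltW.
Qed.

Lemma leb_le_yinit S : mset S -> (leb S <= leb (yinit @^-1` S))%E.
Proof.
move=> mS; rewrite yinit_pushforward//.
have -> : kappa S = (density mw w0 S + ms S)%E by exact: measure_addE.
apply: (@le_trans _ _ (density mw w0 S)); last by rewrite leeDl.
rewrite -[leLHS]mul1e -(integral_cst (@lebesgue_measure R) mS 1%E) /density.
apply: ge0_le_integral => //.
  by apply/measurable_EFinP; exact: mfunS mw.
by move=> x _; rewrite lee_fin /w lerDl.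
Qed.

Lemma yinit_integral (f : R -> \bar R) :
  measurable_fun (setT : set (measurableTypeR R)) f -> (forall x, 0 <= f x)%E ->
  (\int[@lebesgue_measure R]_xi f (yinit xi) =
   \int[@lebesgue_measure R]_x (f x * (1 + v x ^+ 2)%:E) + \int[ms]_x f x)%E.
Proof.
move=> mf f0.
have := @ge0_integral_pushforward _ _ _ _ _ _ measurable_yinit (@lebesgue_measure R)
  setT f measurableT mf (fun x _ => f0 x).
rewrite preimage_setT => /= <-.
transitivity (\int[kappa]_x f x)%E.
  pose py := measure_function_pushforward__canonical__measure_function_Measure
    (@lebesgue_measure R) measurable_yinit.
  apply: (@eq_measure_integral _ _ _ setT kappa py) => S mS _.
  exact: (yinit_pushforward mS).
rewrite /kappa ge0_integral_measure_add//; congr (_ + _)%E.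
exact: integral_density.
Qed.

(** A level set of positive length makes its position an atom of [kappa]. The density part has no
    atoms, so it is an atom of [ms], which is carried by [N]. *)
Lemma yinit_level_N a b : a < b -> yinit a = yinit b -> N (yinit a).
Proof.
move=> ab yab; apply: contrapT => nN.
have := @yinit_pushforward [set yinit a] (measurable_set1 _).
have -> : kappa [set yinit a] = 0%E.
  transitivity (density mw w0 [set yinit a] + ms [set yinit a])%E; first exact: measure_addE.
  rewrite /density integral_set1 add0e; apply: (subset_measure0 (mu:=ms) _ _ _ (hs_msN hd)) => //.
  - exact: measurableC (hs_mN hd).
  - by move=> x ->.
move=> h; have : (leb `[a, b]%classic <= leb (yinit @^-1` [set yinit a]))%E.
  apply: le_measure; rewrite ?inE//.
    rewrite -[X in measurable X]setTI; apply: measurable_yinit => //.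
  move=> x /=; rewrite in_itv/= => /andP[h1 h2]; apply/eqP; rewrite eq_le.
  by apply/andP; split; [rewrite yab|]; exact: yinit_nd.
by rewrite h lebesgue_measure_itv/= lte_fin ab lee_fin subr_le0 leNgt ab.
Qed.

Lemma e_yinit xi : ~ N (yinit xi) -> yinit xi + F (yinit xi) = xi.
Proof.
move=> nN; apply: contrapT => /eqP; rewrite eq_le e_yinit_le/= -ltNge => h.
set e := yinit xi + F (yinit xi) in h.
have h1 : e < (e + xi) / 2 by lra.
have h2 : (e + xi) / 2 < xi by lra.
apply: nN; have yE : yinit ((e + xi) / 2) = yinit xi.
  by apply/eqP; rewrite eq_le yinit_nd ?(ltW h2)//=; exact: le_yinit.
by rewrite -yE; exact: yinit_level_N h2 yE.
Qed.

(** Transfers almost everywhere statements from labels to positions: the density 1 + v^2 is at least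
    1, so a set of positions with null preimage is null. *)
Lemma ae_e (P : R -> Prop) : {ae (@lebesgue_measure R), forall xi, P xi} ->
  {ae (@lebesgue_measure R), forall x, ~ N x -> P (x + F x)}.
Proof.
move=> [Z [mZ Z0 PZ]].
pose S := ((fun x => x + F x) @^-1` Z) `&` ~` N.
have mS : mset S.
  apply: measurableI; last exact: measurableC (hs_mN hd).
  by rewrite -[X in measurable X]setTI; exact: (measurable_e measurableT).
exists S; split => //.
  apply/eqP; rewrite -measure_le0; apply: (le_trans (leb_le_yinit mS)).
  rewrite -Z0; apply: le_measure; rewrite ?inE//.
    by rewrite -[X in measurable X]setTI; exact: (measurable_yinit measurableT).
  by move=> xi [/= h nN]; move: h; rewrite e_yinit.
move=> x /= /not_implyP[nN nP]; split => //.
by apply: PZ.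
Qed.

(** The derivative of [yinit] almost everywhere: the inverse of the density 1 + v^2, and 0 on labels
    that carry singular energy. *)
Definition dyinit (xi : R) : R :=
  if yinit xi \in N then 0 else (1 + v (yinit xi) ^+ 2)^-1.

Let psi (x : R) := \1_(~` N) x * (w x)^-1.

Let mpsi : mfun setT psi.
Proof.
apply: measurable_funM; first exact: (measurable_indic (measurableC (hs_mN hd))).
exact: mfunV.
Qed.

Let psi0 x : 0 <= psi x. Proof. by rewrite /psi mulr_ge0// invr_ge0. Qed.

Lemma dyinitE xi : dyinit xi = psi (yinit xi).
Proof.
rewrite /dyinit /psi indicE in_setC; case: (_ \in N) => /=; first by rewrite mul0r.
by rewrite mul1r.
Qed.

Lemma measurable_dyinit : mfun setT dyinit.
Proof.
rewrite (_ : dyinit = psi \o yinit); first exact: measurableT_comp measurable_yinit.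
by apply/funext => x; rewrite /= dyinitE.
Qed.

(** The factor [psi] vanishes on [N], which removes [ms], and cancels the density 1 + v^2 elsewhere;
    [N] itself is negligible for Lebesgue measure. *)
Let cv_ge0 h V : mfun setT h -> (forall x, 0 <= h x) -> has_integral setT h V ->
  has_integral setT (fun xi => h (yinit xi) * dyinit xi) V.
Proof.
move=> mh h0 hV.
have mhp : mfun setT (fun x => h x * psi x) by exact: measurable_funM.
have hp0 x : 0 <= h x * psi x by rewrite mulr_ge0.
rewrite (_ : (fun xi => _) = (fun x => h x * psi x) \o yinit); last first.
  by apply/funext => x; rewrite /= dyinitE.
apply: has_integral_ge0P => //; first exact: measurableT_comp measurable_yinit.
  by move=> x _; exact: hp0.
have /= -> := @yinit_integral (fun x => (h x * psi x)%:E) _ hp0; last exact/measurable_EFinP.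
rewrite [X in (_ + X)%E](_ : _ = 0%E); last first.
  rewrite (ge0_negligible_integral (mu:=ms) (N:=~` N)) //.
  - rewrite setDE setCK setTI integral0_eq// => x Nx.
    by rewrite /psi indicE in_setC mem_set//= mul0r mulr0.
  - exact: (measurableC (hs_mN hd)).
  - exact/measurable_EFinP.
  - by move=> x _; rewrite lee_fin.
  - exact: (hs_msN hd).
rewrite adde0 -(has_integral_EFin _ hV)//.
apply: ge0_ae_eq_integral => //.
- by apply/measurable_EFinP; exact: measurable_funM.
- exact/measurable_EFinP.
- by move=> x _; rewrite -EFinM lee_fin; apply: mulr_ge0 (hp0 x) (w0 x).
- by move=> x _; rewrite lee_fin.
exists N; split; [exact: hs_mN hd|exact: hs_N0 hd|].
move=> x /= hx; apply: contrapT => nN; apply: hx => _.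
rewrite /psi indicE in_setC memNset//= mul1r -EFinM; congr (_%:E).
by rewrite -mulrA mulVf ?mulr1// gt_eqF// /w ltr_pwDl.
Qed.

Lemma yinit_cv h V : mfun setT h -> has_integral setT h V ->
  has_integral setT (fun xi => h (yinit xi) * dyinit xi) V.
Proof.
move=> mh hV.
have [W [hW _]] : exists W, has_integral setT (fun x => `|h x|) W /\ `|W| <= W.
  exists (\int[leb]_x `|h x|); split; last by rewrite ger0_norm// Rintegral_ge0.
  by split => //; case: hV => /integrable_norm.
have h1 : has_integral setT (fun x => h x + `|h x|) (V + W) by exact: has_integralD.
have := has_integralB _ (cv_ge0 _ _ h1) (cv_ge0 _ _ hW); rewrite addrK.
move=> H; apply: has_integral_eq (H _ _ _ _ _) => //.
- by move=> x _; rewrite mulrDl addrK.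
- by apply: measurable_funD => //; exact: measurableT_comp.
- by move=> x; have := ler_norm (- h x); rewrite normrN; lra.
- exact: measurableT_comp.
Qed.

Lemma yinit_cv_set (E S : set R) h V : mset E -> mset S -> mfun setT h ->
  {ae (@lebesgue_measure R), forall xi, ~ N (yinit xi) -> (E xi <-> S (yinit xi))} ->
  has_integral S h V -> has_integral E (fun xi => h (yinit xi) * dyinit xi) V.
Proof.
move=> mE mS mh ES /(has_integral_mkcond _ _ mS) hV.
have mhS : mfun setT (fun x => h x * \1_S x) by apply: measurable_funM => //; exact: measurable_indic.
have := yinit_cv mhS hV => H.
apply/(has_integral_mkcond _ _ mE); apply: has_integral_ae H => //.
  apply: measurable_funM; last exact: measurable_indic.
  apply: measurable_funM; last exact: measurable_dyinit.
  exact: measurableT_comp measurable_yinit.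
apply: aeS ES => xi ES _; rewrite /dyinit.
case: (boolP (yinit xi \in N)) => yN; first by rewrite !mulr0 mul0r.
have {}ES : E xi <-> S (yinit xi) by apply: ES => /mem_set; rewrite (negbTE yN).
rewrite !indicE -!mulrA; congr (_ * _); rewrite mulrC; congr (_ * (nat_of_bool _)%:R).
by apply/idP/idP => /set_mem ?; apply/mem_set; apply/ES.
Qed.

(** A label below [b] with position [yinit b], or below [a] with position [yinit a], lies on a level
    set, hence over [N], where [dyinit] is 0. The two intervals therefore match up to their end
    points. *)
Lemma yinit_cv_itv a b h V : mfun setT h -> has_integral `[yinit a, yinit b[ h V ->
  has_integral `[a, b] (fun xi => h (yinit xi) * dyinit xi) V.
Proof.
move=> mh; apply: yinit_cv_set => //.
apply: aeS (aeI (ae_neq a) (ae_neq b)) => xi [xa xb] nN /=; rewrite !in_itv/=.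
split => /andP[h1 h2]; apply/andP; split.
- exact: yinit_nd.
- rewrite lt_neqAle yinit_nd// andbT; apply/eqP => yE.
  have xib : xi < b by rewrite lt_neqAle h2 andbT; apply/eqP.
  exact: nN (yinit_level_N xib yE).
- rewrite leNgt; apply/negP => xia; apply: nN; have yE : yinit xi = yinit a.
    by apply/eqP; rewrite eq_le h1 andbT; apply: yinit_nd; exact: ltW.
  exact: yinit_level_N xia yE.
- by rewrite leNgt; apply/negP => /ltW/yinit_nd; rewrite leNgt h2.
Qed.

Lemma yinit_cv_Ny b h V : mfun setT h -> has_integral `]-oo, yinit b[ h V ->
  has_integral `]-oo, b] (fun xi => h (yinit xi) * dyinit xi) V.
Proof.
move=> mh; apply: yinit_cv_set => //.
apply: aeS (ae_neq b) => xi xb nN /=; rewrite !in_itv/=; split => h2.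
- rewrite lt_neqAle yinit_nd// andbT; apply/eqP => yE.
  have xib : xi < b by rewrite lt_neqAle h2 andbT; apply/eqP.
  exact: nN (yinit_level_N xib yE).
- by rewrite leNgt; apply/negP => /ltW/yinit_nd; rewrite leNgt h2.
Qed.

Lemma yinit_primitive a b : a <= b -> has_integral `[a, b] dyinit (yinit b - yinit a).
Proof.
move=> ab.
have h1 : has_integral `[yinit a, yinit b[ (fun=> 1) (yinit b - yinit a).
  apply: has_integral_itvcc_co; have := has_integral_cst 1 (yinit_nd ab); by rewrite mul1r.
have := yinit_cv_itv (measurable_cst _) h1.
by apply: has_integral_eq => // x _; rewrite mul1r.
Qed.

Lemma uinit_primitive a b : a <= b ->
  has_integral `[a, b] (fun xi => v (yinit xi) * dyinit xi) (u (yinit b) - u (yinit a)).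
Proof.
move=> ab; apply: yinit_cv_itv; first exact: hs_mv hd.
by apply: has_integral_itvcc_co; apply: (hs_u hd); exact: yinit_nd.
Qed.

Lemma vinit_primitive a b : a <= b ->
  has_integral `[a, b] (fun xi => 1 - dyinit xi) ((b - yinit b) - (a - yinit a)).
Proof.
move=> ab; have := has_integral_cst 1 ab; rewrite mul1r => h1.
have := has_integralB (measurable_itv _) h1 (yinit_primitive ab).
by congr (has_integral _ _ _); lra.
Qed.

End Inverse.

(** * Exchange of integrals and time primitives of the breaking indicator *)

Section Tools.
Variable R : realType.
Implicit Types (D E : set R).

Lemma has_integral_FTC2 (F f : R -> R) (a b : R) : a <= b ->
  (forall x, is_derive x (1 : R) F (f x)) -> continuous f ->
  has_integral `[a, b] f (F b - F a).
Proof.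
move=> ab dF cf.
have fi : leb.-integrable `[a, b] (EFin \o f).
  apply: continuous_compact_integrable; first exact: segment_compact.
  exact: continuous_subspaceT.
split => //; move: ab; rewrite le_eqVlt => /predU1P[->|ab].
  by rewrite subrr set_itv1 Rintegral_set1.
rewrite /Rintegral (@continuous_FTC2 _ f F)//.
- exact: continuous_subspaceT.
- split.
  + by move=> x _; exact: ex_derive.
  + apply: cvg_at_right_filter; apply: differentiable_continuous; apply/derivable1_diffP; exact: ex_derive.
  + apply: cvg_at_left_filter; apply: differentiable_continuous; apply/derivable1_diffP; exact: ex_derive.
- by move=> x _; rewrite derive1E derive_val.
Qed.

(** By nonnegativity the order can be exchanged before anything is known about [A], whose
    integrability is part of the conclusion. *)
Lemma has_integral_tonelli D E (f : R -> R -> R) (A B : R -> R) V :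
  mset D -> mset E ->
  measurable_fun setT (fun p : measurableTypeR R * measurableTypeR R => f p.1 p.2) ->
  (forall x y, E x -> D y -> 0 <= f x y) ->
  (forall x, E x -> has_integral D (f x) (A x)) ->
  (forall y, D y -> has_integral E (f ^~ y) (B y)) ->
  has_integral D B V -> has_integral E A V.
Proof.
move=> mD mE mf f0 fA fB BV.
pose g (p : measurableTypeR R * measurableTypeR R) := (f p.1 p.2 * \1_E p.1 * \1_D p.2)%:E.
have mg : measurable_fun setT g.
  apply/measurable_EFinP; apply: measurable_funM; first apply: measurable_funM => //.
  - by apply: (measurableT_comp (measurable_indic mE)); exact: measurable_fst.
  - by apply: (measurableT_comp (measurable_indic mD)); exact: measurable_snd.
have g0 p : (0 <= g p)%E.
  rewrite /g lee_fin !indicE; case: (boolP (p.1 \in E)) => [/set_mem Ep|_]; last by rewrite mulr0 mul0r.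
  by case: (boolP (p.2 \in D)) => [/set_mem Dp|_]; rewrite ?mulr0// !mulr1; exact: f0.
have gA x : (\int[@lebesgue_measure R]_y g (x, y))%E = (A x * \1_E x)%:E.
  rewrite /g/= indicE; case: (boolP (x \in E)) => [/set_mem Ex|_].
    rewrite mulr1; apply: has_integral_EFin => //.
    by have /(has_integral_mkcond _ _ mD) := fA x Ex; apply: has_integral_eq => // y _; rewrite mulr1.
  by rewrite mulr0; under eq_integral do rewrite mulr0 mul0r; rewrite integral0.
have gB y : (\int[@lebesgue_measure R]_x g (x, y))%E = (B y * \1_D y)%:E.
  rewrite /g/= [in RHS]indicE; case: (boolP (y \in D)) => [/set_mem Dy|/negbTE Dy].
    rewrite mulr1; apply: has_integral_EFin => //.
    have /(has_integral_mkcond _ _ mE) := fB y Dy; apply: has_integral_eq => // x _.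
    by rewrite [\1_D y]indicE mem_set// mulr1.
  by rewrite mulr0; under eq_integral do rewrite [\1_D y]indicE Dy mulr0; rewrite integral0.
have := @fubini_tonelli _ _ _ _ R (@lebesgue_measure R) (@lebesgue_measure R) g mg g0.
under eq_integral do rewrite gA.
under [in RHS]eq_integral do rewrite gB.
move=> h; apply/(has_integral_mkcond _ _ mE); apply: has_integral_ge0P => //.
- apply/measurable_EFinP; rewrite (_ : _ \o _ = fubini_F (@lebesgue_measure R) g); last first.
    by apply/funext => x; rewrite /fubini_F gA.
  exact: (@measurable_fun_fubini_tonelli_F _ _ _ _ _ (@lebesgue_measure R) g mg g0).
- move=> x _; rewrite indicE; case: (boolP (x \in E)) => [/set_mem Ex|_]; last by rewrite mulr0.
  by rewrite mulr1; apply: has_integral_ge0 (fA x Ex) _ => y Dy; exact: f0.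
- rewrite h; apply: has_integral_EFin => //; exact/(has_integral_mkcond _ _ mD).
Qed.

Definition step (z : R) : R := if z <= 0 then 1 else 0.

Lemma measurable_step : mfun setT step.
Proof.
apply: nonincreasing_measurable => // x y xy; rewrite /step.
by case: (leP y 0) => y0; [rewrite (le_trans xy y0)|case: ifP].
Qed.

Lemma step01 z : 0 <= step z <= 1.
Proof. by rewrite /step; case: ifP; rewrite ?lexx ?ler01. Qed.

(* [step (2 + t * c)] tells whether a particle of initial slope [c] has broken by
   time [t], i.e. whether [c < 0] and [-2 / c <= t]; [ppart] and its square are
   its successive primitives in [t], up to the factors [- c]. *)
Definition ppart (t c : R) : R := Num.max 0 (- (2 + t * c)).

Lemma ppart_ge0 t c : 0 <= ppart t c. Proof. by rewrite /ppart le_max lexx. Qed.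

Lemma ppart_neg t c : 0 <= t -> 0 <= c -> ppart t c = 0.
Proof. by move=> t0 c0; rewrite /ppart max_l// oppr_le0 addr_ge0// mulr_ge0. Qed.

Lemma ppart_le t c : 0 <= t -> ppart t c <= t * `|c|.
Proof.
move=> t0; rewrite /ppart ge_max mulr_ge0//=.
have : - c <= `|c| by rewrite -normrN ler_norm.
by move=> h; have := ler_wpM2l t0 h; rewrite mulrN; lra.
Qed.

Lemma cppart_ge0 t c : 0 <= t -> 0 <= - c * ppart t c.
Proof.
move=> t0; have [c0|c0] := leP 0 c; first by rewrite ppart_neg// mulr0.
by rewrite mulr_ge0 ?ppart_ge0// oppr_ge0 ltW.
Qed.

Lemma cppart_le t c : 0 <= t -> - c * ppart t c <= t * c ^+ 2.
Proof.
move=> t0; have [c0|c0] := leP 0 c; first by rewrite ppart_neg// mulr0 mulr_ge0// sqr_ge0.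
have := ppart_le c t0; rewrite ltr0_norm// => h.
have c1 : 0 <= - c by lra.
by have := ler_wpM2l c1 h; rewrite expr2; lra.
Qed.

Lemma sqr_ppart_le t c : 0 <= t -> ppart t c ^+ 2 <= t ^+ 2 * c ^+ 2.
Proof.
move=> t0; rewrite -[c ^+ 2]real_normK ?num_real// -exprMn.
by rewrite lerXn2r ?nnegrE ?ppart_ge0 ?mulr_ge0// ppart_le.
Qed.

Lemma has_integral_step (t c : R) : 0 <= t ->
  has_integral `[0, t] (fun r => c ^+ 2 * step (2 + r * c)) (- c * ppart t c).
Proof.
move=> t0.
have ms : mfun setT (fun r => c ^+ 2 * step (2 + r * c)).
  apply: measurable_funM => //; apply: measurableT_comp; first exact: measurable_step.
  by apply: measurable_funD => //; apply: measurable_funM.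
have small : {ae (@lebesgue_measure R), forall r, `[0, t] r -> 0 < 2 + r * c} ->
    has_integral `[0, t] (fun r => c ^+ 2 * step (2 + r * c)) 0.
  move=> h; have := has_integral_cst 0 t0; rewrite mul0r.
  apply: has_integral_ae => //; first exact: mfunS ms.
  by apply: aeS h => r h /h; rewrite /step; case: leP; rewrite ?mulr0// ltNge => ->.
have [c0|c0] := leP 0 c.
  rewrite ppart_neg// mulr0; apply: small; apply: aeT => r /=; rewrite in_itv/= => /andP[r0 _].
  by rewrite ltr_wpDr// mulr_ge0.
(* [- 2 / c] is the breaking time: the integrand is 0 before it and [c ^+ 2] after it. *)
have cs : 2 + (- 2 / c) * c = 0 by rewrite mulfVK ?lt_eqF//; lra.
have [ts|st] := leP t (- 2 / c).
  rewrite /ppart max_l.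
    rewrite mulr0; apply: small; apply: aeS (ae_neq (-2 / c)) => r rs; rewrite /= in_itv/= => /andP[r0 rt].
    have : r < - 2 / c by rewrite lt_neqAle (le_trans rt ts) andbT; exact/eqP.
    by rewrite -(ltr_nM2r c0); lra.
  by move: ts; rewrite -(ler_nM2r c0); lra.
have s0 : 0 <= - 2 / c by rewrite mulNr oppr_ge0 ltW// pmulr_rlt0// invr_lt0.
have -> : - c * ppart t c = 0 * (- 2 / c - 0) + c ^+ 2 * (t - (- 2 / c)).
  rewrite /ppart max_r; last by move: st; rewrite -(ltr_nM2r c0); lra.
  have : c ^+ 2 * (- 2 / c) = - 2 * c by rewrite mulrCA expr2 mulfK// lt_eqF.
  by lra.
apply: has_integral_itvco_cc => //.
apply: (has_integral_cat_co s0 (ltW st)).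
  have := has_integral_itvcc_co (has_integral_cst 0 s0).
  apply: has_integral_eq => // r /=; rewrite in_itv/= => /andP[r0 rs].
  rewrite /step; case: leP => //; last by rewrite mulr0.
  by move: rs; rewrite -(ltr_nM2r c0); lra.
have := has_integral_itvcc_co (has_integral_cst (c ^+ 2) (ltW st)).
apply: has_integral_eq => // r /=; rewrite in_itv/= => /andP[r0 rs].
rewrite /step; case: leP => //; first by rewrite mulr1.
by move: r0; rewrite -(ler_nM2r c0); lra.
Qed.

Lemma has_integral_ppart (t c : R) : 0 <= t ->
  has_integral `[0, t] (fun r => - c * ppart r c) (ppart t c ^+ 2 / 2).
Proof.
move=> t0.
have mp : mfun setT (fun r => - c * ppart r c).
  apply: measurable_funM => //; apply: measurable_maxr => //; apply: measurableT_comp => //.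
  by apply: measurable_funD => //; apply: measurable_funM.
have small : (forall r, 0 <= r <= t -> 0 <= 2 + r * c) ->
    has_integral `[0, t] (fun r => - c * ppart r c) 0.
  move=> h; have := has_integral_cst 0 t0; rewrite mul0r.
  apply: has_integral_eq => // r; rewrite /= in_itv/= => /h hr.
  by rewrite /ppart max_l ?mulr0//; lra.
have [c0|c0] := leP 0 c.
  rewrite ppart_neg// expr0n mul0r; apply: small => r /andP[r0 _].
  by rewrite addr_ge0// mulr_ge0.
have cs : 2 + (- 2 / c) * c = 0 by rewrite mulfVK ?lt_eqF//; lra.
have [ts|st] := leP t (- 2 / c).
  rewrite /ppart max_l; last by move: ts; rewrite -(ler_nM2r c0); lra.
  rewrite expr0n mul0r; apply: small => r /andP[r0 rt].
  by have := le_trans rt ts; rewrite -(ler_nM2r c0); lra.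
have s0 : 0 <= - 2 / c by rewrite mulNr oppr_ge0 ltW// pmulr_rlt0// invr_lt0.
pose G r : R := (2 + r * c) ^+ 2 / 2.
have dG r : is_derive r (1 : R) G (c * (2 + r * c)).
  rewrite /G; apply: is_derive_eq.
  by rewrite /GRing.scale/=; lra.
have -> : ppart t c ^+ 2 / 2 = 0 * (- 2 / c - 0) + (G t - G (- 2 / c)).
  rewrite /G cs expr0n !mul0r subr0 add0r /ppart max_r ?sqrrN//.
  by move: st; rewrite -(ltr_nM2r c0); lra.
apply: has_integral_itvco_cc => //.
apply: (has_integral_cat_co s0 (ltW st)).
  have := has_integral_itvcc_co (has_integral_cst 0 s0).
  apply: has_integral_eq => // r /=; rewrite in_itv/= => /andP[r0 rs].
  by rewrite /ppart max_l ?mulr0//; move: rs; rewrite -(ltr_nM2r c0); lra.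
have : has_integral `[(- 2 / c), t] (fun r => c * (2 + r * c)) (G t - G (-2 / c)).
  apply: has_integral_FTC2 => //; first exact: ltW.
  by move=> x; apply: differentiable_continuous; apply/derivable1_diffP.
move/has_integral_itvcc_co; apply: has_integral_eq => // r /=; rewrite in_itv/= => /andP[r0 rs].
by rewrite /ppart max_r; [lra|move: r0; rewrite -(ler_nM2r c0); lra].
Qed.

End Tools.

Lemma mset_itvNyo (R : realType) (b : R) : mset `]-oo, b[%classic.
Proof. exact: measurable_itv. Qed.

Lemma mset_itvco (R : realType) (a b : R) : mset `[a, b[%classic.
Proof. exact: measurable_itv. Qed.

(** * Explicit solution for a given loss *)

Section Cumulative.
Variable R : realType.
Implicit Types (q : R -> R).

Definition cum q (b : R) : R := \int[@lebesgue_measure R]_(x in `]-oo, b[) q x.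
Definition tot q : R := \int[@lebesgue_measure R]_x q x.

Variables (q : R -> R) (Q : R).
Hypotheses (q0 : forall x, 0 <= q x) (qQ : has_integral setT q Q).

Lemma totE : tot q = Q. Proof. by have [_ ->] := qQ. Qed.

Lemma has_integral_cum b : has_integral `]-oo, b[ q (cum q b).
Proof.
have [w hw] := has_integralS measurableT (mset_itvNyo b) (@subsetT _ _) qQ.
by split; [exact: hw.1|].
Qed.

Lemma has_integral_sub a b : a <= b -> has_integral `[a, b[ q (cum q b - cum q a).
Proof.
move=> ab.
have [w hw] := has_integralS measurableT (mset_itvco a b) (@subsetT _ _) qQ.
have := has_integral_catNy ab (has_integral_cum a) hw.
move=> /(has_integral_uniq (has_integral_cum b)) ->.
by rewrite addrAC subrr add0r.
Qed.

Lemma cum_nd a b : a <= b -> cum q a <= cum q b.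
Proof. by move=> /has_integral_sub h; rewrite -subr_ge0; exact: has_integral_ge0 h _. Qed.

Lemma cum_ge0 b : 0 <= cum q b.
Proof. exact: has_integral_ge0 (has_integral_cum b) _. Qed.

Lemma cum_le b : cum q b <= Q.
Proof.
have [w [hw _]] := has_integralS_ge0 measurableT (mset_itvNyo b) (@subsetT _ _) (fun x _ => q0 x) qQ.
by rewrite (has_integral_uniq (has_integral_cum b) hw).
Qed.

Lemma cum_cvgy : cum q b @[b --> +oo] --> Q.
Proof.
pose v n := cum q n%:R.
have vnd : nondecreasing_seq v by move=> n m nm; apply: cum_nd; rewrite ler_nat.
have vub : has_ubound (range v) by exists Q => _ [n _ <-]; exact: cum_le.
have vc := nondecreasing_is_cvgn vnd vub.
pose E n : set (measurableTypeR R) := `]-oo, n%:R[%classic.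
have EQ : has_integral setT q (limn v).
  apply: (has_integral_lim (E := E)) vc => //.
  - by move=> n; exact: measurable_itv.
  - move=> n m nm; apply/subsetPset => x; rewrite /E/= !in_itv/= => /lt_le_trans; apply.
    by rewrite ler_nat.
  - by apply: (bigcup_itv_nat (T := fun r => `]-oo, r[%classic)) => r x /=; rewrite !in_itv/= => /andP[].
  - exact: has_integral_measurable qQ.
  - by move=> n; exact: has_integral_cum.
have lQ := has_integral_uniq EQ qQ.
apply/cvgrPdist_le => e e0.
have : \forall n \near \oo, `|limn v - v n| < e by move/cvgrPdist_lt : vc => /(_ e e0).
rewrite lQ; case=> n _ /(_ n (leqnn n)) /= hn.
near=> b.
have nb : n%:R <= b by near: b; apply: nbhs_pinfty_ge; exact: num_real.
have := cum_nd nb; have := cum_le b; move: hn; rewrite /v !ler_norml ltr_norml; lra.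
Unshelve. all: by end_near. Qed.

End Cumulative.

Section Solution.
Variable R : realType.
Variables (u v F : R -> R) (G0 : R).
Variable ms : {finite_measure set (measurableTypeR R) -> \bar R}.
Variable N : set R.
Hypothesis hd : hs_data u v F G0 ms N.

Let mv : mfun setT v := hs_mv hd.

(** The increments of [F] over bounded intervals are at most [G0], and the singular part only adds
    to the integral of v^2. *)
Lemma hs_energy : exists Q, [/\ has_integral setT (fun x => v x ^+ 2) Q, 0 <= Q & Q <= G0].
Proof.
have mv2 : mfun setT (fun x => v x ^+ 2) by exact: measurable_funX.
apply: (@has_integral_bound _ (fun n => `[- n%:R, n%:R[%classic)) => //.
- move=> n m nm; apply/subsetPset => x; rewrite /= !in_itv/= => /andP[h1 h2].
  have : n%:R <= m%:R :> R by rewrite ler_nat.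
  by move=> h; apply/andP; split; lra.
- by apply: (bigcup_itv_nat (T:=fun r => `[-r, r[%classic)) => r x /=; rewrite !in_itv/= => /andP[/ltW-> ->].
- by move=> x _; exact: sqr_ge0.
move=> n; have nn : - n%:R <= n%:R :> R by have : 0 <= n%:R :> R by []; lra.
have i0 : (0 <= \int[@lebesgue_measure R]_(x in `[(- n%:R)%R, n%:R%R[) (v x ^+ 2)%:E)%E.
  by apply: integral_ge0 => x _; rewrite lee_fin sqr_ge0.
have m0 : (0 <= ms `[(- n%:R)%R, n%:R%R[)%E by [].
have FF : F n%:R - F (- n%:R) <= G0 by have := hs_F_le hd n%:R; have := hs_F_ge0 hd (- n%:R); lra.
have := hs_F hd nn; move: i0 m0.
case iE : (\int[@lebesgue_measure R]_(x in `[(- n%:R)%R, n%:R%R[) (v x ^+ 2)%:E)%E => [i| |]//; last first.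
  by move=> _; case: (ms _).
case: (ms _) => [m| |]// i0 m0 [] E; exists i; split.
  by apply: has_integral_ge0P => //; [exact: mfunS mv2|move=> x _; exact: sqr_ge0].
by move: m0 i0; rewrite !lee_fin; lra.
Qed.

Lemma dominated_energy (q : R -> R) k : mfun setT q -> 0 <= k ->
  (forall x, 0 <= q x <= k * v x ^+ 2) ->
  has_integral setT q (tot q) /\ tot q <= k * G0.
Proof.
move=> mq k0 hq; have [Q [hQ Q0 QG]] := hs_energy.
have [w [hw wk]] : exists w, has_integral setT q w /\ `|w| <= k * Q.
  apply: (has_integral_dom _ mq (has_integralZ k _ hQ)) => //.
  by move=> x _; have /andP[h1 h2] := hq x; rewrite ger0_norm.
rewrite (totE hw); split => //.
by rewrite (le_trans (ler_norm _))// (le_trans wk)// ler_wpM2l.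
Qed.

Variable L : R -> R.
Hypotheses (mL : mfun setT L) (L01 : forall x, 0 <= L x <= 1).

(** The density in x of the energy lost by time t. [loss1] and [loss2] are its first and second
    primitives in t; they are what enters the velocity and the position. *)
Definition loss0 t x := L x * (v x ^+ 2 * step (2 + t * v x)).
Definition loss1 t x := L x * (- v x * ppart t (v x)).
Definition loss2 t x := L x * (ppart t (v x) ^+ 2 / 2).

Let mp1 : measurable_fun setT (fun p : measurableTypeR R * measurableTypeR R => p.1).
Proof. exact: measurable_fst. Qed.
Let mp2 (f : R -> R) : mfun setT f -> measurable_fun setT (fun p : measurableTypeR R * measurableTypeR R => f p.2).
Proof. by move=> mf; apply: (measurableT_comp mf); exact: measurable_snd. Qed.
Let mt2 : measurable_fun setT (fun p : measurableTypeR R * measurableTypeR R => 2 + p.1 * v p.2).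
Proof. by apply: measurable_funD => //; apply: measurable_funM => //; exact: mp2. Qed.
Let mpp : measurable_fun setT (fun p : measurableTypeR R * measurableTypeR R => ppart p.1 (v p.2)).
Proof. by apply: measurable_maxr => //; exact: measurableT_comp mt2. Qed.

Lemma measurable2_loss0 : measurable_fun setT
  (fun p : measurableTypeR R * measurableTypeR R => loss0 p.1 p.2).
Proof.
apply: measurable_funM; first exact: mp2.
apply: measurable_funM; first by apply: (mp2 (f := fun x => v x ^+ 2)); exact: measurable_funX.
by apply: measurableT_comp mt2; exact: measurable_step.
Qed.

Lemma measurable2_loss1 : measurable_fun setT
  (fun p : measurableTypeR R * measurableTypeR R => loss1 p.1 p.2).
Proof.
apply: measurable_funM; first exact: mp2.
apply: measurable_funM => //; apply: (mp2 (f := fun x => - v x)); exact: measurableT_comp.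
Qed.

Lemma measurable2_loss2 : measurable_fun setT
  (fun p : measurableTypeR R * measurableTypeR R => loss2 p.1 p.2).
Proof.
apply: measurable_funM; first exact: mp2.
by apply: measurable_funM => //; exact: measurable_funX.
Qed.

Let msec t (f : R -> R -> R) : measurable_fun setT
  (fun p : measurableTypeR R * measurableTypeR R => f p.1 p.2) -> mfun setT (f t).
Proof. by move=> mf; exact: (measurableT_comp mf (measurable_pair1 t)). Qed.

Lemma measurable_loss0 t : mfun setT (loss0 t). Proof. exact: msec measurable2_loss0. Qed.
Lemma measurable_loss1 t : mfun setT (loss1 t). Proof. exact: msec measurable2_loss1. Qed.
Lemma measurable_loss2 t : mfun setT (loss2 t). Proof. exact: msec measurable2_loss2. Qed.

Lemma loss0_bnd t x : 0 <= loss0 t x <= 1 * v x ^+ 2.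
Proof.
have /andP[l0 l1] := L01 x; have /andP[s0 s1] := step01 (2 + t * v x).
have v0 := sqr_ge0 (v x).
have s2 : 0 <= v x ^+ 2 * step (2 + t * v x) by exact: mulr_ge0.
rewrite /loss0; apply/andP; split; first exact: mulr_ge0.
apply: ler_pM => //.
by rewrite -[leRHS]mulr1 ler_wpM2l.
Qed.

Lemma loss1_bnd t x : 0 <= t -> 0 <= loss1 t x <= t * v x ^+ 2.
Proof.
move=> t0; have /andP[l0 l1] := L01 x; have h0 := cppart_ge0 (v x) t0.
rewrite /loss1 mulr_ge0//= (le_trans _ (cppart_le (v x) t0))//.
by rewrite -[leRHS]mul1r ler_wpM2r.
Qed.

Lemma loss2_bnd t x : 0 <= t -> 0 <= loss2 t x <= t ^+ 2 / 2 * v x ^+ 2.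
Proof.
move=> t0; have /andP[l0 l1] := L01 x; have h0 := sqr_ppart_le (v x) t0.
have h1 : 0 <= ppart t (v x) ^+ 2 / 2 by rewrite divr_ge0// sqr_ge0.
rewrite /loss2 mulr_ge0//=.
have : L x * (ppart t (v x) ^+ 2 / 2) <= 1 * (ppart t (v x) ^+ 2 / 2) by rewrite ler_wpM2r.
by lra.
Qed.

Lemma loss0_int t : has_integral setT (loss0 t) (tot (loss0 t)) /\ tot (loss0 t) <= 1 * G0.
Proof. by apply: dominated_energy => //; [exact: measurable_loss0|exact: loss0_bnd]. Qed.

Lemma loss1_int t : 0 <= t ->
  has_integral setT (loss1 t) (tot (loss1 t)) /\ tot (loss1 t) <= t * G0.
Proof. by move=> t0; apply: dominated_energy => // [|x]; [exact: measurable_loss1|exact: loss1_bnd]. Qed.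

Lemma loss2_int t : 0 <= t ->
  has_integral setT (loss2 t) (tot (loss2 t)) /\ tot (loss2 t) <= t ^+ 2 / 2 * G0.
Proof.
move=> t0; apply: dominated_energy => // [||x]; [exact: measurable_loss2| |exact: loss2_bnd].
by rewrite divr_ge0// sqr_ge0.
Qed.

Lemma loss1_time (S : set R) t : mset S -> 0 <= t ->
  has_integral `[0, t] (fun r => \int[leb]_(x in S) loss0 r x) (\int[leb]_(x in S) loss1 t x).
Proof.
move=> mS t0; apply: (has_integral_tonelli mS _ measurable2_loss0 (B := loss1 t)) => //.
- by move=> r x _ _; have /andP[] := loss0_bnd r x.
- move=> r _; split => //.
  by have [w []] := has_integralS measurableT mS (@subsetT _ _) (loss0_int r).1.
- move=> x _; apply: has_integralZ => //; exact: has_integral_step.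
- split => //.
  by have [w []] := has_integralS measurableT mS (@subsetT _ _) (loss1_int t0).1.
Qed.

Lemma loss2_time (S : set R) t : mset S -> 0 <= t ->
  has_integral `[0, t] (fun r => \int[leb]_(x in S) loss1 r x) (\int[leb]_(x in S) loss2 t x).
Proof.
move=> mS t0; apply: (has_integral_tonelli mS _ measurable2_loss1 (B := loss2 t)) => //.
- by move=> r x /=; rewrite in_itv/= => /andP[r0 _] _; have /andP[] := loss1_bnd x r0.
- move=> r /=; rewrite in_itv/= => /andP[r0 _]; split => //.
  by have [w []] := has_integralS measurableT mS (@subsetT _ _) (loss1_int r0).1.
- move=> x _; apply: has_integralZ => //; exact: has_integral_ppart.
- split => //.
  by have [w []] := has_integralS measurableT mS (@subsetT _ _) (loss2_int t0).1.
Qed.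

Let yb := yinit F.

(** The Lagrangian system solved for a prescribed [L]. The energy to the left of a label is its
    initial value minus the losses to the left of its initial position. Integrating V/2 - Vinf/4
    once and twice in time gives [solU] and [solY], where losses to the left enter with factor -1/2
    and the total loss with factor 1/4. *)
Definition solVinf t := G0 - tot (loss0 t).
Definition solV t xi := (xi - yb xi) - cum (loss0 t) (yb xi).
Definition solU t xi := u (yb xi) + t / 2 * (xi - yb xi) - t / 4 * G0
  - cum (loss1 t) (yb xi) / 2 + tot (loss1 t) / 4.
Definition solY t xi := yb xi + t * u (yb xi) + t ^+ 2 / 4 * (xi - yb xi)
  - t ^+ 2 / 8 * G0 - cum (loss2 t) (yb xi) / 2 + tot (loss2 t) / 4.

Lemma solU_time t xi : 0 <= t -> has_integral `[0, t]
  (fun r => solV r xi / 2 - solVinf r / 4) (solU t xi - u (yb xi)).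
Proof.
move=> t0.
have h1 := loss1_time (mset_itvNyo (yb xi)) t0.
have h2 := loss1_time measurableT t0.
have h3 := has_integral_cst ((xi - yb xi) / 2 - G0 / 4) t0.
have := has_integralD (measurable_itv _) h3
  (has_integralB (measurable_itv _) (has_integralZ (4^-1) (measurable_itv _) h2)
  (has_integralZ (2^-1) (measurable_itv _) h1)).
rewrite -/(cum (loss1 t) _) -/(tot (loss1 t)).
have -> : ((xi - yb xi) / 2 - G0 / 4) * (t - 0) + (4^-1 * tot (loss1 t) - 2^-1 * cum (loss1 t) (yb xi)) = solU t xi - u (yb xi).
  by rewrite /solU; lra.
apply: has_integral_eq => // r _; rewrite /solV /solVinf -/(tot (loss0 r)) -/(cum (loss0 r) _); lra.
Qed.

Lemma solY_time t xi : 0 <= t -> has_integral `[0, t] (fun r => solU r xi) (solY t xi - yb xi).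
Proof.
move=> t0.
have h1 := loss2_time (mset_itvNyo (yb xi)) t0.
have h2 := loss2_time measurableT t0.
have h3 := has_integral_cst (u (yb xi)) t0.
have h4 : has_integral `[0, t] (fun r : R => r) (t ^+ 2 / 2 - 0 ^+ 2 / 2).
  apply: (@has_integral_FTC2 _ (fun r => r ^+ 2 / 2)) => // r; last exact: cvg_id.
  by apply: is_derive_eq; rewrite /GRing.scale/=; lra.
have := has_integralD (measurable_itv _) (has_integralD (measurable_itv _) h3
  (has_integralZ ((xi - yb xi) / 2 - G0 / 4) (measurable_itv _) h4))
  (has_integralB (measurable_itv _) (has_integralZ (4^-1) (measurable_itv _) h2)
  (has_integralZ (2^-1) (measurable_itv _) h1)).
rewrite -/(cum (loss2 t) _) -/(tot (loss2 t)).
set s := (X in has_integral _ _ X -> _).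
have -> : s = solY t xi - yb xi by rewrite /s /solY expr0n/=; lra.
apply: has_integral_eq => // r _; rewrite /solU -/(tot (loss1 r)) -/(cum (loss1 r) _); lra.
Qed.

Lemma solV_cvgy t : solV t xi @[xi --> +oo] --> solVinf t.
Proof.
apply: cvgB; first exact: yinit_energy_cvgy hd.
have hc := cum_cvgy (fun x => proj1 (andP (loss0_bnd t x))) (loss0_int t).1.
apply: cvg_comp hc; apply/cvgryPge => A.
near=> xi; have := yinit_energy_le hd xi.
have : A + G0 <= xi by near: xi; apply: nbhs_pinfty_ge; exact: num_real.
by rewrite /yb; lra.
Unshelve. all: by end_near. Qed.

Lemma sol0 xi : solY 0 xi = yb xi /\ solU 0 xi = u (yb xi).
Proof.
have p0 c : ppart 0 c = 0 :> R by rewrite /ppart mul0r addr0 max_l// oppr_le0.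
have z1 S : \int[leb]_(x in S) loss1 0 x = 0.
  rewrite (_ : (fun x => loss1 0 x) = cst 0); first by rewrite /Rintegral integral0.
  by apply/funext => x; rewrite /loss1 p0 !mulr0.
have z2 S : \int[leb]_(x in S) loss2 0 x = 0.
  rewrite (_ : (fun x => loss2 0 x) = cst 0); first by rewrite /Rintegral integral0.
  by apply/funext => x; rewrite /loss2 p0 expr0n/= mul0r mulr0.
by rewrite /solY /solU /cum /tot !z1 !z2 expr0n/=; split; lra.
Qed.

End Solution.

(** * Borel measurability of the derivative of a continuous function *)

Section Derive1.
Variable R : realType.

(** Losses and breaking times are written with [derive1] at every label, so its measurability is
    needed also where the derivative does not exist. By the Cauchy criterion the points of
    differentiability form a countable intersection of countable unions of the sets [A k m], which
    are closed because difference quotients are continuous. *)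
Lemma measurable_derive1 (f : R -> R) : continuous f -> mfun setT (derive1 f).
Proof.
move=> cf.
pose q (h x : R) : R := h^-1 * (f (h + x) - f x).
have cq h : continuous (q h).
  move=> x; apply: cvgM; first exact: cvg_cst.
  apply: cvgB; last exact: cf.
  apply: (@cvg_comp _ _ _ (fun x => h + x) f); last exact: cf.
  by apply: cvgD; [exact: cvg_cst|exact: cvg_id].
pose A (k m : nat) := [set x | forall h h' : R, 0 < `|h| < m.+1%:R^-1 ->
  0 < `|h'| < m.+1%:R^-1 -> `|q h x - q h' x| <= k.+1%:R^-1].
have clA k m : closed (A k m).
  rewrite (_ : A k m = \bigcap_(p in [set p : R * R | 0 < `|p.1| < m.+1%:R^-1 /\ 0 < `|p.2| < m.+1%:R^-1])
    [set x | `|q p.1 x - q p.2 x| <= k.+1%:R^-1]); last first.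
    apply/seteqP; split => x; first by move=> Ax [h h'] /= [h1 h2]; exact: Ax.
    by move=> Ax h h' h1 h2; exact: (Ax (h, h')).
  apply: closed_bigI => -[h h'] _.
  apply: (@closed_comp _ _ (fun x => `|q h x - q h' x|) [set y | y <= k.+1%:R^-1]); last exact: closed_le.
  by move=> x _; apply: cvg_norm; apply: cvgB; exact: cq.
pose D := \bigcap_k \bigcup_m A k m.
have mD : mset D.
  apply: bigcapT_measurable => k; apply: bigcup_measurable => m _.
  exact: closed_measurable.
have DP x : D x <-> cvg (h^-1 *: (f (h + x) - f x) @[h --> (0 : R)^']).
  split=> [Dx|].
    apply/cauchy_cvgP; apply/cauchyP => e e0.
    have [m _ Am] := Dx (Num.bound e^-1) I.
    exists (q (m.+1%:R^-1 / 2) x).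
    have hm : 0 < `|(m.+1%:R^-1 : R) / 2| < m.+1%:R^-1.
      by rewrite gtr0_norm ?divr_gt0// ltr_pdivrMr// ltr_pMr ?invr_gt0// ltr1n.
    have : \forall h \near (0 : R)^', `|h| < m.+1%:R^-1.
      by apply: dnbhs0_lt; rewrite invr_gt0.
    have : \forall h \near (0 : R)^', h != 0 by exact: nbhs_dnbhs_neq.
    apply: filterS2 => h h0 hlt.
    rewrite -ball_normE /=; apply: le_lt_trans (Am _ _ hm _) _; first by rewrite normr_gt0 h0.
    rewrite -[ltRHS]invrK ltf_pV2 ?posrE ?invr_gt0//.
    have := archi_boundP (ltW (_ : 0 < e^-1)); rewrite invr_gt0 => /(_ e0) /lt_trans; apply.
    by rewrite ltr_nat.
  move=> cx k _.
  set l := lim (h^-1 *: (f (h + x) - f x) @[h --> (0 : R)^']) in cx.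
  have : \forall h \near (0 : R), h != 0 -> `|l - h^-1 *: (f (h + x) - f x)| < k.+1%:R^-1 / 2.
    by move/cvgrPdist_lt : cx; apply; rewrite divr_gt0// invr_gt0.
  case=> d /= d0 hd.
  exists (Num.bound d^-1) => // h h' /andP[h0 h1] /andP[h'0 h'1].
  have dm : (Num.bound d^-1).+1%:R^-1 < d.
    rewrite -[ltRHS]invrK ltf_pV2 ?posrE ?invr_gt0//.
    have := archi_boundP (ltW (_ : 0 < d^-1)); rewrite invr_gt0 => /(_ d0) /lt_trans; apply.
    by rewrite ltr_nat.
  have := hd h; rewrite /ball_/= sub0r normrN => /(_ (lt_trans h1 dm)).
  rewrite -normr_gt0 => /(_ h0) a1.
  have := hd h'; rewrite /ball_/= sub0r normrN => /(_ (lt_trans h'1 dm)).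
  rewrite -normr_gt0 => /(_ h'0) a2.
  apply: ltW; rewrite [ltRHS]splitr.
  have -> : q h x - q h' x = - (l - q h x) + (l - q h' x) by lra.
  by rewrite (le_lt_trans (ler_normD _ _))// normrN ltrD.
(* The limit of a divergent quotient is one and the same default value at every such point. *)
have [c hc] : exists c : R, forall x, ~ D x -> derive1 f x = c.
  by eexists => x nx; rewrite /derive1 dvgP; [reflexivity|move=> /DP].
pose g (n : nat) x : R := q n.+1%:R^-1 x * \1_D x + c * \1_(~` D) x.
apply: (@measurable_fun_cvg _ _ _ _ g).
  move=> n; apply: measurable_funD; apply: measurable_funM => //.
  - exact: continuous_measurable_fun.
  - exact: (measurable_indic (measurableC mD)).
move=> x _; rewrite /g !indicE in_setC; case: (boolP (x \in D)) => /= [/set_mem/DP cx|/negP nx].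
  rewrite mulr0 (_ : (fun n => _) = (fun n => q n.+1%:R^-1 x)); last first.
    by apply/funext => n; rewrite mulr1 addr0.
  rewrite /derive1; apply: (proj1 (cvgr_dnbhsP _ _ _) cx (fun n => n.+1%:R^-1)).
  by split; [move=> n; rewrite invr_neq0|exact: cvg_harmonic].
rewrite hc; last by move=> /mem_set.
rewrite (_ : (fun n => _) = cst c); first exact: cvg_cst.
by apply/funext => n; rewrite mulr0 add0r mulr1.
Qed.

Lemma derive1_ge0 (f : R -> R) x : {homo f : a b / a <= b} -> 0 <= derive1 f x.
Proof.
move=> fnd; rewrite /derive1.
(* The default value of a divergent limit is 0. *)
have [cx|ncx] := pselect (cvg (h^-1 *: (f (h + x) - f x) @[h --> (0 : R)^'])); last by rewrite dvgP.
apply: limr_ge => //; near=> h.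
have h0 : h != 0 by near: h; exact: nbhs_dnbhs_neq.
have [hp|hn] := ltP 0 h.
  by apply: mulr_ge0; [rewrite invr_ge0 ltW|rewrite subr_ge0 fnd// lerDr ltW].
by apply: mulr_le0; [rewrite invr_le0|rewrite subr_le0 fnd// gerDr].
Unshelve. all: by end_near. Qed.

End Derive1.

Section Initial.
Variable R : realType.
Variables (u v F : R -> R) (G0 : R).
Variable ms : {finite_measure set (measurableTypeR R) -> \bar R}.
Variable N : set R.
Hypothesis hd : hs_data u v F G0 ms N.

Notation yb := (yinit F).
Notation dy := (dyinit v F N).

Lemma dyinit01 xi : 0 <= dy xi <= 1.
Proof.
rewrite /dyinit; case: ifP => _; first by rewrite lexx ler01.
have h : 1 <= 1 + v (yb xi) ^+ 2 by rewrite lerDl sqr_ge0.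
by rewrite invr_ge0 invf_le1 ?h ?(le_trans ler01 h)// (lt_le_trans ltr01 h).
Qed.

(** |v| / (1 + v^2) is bounded although v is not; this makes the initial velocity Lipschitz in the
    label, while it is in general only Hoelder in the position. *)
Lemma v_dyinit_le xi : `|v (yb xi) * dy xi| <= 1.
Proof.
rewrite normrM [`|dy xi|]ger0_norm; last by have /andP[] := dyinit01 xi.
rewrite /dyinit; case: ifP => _; first by rewrite mulr0.
have h : 0 < 1 + v (yb xi) ^+ 2 by rewrite ltr_pwDl// sqr_ge0.
rewrite ler_pdivrMr// mul1r -[v _ ^+ 2]real_normK ?num_real//.
by have := sqr_ge0 (`|v (yb xi)| - 1); have := sqr_ge0 (`|v (yb xi)|); rewrite sqrrB1; lra.
Qed.

Lemma uinit_lip a b : `|u (yb a) - u (yb b)| <= `|a - b|.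
Proof.
wlog ab : a b / a <= b.
  move=> h; have [|/ltW] := leP a b; first exact: h.
  by rewrite distrC (distrC a); exact: h.
rewrite distrC (distrC a) [leRHS]ger0_norm ?subr_ge0//.
have h1 := uinit_primitive hd ab.
have h2 := has_integral_cst 1 ab; rewrite mul1r in h2.
have [w [hw wk]] := has_integral_dom (measurable_itv _) (has_integral_measurable h1) h2
  (fun x _ => v_dyinit_le x).
by rewrite (has_integral_uniq h1 hw).
Qed.

Lemma lip_continuous (f : R -> R) : (forall a b, `|f a - f b| <= `|a - b|) -> continuous f.
Proof.
move=> hf x; apply/cvgrPdist_lt => e e0; near=> y.
apply: le_lt_trans (hf _ _) _.
by near: y; exists e.
Unshelve. all: by end_near. Qed.

(** [Lmap] reads the distribution function of the second measure, which agrees with that of the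
    first by a property of the data and not by definition. *)
Variable G : R -> R.
Hypothesis GF : G = F.
Let Xb := Lmap (Euler u F G).

Lemma lyE : ly Xb = yb. Proof. by rewrite /Xb GF. Qed.
Lemma lUE : lU Xb = (fun xi => u (yb xi)). Proof. by rewrite /Xb GF. Qed.
Lemma lVE : lV Xb = (fun xi => xi - yb xi). Proof. by rewrite /Xb GF. Qed.

Lemma continuous_yinit : continuous yb.
Proof. by apply: lip_continuous => a b; exact: (yinit_lip_abs hd). Qed.

Lemma continuous_uinit : continuous (fun xi => u (yb xi)).
Proof. by apply: lip_continuous; exact: uinit_lip. Qed.

Lemma measurable_dlV : mfun setT (derive1 (lV Xb)).
Proof.
apply: measurable_derive1; rewrite lVE => x; apply: cvgB; first exact: cvg_id.
exact: continuous_yinit.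
Qed.

Lemma measurable_dlU : mfun setT (derive1 (lU Xb)).
Proof. by apply: measurable_derive1; rewrite lUE; exact: continuous_uinit. Qed.

Lemma measurable_dly : mfun setT (derive1 (ly Xb)).
Proof. by apply: measurable_derive1; rewrite lyE; exact: continuous_yinit. Qed.

Lemma dlV_ge0 xi : 0 <= derive1 (lV Xb) xi.
Proof. by apply: derive1_ge0 => a b; rewrite lVE; exact: (yinit_mono_energy hd). Qed.

Lemma ae_init : {ae (@lebesgue_measure R), forall xi,
  [/\ derive1 (ly Xb) xi = dy xi, derive1 (lU Xb) xi = v (yb xi) * dy xi
    & derive1 (lV Xb) xi = 1 - dy xi]}.
Proof.
have h1 := ae_derive1 (yinit_primitive hd).
have h2 := ae_derive1 (fun a b ab => uinit_primitive hd (a:=a) (b:=b) ab).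
have h3 := ae_derive1 (fun a b ab => vinit_primitive hd (a:=a) (b:=b) ab).
apply: aeS (aeI h1 (aeI h2 h3)) => xi [[_ e1] [[_ e2] [_ e3]]].
by rewrite lyE lUE lVE.
Qed.

(** Off [N] the derivatives of y, U and V are d, v d and v^2 d with d > 0, so that the breaking time
    is -2/v, a function of the slope only. On [N] the first two vanish, the breaking time is 0, and
    singular energy is never dissipated. *)
Lemma ae_break : {ae (@lebesgue_measure R), forall xi, forall t, 0 <= t ->
  (if (0%:E < tau Xb xi <= t%:E)%E then 1 else 0) * derive1 (lV Xb) xi
  = v (yb xi) ^+ 2 * step (2 + t * v (yb xi)) * dy xi}.
Proof.
apply: aeS ae_init => xi [e1 e2 e3] t t0; rewrite /tau e1 e2 e3.
rewrite /dyinit; case: (boolP (yb xi \in N)) => yN.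
  by rewrite eqxx mulr0 eqxx/= ltxx mul0r mulr0.
set c := v (yb xi); set d := (1 + c ^+ 2)^-1.
have d1 : 0 < 1 + c ^+ 2 by rewrite ltr_pwDl// sqr_ge0.
have d0 : 0 < d by rewrite invr_gt0.
rewrite gt_eqF//=.
have e4 : 1 - d = c ^+ 2 * d by rewrite /d; field; rewrite gt_eqF.
rewrite e4 pmulr_llt0//.
have [c0|c0] := ltP c 0; last first.
  rewrite leye_eq/= andbF mul0r /step leNgt ltr_wpDr// ?mulr_ge0//= mulr0 mul0r.
  by [].
have -> : - 2 * d / (c * d) = - 2 / c by field; rewrite lt_eqF// gt_eqF.
rewrite lte_fin lee_fin; have -> : 0 < - 2 / c.
  by rewrite mulNr oppr_gt0 pmulr_rlt0// invr_lt0.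
have -> : (- 2 / c <= t) = (2 + t * c <= 0).
  by rewrite ler_ndivrMr// -subr_le0 opprK addrC.
by rewrite /step/=; case: ifP => _; rewrite ?mul1r ?mul0r ?mulr1 ?mulr0 ?mul0r.
Qed.

Lemma ae_tau : {ae (@lebesgue_measure R), forall xi, ~ N (yb xi) -> v (yb xi) < 0 ->
  fine (tau Xb xi) = - 2 / v (yb xi) /\ derive1 (lV Xb) xi != 0}.
Proof.
apply: aeS ae_init => xi [e1 e2 e3] yN c0; rewrite /tau e1 e2 e3.
rewrite /dyinit memNset//; set c := v (yb xi) in c0 *; set d := (1 + c ^+ 2)^-1.
have d1 : 0 < 1 + c ^+ 2 by rewrite ltr_pwDl// sqr_ge0.
have d0 : 0 < d by rewrite invr_gt0.
rewrite gt_eqF//= pmulr_llt0// c0/=; split.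
  by field; rewrite lt_eqF// gt_eqF.
have e4 : 1 - d = c ^+ 2 * d by rewrite /d; field; rewrite gt_eqF.
by rewrite e4 mulf_neq0 ?gt_eqF// exprn_even_gt0//= lt_eqF.
Qed.

Lemma has_integral_lV xi : has_integral `]-oo, xi] (derive1 (lV Xb)) (lV Xb xi).
Proof.
pose E n : set (measurableTypeR R) := `[xi - n%:R, xi]%classic.
have hE n : has_integral (E n) (derive1 (lV Xb)) (lV Xb xi - lV Xb (xi - n%:R)).
  have n0 : xi - n%:R <= xi by rewrite gerBl.
  have hm := measurable_dlV; rewrite lVE in hm.
  have := vinit_primitive hd n0; rewrite lVE; apply: has_integral_ae => //.
    exact: mfunS hm.
  by apply: aeS ae_init => x [_ _ e] _; rewrite -lVE e.
apply: (has_integral_lim _ _ _ _ _ hE).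
- by move=> n; exact: measurable_itv.
- move=> n m nm; apply/subsetPset => x; rewrite /E/= !in_itv/= => /andP[h ->]; rewrite andbT.
  by apply: le_trans h; rewrite lerB// ler_nat.
- apply/seteqP; split => x; first by move=> [n _]; rewrite /E/= !in_itv/= => /andP[].
  rewrite /= in_itv/= => h; exists (Num.bound (xi - x)) => //; rewrite /E/= in_itv/= h andbT.
  by rewrite lerBlDl -lerBlDr ltW// archi_boundP// subr_ge0.
- by apply: mfunS measurable_dlV.
- by move=> x _; exact: dlV_ge0.
(* The energy to the left of [xi - n%:R] tends to 0. *)
rewrite -[X in _ --> X]subr0; apply: cvgB; first exact: cvg_cst.
apply/cvgrPdist_le => e e0.
have [a ha] := yinit_energy_small hd e0.
near=> n; rewrite sub0r normrN lVE ger0_norm ?(yinit_energy_ge0 hd)//; apply: ha.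
rewrite lerBlDl -lerBlDr; near: n; exact: nbhs_infty_ger.
Unshelve. all: by end_near. Qed.

End Initial.

(** * Exact evolutions as fixed points *)

Section Exact.
Variable R : realType.
Variables (u v F : R -> R) (G0 : R).
Variable ms : {finite_measure set (measurableTypeR R) -> \bar R}.
Variable N : set R.
Hypothesis hd : hs_data u v F G0 ms N.
Variable G : R -> R.
Hypothesis GF : G = F.

Notation yb := (yinit F).
Notation dy := (dyinit v F N).
Notation Xb := (Lmap (Euler u F G)).
Notation W := (derive1 (lV Xb)).
Notation br t xi := (if (0%:E < tau Xb xi <= t%:E)%E then 1 else 0 : R).

Lemma mfun_itvNy (f : R -> R) : (forall b, mfun `]-oo, b] f) -> mfun setT f.
Proof.
move=> mf; rewrite -(@bigcup_itv_nat R (fun r => `]-oo, r])); last first.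
  by move=> r x /=; rewrite !in_itv/= => /andP[_ /ltW].
by apply/measurable_fun_bigcup => // n; exact: measurable_itv.
Qed.

Let lossE' (w e b : R) : (1 - e * b) * w = w - e * (b * w).
Proof. ring. Qed.

Let lossE (w e b : R) : w - (1 - e * b) * w = e * (b * w).
Proof. ring. Qed.

Section MeasurableSol.
Variable L : R -> R.
Hypotheses (mL : mfun setT L) (L01 : forall x, 0 <= L x <= 1).

(** The time depends on the label because losses are evaluated at the breaking time. Writing the
    half-line as the factor [1 - step (b - x)], the indicator of x < b, gives a jointly measurable
    integrand to which Tonelli's theorem applies. *)
Let mcum (s b : R -> R) : mfun setT s -> mfun setT b ->
  mfun setT (fun xi => cum (loss2 v L (s xi)) (b xi)).
Proof.
move=> ms1 mb.
pose q (p : measurableTypeR R * measurableTypeR R) : \bar R :=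
  (loss2 v L (s p.1) p.2 * (1 - step (b p.1 - p.2)))%:E.
have mq : measurable_fun setT q.
  apply/measurable_EFinP; apply: measurable_funM.
    have := measurableT_comp (measurable2_loss2 hd mL)
      (measurable_fun_pair (measurableT_comp ms1 measurable_fst) measurable_snd).
    exact.
  apply: measurable_funB => //; apply: measurableT_comp; first exact: measurable_step.
  apply: measurable_funB; last exact: measurable_snd.
  exact: measurableT_comp mb measurable_fst.
have q0 p : (0 <= q p)%E.
  rewrite lee_fin mulr_ge0//.
    have /andP[l0 _] := L01 p.2.
    by rewrite /loss2 mulr_ge0// divr_ge0// sqr_ge0.
  by have /andP[_] := step01 (b p.1 - p.2); rewrite subr_ge0.
have := @measurable_fun_fubini_tonelli_F _ _ _ _ _ (@lebesgue_measure R) q mq q0.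
move=> hm.
rewrite (_ : (fun xi => _) = fine \o fubini_F (@lebesgue_measure R) q).
  by apply: measurableT_comp hm; exact: fine_measurable.
apply/funext => xi; rewrite /cum /Rintegral /fubini_F /=; congr fine.
rewrite integral_mkcond; apply: eq_integral => x _.
rewrite /q/= patchE /step; case: ifPn => [/set_mem|/negP].
  by rewrite /= in_itv/= => xb; rewrite subr_le0 leNgt xb/= subr0 mulr1.
case: leP; first by rewrite subrr mulr0.
by rewrite subr_gt0 => h; case; apply/mem_set; rewrite /= in_itv.
Qed.

Let mtot (s : R -> R) : mfun setT s -> mfun setT (fun xi => tot (loss2 v L (s xi))).
Proof.
move=> ms1.
pose q (p : measurableTypeR R * measurableTypeR R) : \bar R := (loss2 v L (s p.1) p.2)%:E.
have mq : measurable_fun setT q.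
  apply/measurable_EFinP.
  have := measurableT_comp (measurable2_loss2 hd mL)
      (measurable_fun_pair (measurableT_comp ms1 measurable_fst) measurable_snd).
  exact.
have q0 p : (0 <= q p)%E.
  have /andP[l0 _] := L01 p.2.
  by rewrite lee_fin /loss2 mulr_ge0// divr_ge0// sqr_ge0.
have := @measurable_fun_fubini_tonelli_F _ _ _ _ _ (@lebesgue_measure R) q mq q0.
by move=> hm; apply: measurableT_comp hm; exact: fine_measurable.
Qed.

Lemma measurable_solY (s : R -> R) : mfun setT s ->
  mfun setT (fun xi => solY u v F G0 L (s xi) xi).
Proof.
move=> ms1; rewrite /solY.
have my := measurable_yinit hd.
have mu : mfun setT (fun xi => u (yb xi)).
  by apply: continuous_measurable_fun; exact: continuous_uinit hd.
have mf2 : mfun setT (fun xi => s xi ^+ 2) by exact: measurable_funX.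
apply: measurable_funD; last by apply: measurable_funM => //; exact: mtot.
apply: measurable_funB; last by apply: measurable_funM => //; exact: mcum.
apply: measurable_funB.
  apply: measurable_funD.
    by apply: measurable_funD => //; exact: measurable_funM.
  apply: measurable_funM; first exact: measurable_funM.
  exact: measurable_funB.
by apply: measurable_funM => //; exact: measurable_funM.
Qed.

End MeasurableSol.

Section FromExact.
Variables (alpha : R -> R) (X : R -> lagr R) (T : R).
Hypotheses (al01 : forall x, 0 <= alpha x < 1) (T0 : 0 < T).
Hypothesis hX : exact_evolution alpha Xb X.

Let ell xi := alpha (ly (X (fine (tau Xb xi))) xi).
Let g t xi := (1 - ell xi * br t xi) * W xi.

Let hg t xi : 0 <= t -> has_integral `]-oo, xi] (g t) (lV (X t) xi).
Proof. by move=> t0; have [_ /(_ t t0)[_ h]] := hX; exact: h. Qed.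

Let mg t : 0 <= t -> mfun setT (g t).
Proof. by move=> t0; apply: mfun_itvNy => b; exact: has_integral_measurable (hg b t0). Qed.

Let mW : mfun setT W := measurable_dlV hd GF.

Let f xi := (W xi - g T xi) * (W xi)^-1.

Let mf : mfun setT f.
Proof.
apply: measurable_funM; last exact: mfunV.
by apply: measurable_funB => //; apply: mg; exact: ltW.
Qed.

Let fE xi : W xi != 0 -> f xi = ell xi * br T xi.
Proof. by move=> W0; rewrite /f /g lossE mulrA mulfK. Qed.

Let f01 xi : 0 <= f xi <= 1.
Proof.
have [W0|W0] := eqVneq (W xi) 0; first by rewrite /f W0 invr0 mulr0 lexx ler01.
rewrite fE//; have /andP[a0 a1] := al01 (ly (X (fine (tau Xb xi))) xi).
by case: ifP => _; rewrite ?mulr1 ?mulr0 ?lexx ?ler01// a0 ltW.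
Qed.

(* The loss at breaking is recovered from the energy lost by time [T], because
   this makes it measurable. *)
Definition exact_loss x := f (x + F x).
Let L := exact_loss.

Lemma measurable_exact_loss : mfun setT L.
Proof. exact: (measurableT_comp mf (measurable_e hd)). Qed.

Lemma exact_loss01 x : 0 <= L x <= 1. Proof. exact: f01. Qed.

Let mL := measurable_exact_loss.
Let L01 := exact_loss01.

Let br_mono t xi : t <= T -> br t xi != 0 -> br T xi = 1.
Proof.
move=> tT; case: ifP; last by rewrite eqxx.
by move=> /andP[-> h] _ /=; rewrite (le_trans h)// lee_fin.
Qed.

Lemma exact_solV t xi : 0 <= t <= T -> lV (X t) xi = solV v F L t xi.
Proof.
move=> /andP[t0 tT].
have hW := has_integral_lV hd GF xi.
have hl : has_integral `]-oo, xi] (fun eta => W eta - g t eta) (cum (loss0 v L t) (yb xi)).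
  have hc := has_integral_cum (loss0_int hd mL L01 t).1 (yb xi).
  have := yinit_cv_Ny hd (measurable_loss0 hd mL t) hc.
  apply: has_integral_ae => //.
    by apply: (mfunS measurableT) => //; apply: measurable_funB => //; exact: mg.
  apply: aeS (ae_break hd GF) => eta hb _.
  have {}hb := hb t t0.
  have -> : W eta - g t eta = ell eta * (br t eta * W eta) by rewrite /g lossE.
  rewrite hb /loss0.
  have [yN|yN] := pselect (N (yb eta)).
    by rewrite /dyinit mem_set// !mulr0.
  rewrite /L /exact_loss (e_yinit hd yN) -mulrA.
  (* [f] recovers [ell] only on labels with energy that break by time T; where no energy is lost by
     time t both sides are 0. *)
  have [z|nz] := eqVneq (v (yb eta) ^+ 2 * step (2 + t * v (yb eta)) * dy eta) 0.
    by rewrite z !mulr0.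
  congr (_ * _); rewrite -hb in nz.
  have W0 : W eta != 0 by apply: contraNneq nz => ->; rewrite mulr0.
  rewrite fE// (br_mono (t := t)) ?mulr1//.
  by apply: contraNneq nz => ->; rewrite mul0r.
have := has_integralB (measurable_itv _) hW hl.
have -> : (fun eta => W eta - (W eta - g t eta)) = g t by apply/funext => eta; lra.
move=> /(has_integral_uniq (hg xi t0)) ->.
by rewrite (lVE u GF).
Qed.

Lemma exact_solU t xi : 0 <= t <= T -> lU (X t) xi = solU u v F G0 L t xi.
Proof.
move=> /andP[t0 tT]; have [X0 /(_ t t0)[/(_ xi)[_ hU _] _]] := hX.
have := solU_time hd mL L01 xi t0.
have hU' : has_integral `[0, t] (fun r => solV v F L r xi / 2 - solVinf v G0 L r / 4)
    (lU (X t) xi - lU (X 0) xi).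
  apply: has_integral_eq hU => // r /=; rewrite in_itv/= => /andP[r0 rt].
  have rT : 0 <= r <= T by rewrite r0 (le_trans rt).
  rewrite exact_solV//; congr (_ - _ / _).
  rewrite /Vinf (_ : lV (X r) = solV v F L r); last by apply/funext => z; exact: exact_solV.
  by apply: cvg_lim => //; exact: (solV_cvgy hd mL L01).
move=> /(has_integral_uniq hU'); rewrite X0 (lUE u GF); lra.
Qed.

Lemma exact_solY t xi : 0 <= t <= T -> ly (X t) xi = solY u v F G0 L t xi.
Proof.
move=> /andP[t0 tT]; have [X0 /(_ t t0)[/(_ xi)[hY _ _] _]] := hX.
have := solY_time hd mL L01 xi t0.
have hY' : has_integral `[0, t] (fun r => solU u v F G0 L r xi) (ly (X t) xi - ly (X 0) xi).
  apply: has_integral_eq hY => // r /=; rewrite in_itv/= => /andP[r0 rt].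
  by rewrite exact_solU// r0 (le_trans rt).
move=> /(has_integral_uniq hY'); rewrite X0 (lyE u GF); lra.
Qed.

(** Restricted to particles that break by time T, since [exact_loss] is read off the energy at time
    T. *)
Lemma exact_lossE : {ae (@lebesgue_measure R), forall x, 2 + T * v x <= 0 ->
  L x = alpha (solY u v F G0 L (- 2 / v x) (x + F x))}.
Proof.
have nN : {ae (@lebesgue_measure R), forall x, ~ N x}.
  by exists N; split; [exact: hs_mN hd|exact: hs_N0 hd|move=> x /= /contrapT].
have hbt := aeI (ae_break hd GF) (ae_tau hd GF).
apply: aeS (aeI nN (ae_e hd hbt)) => x [xN /(_ xN)[hb ht]] hx.
have v0 : v x < 0.
  rewrite ltNge; apply/negP => v0; move: hx; have : 0 <= T * v x by rewrite mulr_ge0// ltW.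
  by lra.
rewrite (yinitK hd) in hb ht; have [fine_tau W0] := ht xN v0.
have tT : 0 <= - 2 / v x <= T.
  have tv0 : 0 <= - 2 / v x by rewrite mulNr oppr_ge0 ltW// pmulr_rlt0// invr_lt0.
  by rewrite tv0/= ler_ndivrMr//; lra.
rewrite -exact_solY// -fine_tau /L /exact_loss fE//.
suff -> : br T (x + F x) = 1 by rewrite mulr1.
apply: (br_mono (t := T)) => //; apply/eqP => z.
have := hb T (ltW T0); rewrite z mul0r => /esym/eqP; apply/negP.
rewrite /step hx mulr1; apply: mulf_neq0; first by rewrite expf_neq0// lt_eqF.
rewrite /dyinit (yinitK hd) memNset//.
by apply: invr_neq0; rewrite gt_eqF// ltr_pwDl// sqr_ge0.
Qed.

End FromExact.

Section ToExact.
Variables (alpha : R -> R) (L : R -> R).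
Hypotheses (mal : mfun setT alpha).
Hypotheses (mL : mfun setT L) (L01 : forall x, 0 <= L x <= 1).
Hypothesis hL : forall x, v x < 0 -> L x = alpha (solY u v F G0 L (- 2 / v x) (x + F x)).

Let X t := Lagr (solY u v F G0 L t) (solU u v F G0 L t) (solV v F L t) (lH Xb).

(** This formula without case distinction, and the next one for the breaking indicator, exhibit both
    as measurable functions of the label. *)
Let fineE xi : fine (tau Xb xi) = (- 2 * derive1 (ly Xb) xi / derive1 (lU Xb) xi)
  * (1 - step (- derive1 (lU Xb) xi)).
Proof.
rewrite /tau /step oppr_le0; set a := derive1 (lU Xb) xi; set b := derive1 (ly Xb) xi.
have [->|a0] := eqVneq a 0; first by rewrite lexx ltxx andbT subrr mulr0; case: ifP.
rewrite andbF; case: (ltP a 0) => ha; last by rewrite subrr mulr0.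
by rewrite subr0 mulr1.
Qed.

Let mfine : mfun setT (fun xi => fine (tau Xb xi)).
Proof.
have -> := funext fineE.
have m1 := measurable_dly hd GF; have m2 := measurable_dlU hd GF.
apply: measurable_funM.
  by apply: measurable_funM; [exact: measurable_funM|exact: mfunV].
apply: measurable_funB => //; apply: measurableT_comp; first exact: measurable_step.
exact: measurableT_comp.
Qed.

Let brE t xi : br t xi = (1 - step (- derive1 (lU Xb) xi)) *
  (1 - step (fine (tau Xb xi))) * step (fine (tau Xb xi) - t).
Proof.
rewrite /tau /step oppr_le0; set a := derive1 (lU Xb) xi; set b := derive1 (ly Xb) xi.
have [->|a0] := eqVneq a 0.
  by rewrite lexx ltxx andbT subrr !mul0r; case: (b == 0) => /=; rewrite ?ltxx// leye_eq andbF.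
rewrite andbF; case: (ltP a 0) => ha; last by rewrite leye_eq andbF subrr !mul0r.
rewrite lte_fin lee_fin subr_le0 subr0 mul1r/=.
case: (leP (- 2 * b / a) 0) => _ /=; first by rewrite subrr mul0r.
by rewrite subr0 mul1r.
Qed.

Let mbr t : mfun setT (fun xi => br t xi).
Proof.
have -> := funext (brE t).
have m2 := measurable_dlU hd GF.
have ms1 := @measurable_step R.
apply: measurable_funM; first apply: measurable_funM.
- by apply: measurable_funB => //; apply: measurableT_comp => //; exact: measurableT_comp.
- by apply: measurable_funB => //; exact: measurableT_comp.
- by apply: measurableT_comp => //; exact: measurable_funB.
Qed.

Let mell : mfun setT (fun xi => alpha (solY u v F G0 L (fine (tau Xb xi)) xi)).
Proof.
apply: measurableT_comp => //; exact: measurable_solY.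
Qed.

Lemma solution_exact : exact_evolution alpha Xb X.
Proof.
split.
  have -> : Xb = Lagr yb (fun xi => u (yb xi)) (fun xi => xi - yb xi) (lH Xb).
    by rewrite -{1}(lyE u GF) -(lUE u GF) -(lVE u GF).
  rewrite /X; congr Lagr; apply/funext => xi.
  - by have [] := sol0 u v F G0 L xi.
  - by have [] := sol0 u v F G0 L xi.
  - rewrite /solV /cum (_ : loss0 v L 0 = cst 0) ?/Rintegral ?integral0 ?subr0//.
    apply/funext => x; rewrite /loss0 /step mul0r addr0 leNgt ltr0n/= !mulr0.
    by [].
move=> t t0; split.
  move=> xi; split => //=.
  - have := solY_time hd mL L01 xi t0; have [-> _] := sol0 u v F G0 L xi.
    exact.
  - have := solU_time hd mL L01 xi t0; have [_ ->] := sol0 u v F G0 L xi.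
    apply: has_integral_eq => // r _; congr (_ - _ / _); apply/esym.
    by apply: cvg_lim => //; exact: (solV_cvgy hd mL L01).
move=> xi.
have hW := has_integral_lV hd GF xi.
have hc := has_integral_cum (loss0_int hd mL L01 t).1 (yb xi).
have hl := yinit_cv_Ny hd (measurable_loss0 hd mL t) hc.
have := has_integralB (measurable_itv _) hW hl.
rewrite [in X in has_integral _ _ X](lVE u GF) -/(solV v F L t xi).
apply: has_integral_ae => //.
  apply: (mfunS measurableT) => //; apply: measurable_funM; last exact: (measurable_dlV hd GF).
  by apply: measurable_funB => //; apply: measurable_funM; [exact: mell|exact: mbr].
apply: aeS (aeI (ae_break hd GF) (ae_tau hd GF)) => eta [hb ht] _.
rewrite [RHS]lossE' hb//; congr (_ - _).
have [yN|yN] := pselect (N (yb eta)); first by rewrite /dyinit mem_set// !mulr0.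
rewrite /loss0 -mulrA.
have [v0|v0] := ltP (v (yb eta)) 0; last first.
  by rewrite /step leNgt ltr_wpDr ?mulr_ge0//= mulr0 !mul0r !mulr0.
have [-> _] := ht yN v0.
by rewrite (hL v0) (e_yinit hd yN).
Qed.

End ToExact.
End Exact.

(** * Existence of the loss function by a weighted contraction *)

Lemma sqr_le_expR (R : realType) (x : R) : 0 <= x -> x ^+ 2 <= 4 * expR x.
Proof.
move=> x0; have h := expR_ge1Dx (x / 2).
have -> : expR x = expR (x / 2) ^+ 2 by rewrite expr2 -expRD; congr expR; lra.
have h1 : 0 <= x / 2 by rewrite divr_ge0.
have h2 : x / 2 <= expR (x / 2) by lra.
have : (x / 2) ^+ 2 <= expR (x / 2) ^+ 2 by rewrite lerXn2r ?nnegrE ?expR_ge0.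
by rewrite expr_div_n; lra.
Qed.

(** After the breaking time tau = -2/c one has ppart = -c (t - tau). The inequality s^2 <= 4 exp s
    at s = lam (t - tau) trades the square for the weight at time t and for the factor lam^-2 on
    which the contraction rests. *)
Lemma ppart_weight (R : realType) (lam t c : R) : 0 < lam -> 0 <= t -> c < 0 ->
  ppart t c ^+ 2 / 2 * expR (lam * (- 2 / c)) <= 2 / lam ^+ 2 * expR (lam * t) * c ^+ 2.
Proof.
move=> l0 t0 c0.
have r0 : 0 <= 2 / lam ^+ 2 * expR (lam * t) * c ^+ 2.
  by rewrite mulr_ge0 ?sqr_ge0// mulr_ge0 ?expR_ge0// divr_ge0// sqr_ge0.
rewrite {1}/ppart; case: (ltP 0 (- (2 + t * c))) => h; last first.
  by rewrite expr0n/= !mul0r.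
have th : 0 <= lam * (t - - 2 / c).
  apply: mulr_ge0; first exact: ltW.
  by rewrite subr_ge0 ler_ndivrMr//; lra.
have := sqr_le_expR th.
have -> : - (2 + t * c) = - c * (t - - 2 / c) by field; rewrite lt_eqF.
set s := t - - 2 / c => hs.
have -> : expR (lam * t) = expR (lam * s) * expR (lam * (- 2 / c)).
  by rewrite -expRD; congr expR; rewrite /s -mulrDr; congr (_ * _); lra.
have := expR_ge0 (lam * (- 2 / c)); move: (expR (lam * (- 2 / c))) hs => g.
move: (expR (lam * s)) => e hs g0; rewrite exprMn sqrrN.
have -> : 2 / lam ^+ 2 * (e * g) * c ^+ 2 = 4 * e * (c ^+ 2 / 2 / lam ^+ 2) * g.
  by field; rewrite gt_eqF.
have -> : c ^+ 2 * s ^+ 2 / 2 = (lam * s) ^+ 2 * (c ^+ 2 / 2 / lam ^+ 2).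
  by field; rewrite gt_eqF.
by apply: ler_wpM2r => //; apply: ler_wpM2r => //; rewrite !divr_ge0 ?sqr_ge0.
Qed.

Section Existence.
Variable R : realType.
Variables (u v F : R -> R) (G0 : R).
Variable ms : {finite_measure set (measurableTypeR R) -> \bar R}.
Variable N : set R.
Hypothesis hd : hs_data u v F G0 ms N.
Variables (alpha : R -> R) (A : R).
Hypotheses (al01 : forall x, 0 <= alpha x < 1) (A0 : 0 <= A)
  (alA : forall x y, `|alpha x - alpha y| <= A * `|x - y|).

Let th x := - 2 / v x.
(** [solY] contains [loss2] with total coefficient 1/2 + 1/4; each integral contributes at most 2 G0
    / lam^2 and [alpha] a factor A. The contraction factor is 3 A G0 / (2 lam^2), at most 1/2 since
    lam^2 >= lam >= 3 A G0. *)
Let lam := 3 * A * G0 + 1.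

Let G00 : 0 <= G0.
Proof. exact: le_trans (hs_F_ge0 hd 0) (hs_F_le hd 0). Qed.

Let lam1 : 1 <= lam.
Proof. by rewrite lerDr !mulr_ge0. Qed.

Section Difference.
Variables (L L' : R -> R) (e : R).
Hypotheses (mL : mfun setT L) (L01 : forall x, 0 <= L x <= 1).
Hypotheses (mL' : mfun setT L') (L'01 : forall x, 0 <= L' x <= 1).
Hypothesis e0 : 0 <= e.
Hypothesis LL' : forall x, v x < 0 -> `|L x - L' x| <= e * expR (lam * th x).

Lemma loss2_diff (D : set R) t : 0 <= t -> mset D ->
  `|\int[leb]_(x in D) loss2 v L t x - \int[leb]_(x in D) loss2 v L' t x|
  <= 2 / lam ^+ 2 * expR (lam * t) * e * G0.
Proof.
move=> t0 mD.
have [i1 _] := loss2_int hd mL L01 t0; have [i2 _] := loss2_int hd mL' L'01 t0.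
have [Q [hQ Q0 QG]] := hs_energy hd.
have lam0 : 0 < lam by exact: lt_le_trans lam1.
set k := 2 / lam ^+ 2 * expR (lam * t) * e.
have k0 : 0 <= k.
  by rewrite /k mulr_ge0// mulr_ge0 ?expR_ge0// divr_ge0// sqr_ge0.
have [w1 h1] := has_integralS measurableT mD (@subsetT _ _) i1.
have [w2 h2] := has_integralS measurableT mD (@subsetT _ _) i2.
have [w3 [h3 w30 w3Q]] := has_integralS_ge0 measurableT mD (@subsetT _ _) (fun x _ => sqr_ge0 (v x)) hQ.
have h12 := has_integralB mD h1 h2.
have hk x : D x -> `|loss2 v L t x - loss2 v L' t x| <= k * v x ^+ 2.
  move=> _; rewrite /loss2 -mulrBl normrM [X in _ * X]ger0_norm ?divr_ge0 ?sqr_ge0//.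
  have [v0|v0] := ltP (v x) 0; last first.
    by rewrite ppart_neg// expr0n mul0r mulr0 mulr_ge0 ?sqr_ge0.
  have h := ppart_weight lam0 t0 v0.
  have p0 : 0 <= ppart t (v x) ^+ 2 / 2 by rewrite divr_ge0// sqr_ge0.
  have := ler_wpM2r p0 (LL' v0); move/le_trans; apply.
  by have := ler_wpM2l e0 h; rewrite /k /th; lra.
have [w [hw wk]] := has_integral_dom mD (has_integral_measurable h12)
  (has_integralZ k mD h3) hk.
rewrite h1.2 h2.2 in h12; rewrite (has_integral_uniq h12 hw) (le_trans wk)//.
by rewrite ler_wpM2l// (le_trans w3Q).
Qed.

Lemma solY_diff t xi : 0 <= t ->
  A * `|solY u v F G0 L t xi - solY u v F G0 L' t xi| <= e / 2 * expR (lam * t).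
Proof.
move=> t0; have hc := loss2_diff t0 (mset_itvNyo (yinit F xi)).
have ht := loss2_diff t0 measurableT.
set k := 2 / lam ^+ 2 * expR (lam * t) * e * G0 in hc ht.
have hle : `|solY u v F G0 L t xi - solY u v F G0 L' t xi| <= 3 / 4 * k.
  rewrite /solY /tot /cum; move: hc ht.
  set c1 := \int[leb]_(x in _) _; set c2 := \int[leb]_(x in _) _.
  set c3 := \int[leb]_x _; set c4 := \int[leb]_x _.
  by rewrite !ler_norml; lra.
apply: (le_trans (ler_wpM2l A0 hle)).
have E0 := expR_ge0 (lam * t); set E := expR (lam * t) in E0 *.
have lam2 : 0 < lam ^+ 2 by rewrite exprn_gt0// (lt_le_trans ltr01 lam1).
have -> : A * (3 / 4 * k) = (3 * A * G0) * (e / 2 * E) / lam ^+ 2.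
  by rewrite /k -/E; field; rewrite gt_eqF// (lt_le_trans ltr01 lam1).
rewrite ler_pdivrMr// mulrC ler_wpM2l//; first by rewrite mulr_ge0// divr_ge0.
rewrite (@le_trans _ _ lam)//; first by rewrite lerDl.
by rewrite expr2 ler_pMr// (lt_le_trans ltr01 lam1).
Qed.

(** The value 0 where [v x >= 0] is a convention: such particles never break and the kernels vanish
    there. *)
Definition breaking_loss (L : R -> R) x :=
  if v x < 0 then alpha (solY u v F G0 L (th x) (x + F x)) else 0.

Lemma breaking_loss_diff x : v x < 0 ->
  `|breaking_loss L x - breaking_loss L' x| <= e / 2 * expR (lam * th x).
Proof.
move=> v0; rewrite /breaking_loss v0 (le_trans (alA _ _))// solY_diff//.
by rewrite /th mulNr oppr_ge0 ltW// pmulr_rlt0// invr_lt0.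
Qed.

End Difference.

Lemma breaking_loss01 L x : 0 <= breaking_loss L x <= 1.
Proof.
rewrite /breaking_loss; case: ifP => _; last by rewrite lexx ler01.
by have /andP[-> /ltW] := al01 (solY u v F G0 L (th x) (x + F x)).
Qed.

Lemma lipschitz_measurable (f : R -> R) (K : R) : 0 <= K ->
  (forall x y, `|f x - f y| <= K * `|x - y|) -> mfun setT f.
Proof.
move=> K0 fK; apply: continuous_measurable_fun => x; apply/cvgrPdist_le => e e0.
have K1 : 0 < K + 1 by rewrite ltr_wpDl.
near=> y; rewrite (le_trans (fK _ _))//.
have : `|x - y| <= e / (K + 1).
  near: y; apply: cvgr_dist_le; last exact: divr_gt0.
  exact: cvg_id.
rewrite ler_pdivlMr//; have := normr_ge0 (x - y); set d := `|x - y| => d0 h.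
by have := mulr_ge0 K0 d0; lra.
Unshelve. all: by end_near. Qed.

Lemma measurable_breaking_loss L : mfun setT L -> (forall x, 0 <= L x <= 1) ->
  mfun setT (breaking_loss L).
Proof.
move=> mL L01; have mv := hs_mv hd.
have my := measurable_yinit hd.
have mvy : mfun setT (fun xi => v (yinit F xi)) by exact: measurableT_comp mv my.
have mt : mfun setT (fun xi => - 2 / v (yinit F xi)).
  by apply: measurable_funM => //; exact: mfunV.
have ms1 := measurable_solY hd mL L01 mt.
have me := measurable_e hd.
have hs : mfun setT (fun x => alpha (solY u v F G0 L (th x) (x + F x))).
  have := measurableT_comp (lipschitz_measurable A0 alA) (measurableT_comp ms1 me).
  by congr measurable_fun; apply/funext => x /=; rewrite (yinitK hd).
rewrite (_ : breaking_loss L = fun x => (1 - step (- v x)) * alpha (solY u v F G0 L (th x) (x + F x))).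
  apply: measurable_funM => //; apply: measurable_funB => //.
  by apply: measurableT_comp; [exact: measurable_step|exact: measurableT_comp].
apply/funext => x; rewrite /breaking_loss /step oppr_le0.
by case: ltP => _; rewrite ?subr0 ?mul1r// subrr mul0r.
Qed.

Fixpoint picard n : R -> R := if n is n'.+1 then breaking_loss (picard n') else cst 0.

Lemma picard01 n x : 0 <= picard n x <= 1.
Proof. by case: n => [|n]; [rewrite /= lexx ler01|exact: breaking_loss01]. Qed.

Lemma measurable_picard n : mfun setT (picard n).
Proof.
elim: n => [|n IH]; first exact: measurable_cst.
by apply: measurable_breaking_loss => // x; exact: picard01.
Qed.

Lemma picard_diff n k x : v x < 0 ->
  `|picard (n + k)%N x - picard n x| <= 2 ^- n * expR (lam * th x).
Proof.
elim: n k x => [|n IH] k x v0.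
  rewrite expr0 invr1 mul1r add0n subr0 (@le_trans _ _ 1)//.
    by have /andP[h1 h2] := picard01 k x; rewrite ger0_norm.
  apply: (le_trans _ (expR_ge1Dx _)); rewrite lerDl mulr_ge0//; first exact: le_trans lam1.
  by rewrite /th mulNr oppr_ge0 ltW// pmulr_rlt0// invr_lt0.
have -> : 2 ^- n.+1 = 2 ^- n / 2 :> R by rewrite exprS invfM mulrC.
have p0 : 0 <= 2 ^- n :> R by rewrite invr_ge0 exprn_ge0.
by apply: breaking_loss_diff => //; [exact: measurable_picard|exact: picard01|exact: measurable_picard
  |exact: picard01|move=> z; exact: IH].
Qed.

Lemma half_pow_cvg0 (c : R) : (fun n : nat => 2 ^- n * c) @ \oo --> (0 : R).
Proof.
have : (fun n : nat => 2 ^- n * c) @ \oo --> (0 * c : R).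
  apply: cvgM; last exact: cvg_cst.
  rewrite (_ : (fun n : nat => (2 ^- n : R)) = geometric 1 (2^-1)); last first.
    by apply/funext => n; rewrite /= mul1r exprVn.
  by apply: cvg_geometric; rewrite ger0_norm ?invr_ge0// invf_lt1// ltr1n.
by rewrite mul0r.
Qed.

(** The convergence is pointwise, not uniform: the weight exp(lam tau) is unbounded as the slope
    tends to 0 from below. *)
Lemma picard_cvg x : exists l : R, (fun n => picard n x) @ \oo --> l.
Proof.
have [v0|v0] := ltP (v x) 0; last first.
  exists 0; apply: cvg_near_cst; near=> n.
  have [m ->] : exists m, n = m.+1 by exists n.-1; rewrite prednK//; near: n; exists 1%N.
  by rewrite /= /breaking_loss ltNge v0.
exists (limn (fun n => picard n x)); apply/cauchy_cvgP/cauchy_exP => e e0.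
have /cvgrPdist_lt /(_ _ e0)[n _ /(_ n (leqnn n))] := half_pow_cvg0 (expR (lam * th x)).
rewrite /= sub0r normrN => hn; exists (picard n x); exists n => // k /= nk.
rewrite -ball_normE /= distrC; apply: le_lt_trans hn.
rewrite -(subnKC nk) (le_trans (picard_diff _ _ v0))// ler_norm//.
Unshelve. all: by end_near. Qed.

Lemma breaking_loss_fixpoint : exists L, [/\ mfun setT L, (forall x, 0 <= L x <= 1) &
  forall x, v x < 0 -> L x = alpha (solY u v F G0 L (- 2 / v x) (x + F x))].
Proof.
have /choice[L hL] := picard_cvg.
have mL : mfun setT L.
  apply: (@measurable_fun_cvg _ _ _ _ picard) => [n|x _]; first exact: measurable_picard.
  exact: hL.
have L01 x : 0 <= L x <= 1.
  apply/andP; split.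
    by apply: (cvgr_to_ge (hL x)); apply: nearW => n; have /andP[] := picard01 n x.
  by apply: (cvgr_to_le (hL x)); apply: nearW => n; have /andP[] := picard01 n x.
exists L; split => // x v0.
have Ln n z : v z < 0 -> `|L z - picard n z| <= 2 ^- n * expR (lam * th z).
  move=> vz; have h : `|picard k z - picard n z| @[k --> \oo] --> `|L z - picard n z|.
    by apply: cvg_norm; apply: cvgB; [exact: hL|exact: cvg_cst].
  apply: (cvgr_to_le h); near=> k.
  have -> : k = (n + (k - n))%N by rewrite subnKC//; near: k; exists n.
  exact: picard_diff.
have hn n : `|L x - breaking_loss L x| <= 2 ^- n * expR (lam * th x).
  have p0 : 0 <= 2 ^- n :> R by rewrite invr_ge0 exprn_ge0.
  have h1 := Ln n.+1 x v0.
  (* The contraction applies to [L] and [picard n], whose weighted distance is at most 2^-n, and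
     [picard n.+1] is the image of [picard n]. *)
  have h2 := breaking_loss_diff mL L01 (measurable_picard n) (picard01 n) p0 (Ln n) v0.
  have e2 : 2 ^- n.+1 = 2 ^- n / 2 :> R by rewrite exprS invfM mulrC.
  rewrite e2 in h1.
  have -> : L x - breaking_loss L x = (L x - picard n.+1 x) - (breaking_loss L x - breaking_loss (picard n) x).
    by rewrite /=; lra.
  by rewrite (le_trans (ler_normB _ _))//; lra.
have : L x = breaking_loss L x.
  apply/eqP; rewrite -subr_eq0 -normr_le0.
  by apply: (cvgr_to_ge (half_pow_cvg0 (expR (lam * th x)))); exact: nearW.
by rewrite /breaking_loss v0.
Unshelve. all: by end_near. Qed.

End Existence.

(** * Regularity and stability of solutions *)

Section Regularity.
Variable R : realType.
Variables (u v F : R -> R) (G0 : R).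
Variable ms : {finite_measure set (measurableTypeR R) -> \bar R}.
Variable N : set R.
Hypothesis hd : hs_data u v F G0 ms N.

Notation yb := (yinit F).

Let mv : mfun setT v := hs_mv hd.

Lemma hs_G0_ge0 : 0 <= G0.
Proof. exact: le_trans (hs_F_ge0 hd 0) (hs_F_le hd 0). Qed.

Lemma hs_energy_itv a b : exists w, [/\ has_integral `[a, b[ (fun x => v x ^+ 2) w,
  0 <= w & w <= G0].
Proof.
have [Q [hQ Q0 QG]] := hs_energy hd.
have [w [h w0 wQ]] := has_integralS_ge0 measurableT (mset_itvco a b) (@subsetT _ _)
  (fun x _ => sqr_ge0 (v x)) hQ.
by exists w; split => //; exact: le_trans wQ QG.
Qed.

Lemma yinit_energy_itv a b : a <= b -> exists w,
  [/\ has_integral `[yb a, yb b[ (fun x => v x ^+ 2) w, 0 <= w &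
      w <= (b - yb b) - (a - yb a)].
Proof.
move=> ab; have [w [hw w0 _]] := hs_energy_itv (yb a) (yb b); exists w; split => //.
have mv2 : mfun setT (fun x => v x ^+ 2) by exact: measurable_funX.
apply: (has_integral_leT _ (yinit_cv_itv hd mv2 hw) (vinit_primitive hd ab)) => // xi _.
rewrite /dyinit; case: ifP => _; first by rewrite mulr0 subr0.
have h : 0 < 1 + v (yb xi) ^+ 2 by rewrite ltr_pwDl// sqr_ge0.
rewrite le_eqVlt; apply/orP; left; apply/eqP; field; exact: lt0r_neq0.
Qed.

(** The Hoelder bound of exponent 1/2 in Young's form: e of the order of the square root of
    [|b - a|] restores it, and no square root has to be handled. *)
Lemma hs_u_young e a b : 0 < e -> `|u b - u a| <= `|b - a| / (2 * e) + e / 2 * G0.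
Proof.
move=> e0; wlog ab : a b / a <= b.
  move=> h; have [|/ltW] := leP a b; first exact: h.
  by rewrite distrC (distrC b); exact: h.
have [w [hw w0 wG]] := hs_energy_itv a b.
have h1 := has_integral_itvcc_co (hs_u hd ab).
have h2 := has_integral_itvcc_co (has_integral_cst ((2 * e)^-1) ab).
have h3 := has_integralD (mset_itvco a b) h2 (has_integralZ (e / 2) (mset_itvco a b) hw).
have hle x : `[a, b[%classic x -> `|v x| <= (2 * e)^-1 + e / 2 * v x ^+ 2.
  move=> _; rewrite -subr_ge0.
  have -> : (2 * e)^-1 + e / 2 * v x ^+ 2 - `|v x| = (1 - e * `|v x|) ^+ 2 / (2 * e).
    by rewrite -[v x ^+ 2]real_normK ?num_real//; field; rewrite gt_eqF.
  by rewrite divr_ge0 ?sqr_ge0// mulr_ge0// ltW.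
have [w' [hw' w'le]] := has_integral_dom (mset_itvco a b) (has_integral_measurable h1) h3 hle.
rewrite (has_integral_uniq h1 hw') (le_trans w'le)// ger0_norm ?subr_ge0//.
rewrite mulrC lerD2l ler_wpM2l// divr_ge0// ltW//.
Qed.

Lemma cum_yinit_lip (q : R -> R) k a b : mfun setT q -> 0 <= k ->
  (forall x, 0 <= q x <= k * v x ^+ 2) -> a <= b ->
  0 <= cum q (yb b) - cum q (yb a) <= k * ((b - yb b) - (a - yb a)).
Proof.
move=> mq k0 hq ab; have [hT _] := dominated_energy hd mq k0 hq.
have hs := has_integral_sub hT (yinit_nd hd ab).
have [w [hw w0 wle]] := yinit_energy_itv ab.
apply/andP; split.
  by apply: has_integral_ge0 hs _ => x _; have /andP[] := hq x.
rewrite (@le_trans _ _ (k * w)) ?ler_wpM2l//.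
apply: (has_integral_leT _ hs (has_integralZ k _ hw)) => // x _.
by have /andP[] := hq x.
Qed.

Variable L : R -> R.
Hypotheses (mL : mfun setT L) (L01 : forall x, 0 <= L x <= 1).

Notation Y t := (solY u v F G0 L t).
Notation U t := (solU u v F G0 L t).

Lemma solY_lip t a b : 0 <= t -> `|Y t a - Y t b| <= (1 + t + t ^+ 2) * `|a - b|.
Proof.
move=> t0; wlog ab : a b / a <= b.
  move=> h; have [|/ltW] := leP a b; first exact: h.
  by rewrite distrC (distrC a); exact: h.
have h1 := yinit_nd hd ab; have h2 := yinit_lip hd ab.
have h3 := yinit_mono_energy hd ab.
have := uinit_lip hd a b; rewrite !(distrC a) [`|b - a|]ger0_norm ?subr_ge0// => h4.
have t2 : 0 <= t ^+ 2 / 2 by rewrite divr_ge0// sqr_ge0.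
have := cum_yinit_lip (measurable_loss2 hd mL t) t2 (fun x => loss2_bnd v L01 x t0) ab.
move=> /andP[h5 h6]; rewrite distrC.
move: h1 h2 h3 h4 h5 h6; rewrite /solY.
move: (yb a) (yb b) (u _) (u _) (tot _) (cum _ _) (cum _ _) => y1 y2 u1 u2 q c1 c2 h1 h2 h3 h4 h5 h6.
have := ler_wpM2l t0 h4; rewrite -[t in t * `|_|]ger0_norm// -normrM.
have := ler_wpM2l t2 (_ : b - y2 - (a - y1) <= b - a); have : b - y2 - (a - y1) <= b - a by lra.
move=> h7 /(_ h7) h8; have h9 : 0 <= t ^+ 2 / 2 * (b - y2 - (a - y1)) by apply: mulr_ge0 => //; lra.
rewrite !ler_norml; lra.
Qed.

Lemma solU_lip t a b : 0 <= t -> `|U t a - U t b| <= (1 + t) * `|a - b|.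
Proof.
move=> t0; wlog ab : a b / a <= b.
  move=> h; have [|/ltW] := leP a b; first exact: h.
  by rewrite distrC (distrC a); exact: h.
have h1 := yinit_nd hd ab.
have h3 := yinit_mono_energy hd ab.
have := uinit_lip hd a b; rewrite !(distrC a) [`|b - a|]ger0_norm ?subr_ge0// => h4.
have := cum_yinit_lip (measurable_loss1 hd mL t) t0 (fun x => loss1_bnd v L01 x t0) ab.
move=> /andP[h5 h6]; rewrite distrC.
move: h1 h3 h4 h5 h6; rewrite /solU.
move: (yb a) (yb b) (u _) (u _) (tot _) (cum _ _) (cum _ _) => y1 y2 u1 u2 q c1 c2 h1 h3 h4 h5 h6.
have h7 : b - y2 - (a - y1) <= b - a by lra.
have := ler_wpM2l t0 h7; have h9 : 0 <= t * (b - y2 - (a - y1)) by apply: mulr_ge0 => //; lra.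
by move: h4; rewrite !ler_norml; lra.
Qed.

Lemma solU_bound U0 t xi : (forall x, `|u x| <= U0) -> 0 <= t ->
  `|U t xi| <= U0 + t * G0.
Proof.
move=> hU t0; have hu := hU (yb xi).
have [i1 t1] := loss1_int hd mL L01 t0.
have q0 x : 0 <= loss1 v L t x by have /andP[] := loss1_bnd v L01 x t0.
have c0 := cum_ge0 q0 i1 (yb xi); have c1 := cum_le q0 i1 (yb xi).
have e0 := yinit_energy_ge0 hd xi; have e1 := yinit_energy_le hd xi.
have := mulr_ge0 t0 e0; have := ler_wpM2l t0 e1.
by move: hu; rewrite /solU !ler_norml; lra.
Qed.

Lemma solY_time_lip U0 T t t' xi : (forall x, `|u x| <= U0) ->
  0 <= t <= T -> 0 <= t' <= T -> `|Y t xi - Y t' xi| <= (U0 + T * G0) * `|t - t'|.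
Proof.
move=> hU ht ht'; wlog tt : t t' ht ht' / t <= t'.
  move=> h; have [|/ltW] := leP t t'; first exact: h.
  by rewrite distrC (distrC t); exact: h.
have /andP[t0 tT] := ht; have /andP[t'0 t'T] := ht'.
have h1 := has_integral_itvcc_co (solY_time hd mL L01 xi t0).
have h2 := has_integral_itvcc_co (solY_time hd mL L01 xi t'0).
have sub : `[t, t'[%classic `<=` (`[0, t'[%classic : set R).
  by move=> x /=; rewrite !in_itv/= => /andP[h ->]; rewrite (le_trans t0 h).
have [w hw] := has_integralS (mset_itvco 0 t') (mset_itvco t t') sub h2.
have E := has_integral_uniq (has_integral_cat_co t0 tt h1 hw) h2.
have -> : Y t xi - Y t' xi = - w by lra.
have hb x : `[t, t'[%classic x -> `|U x xi| <= U0 + T * G0.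
  rewrite /= in_itv/= => /andP[x0 xt].
  rewrite (le_trans (solU_bound xi hU (le_trans t0 x0)))// lerD2l ler_wpM2r ?hs_G0_ge0//.
  exact: le_trans (ltW xt) t'T.
have hc := has_integral_itvcc_co (has_integral_cst (U0 + T * G0) tt).
have [w' [hw' w'le]] := has_integral_dom (mset_itvco t t') (has_integral_measurable hw) hc hb.
by rewrite normrN (has_integral_uniq hw hw') (le_trans w'le)// distrC ger0_norm// subr_ge0.
Qed.

Lemma solY_dist U0 t xi : (forall x, `|u x| <= U0) -> 0 <= t ->
  `|Y t xi - xi| <= G0 + t * U0 + t ^+ 2 * G0.
Proof.
move=> hU t0; have hu := hU (yb xi).
have [i1 t1] := loss2_int hd mL L01 t0.
have q0 x : 0 <= loss2 v L t x by have /andP[] := loss2_bnd v L01 x t0.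
have c0 := cum_ge0 q0 i1 (yb xi); have c1 := cum_le q0 i1 (yb xi).
have e0 := yinit_energy_ge0 hd xi; have e1 := yinit_energy_le hd xi.
have t2 := sqr_ge0 t.
have := mulr_ge0 t2 e0; have := ler_wpM2l t2 e1; have := mulr_ge0 t2 hs_G0_ge0.
have := ler_wpM2l t0 hu; rewrite -[t in t * `|_|]ger0_norm// -normrM.
by rewrite /solY !ler_norml; lra.
Qed.

(* With z = 2 + t v, both sides are quadratic in z and v, and the inequality is
   2 v z <= e z^2 + v^2 / e. *)
Let holder_pointwise e t x (s : R) : 0 < e -> (s = 1 \/ s = -1) ->
  s * (v x + t / 2 * v x ^+ 2 - loss1 v L t x / 2) <=
  e * (1 + t * v x + t ^+ 2 / 4 * v x ^+ 2 - loss2 v L t x / 2) + v x ^+ 2 / (4 * e).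
Proof.
move=> e0 hs; rewrite /loss1 /loss2; have /andP[l0 l1] := L01 x.
have sq (c z : R) : s * (c * z / 2) <= e * (z ^+ 2 / 4) + c ^+ 2 / (4 * e).
  rewrite -subr_ge0.
  have -> : e * (z ^+ 2 / 4) + c ^+ 2 / (4 * e) - s * (c * z / 2) = (e * z - s * c) ^+ 2 / (4 * e).
    by case: hs => ->; field; rewrite gt_eqF.
  by rewrite divr_ge0 ?sqr_ge0// mulr_ge0// ltW.
move: (v x) (L x) l0 l1 => c l l0 l1; rewrite /ppart.
have := sq c (2 + t * c); case: (ltP 0 (- (2 + t * c))) => h; last first.
  rewrite expr0n/= mulr0 !mul0r mulr0 !mul0r !subr0.
  have -> : c * (2 + t * c) / 2 = c + t / 2 * c ^+ 2 by rewrite expr2; lra.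
  have -> // : (2 + t * c) ^+ 2 / 4 = 1 + t * c + t ^+ 2 / 4 * c ^+ 2 by field.
move=> h1.
(* After breaking, the corrections by [loss1] and [loss2] multiply both quadratic forms by 1 - l,
   and the last term only gains from it. *)
have h2 : (1 - l) * (s * (c * (2 + t * c) / 2)) <= e * ((1 - l) * ((2 + t * c) ^+ 2 / 4)) + c ^+ 2 / (4 * e).
  have l2 : 0 <= 1 - l by lra.
  have := ler_wpM2l l2 h1; have c0 : 0 <= c ^+ 2 / (4 * e) by rewrite divr_ge0 ?sqr_ge0// mulr_ge0// ltW.
  by have := mulr_ge0 l0 c0; lra.
by move: h2; congr (_ <= _ + _); field.
Qed.

Lemma solU_holder e t a b : 0 < e -> 0 <= t -> a <= b ->
  `|U t b - U t a| <= e * (Y t b - Y t a) + G0 / (4 * e).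
Proof.
move=> e0 t0 ab.
have hI := mset_itvco (yb a) (yb b).
have ynd := yinit_nd hd ab.
have h0 := has_integral_itvcc_co (has_integral_cst 1 ynd).
have h1 := has_integral_itvcc_co (hs_u hd ynd).
have [w [h2 w0 wle]] := yinit_energy_itv ab.
have [i1 _] := loss1_int hd mL L01 t0; have [i2 _] := loss2_int hd mL L01 t0.
have h3 := has_integral_sub i1 ynd; have h4 := has_integral_sub i2 ynd.
have hl s := has_integralZ s hI (has_integralB hI (has_integralD hI h1 (has_integralZ (t / 2) hI h2))
  (has_integralZ (2^-1) hI h3)).
have hr := has_integralD hI (has_integralZ e hI (has_integralB hI (has_integralD hI
  (has_integralD hI h0 (has_integralZ t hI h1)) (has_integralZ (t ^+ 2 / 4) hI h2))
  (has_integralZ (2^-1) hI h4))) (has_integralZ ((4 * e)^-1) hI h2).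
have main s : s = 1 \/ s = -1 -> s * (U t b - U t a) <= e * (Y t b - Y t a) + G0 / (4 * e).
  move=> hs; have := has_integral_leT hI (hl s) hr.
  have pw x : s * (v x + t / 2 * v x ^+ 2 - 2^-1 * loss1 v L t x)
     <= e * (1 + t * v x + t ^+ 2 / 4 * v x ^+ 2 - 2^-1 * loss2 v L t x) + (4 * e)^-1 * v x ^+ 2.
    by have := holder_pointwise t x e0 hs; lra.
  move=> /(_ (fun x _ => pw x)).
  have E0 := yinit_energy_ge0 hd a; have E1 := yinit_energy_le hd b.
  (* The singular energy between the two labels. It enters U with factor t/2 and Y with factor
     t^2/4, and obeys the same quadratic inequality, without loss. *)
  set S := (b - yb b) - (a - yb a) - w.
  have S0 : 0 <= S by rewrite /S; lra.
  have hS : s * (t / 2 * S) <= e * (t ^+ 2 / 4 * S) + S / (4 * e).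
    rewrite -subr_ge0.
    have -> : e * (t ^+ 2 / 4 * S) + S / (4 * e) - s * (t / 2 * S) = S * ((e * t - s) ^+ 2 / (4 * e)).
      by case: hs => ->; field; rewrite gt_eqF.
    by apply: mulr_ge0 => //; rewrite divr_ge0 ?sqr_ge0// mulr_ge0// ltW.
  have e4 : 0 <= (4 * e)^-1 by rewrite invr_ge0 mulr_ge0// ltW.
  have hG : (w + S) / (4 * e) <= G0 / (4 * e) by apply: ler_wpM2r => //; rewrite /S; lra.
  have Sw : (b - yb b) - (a - yb a) = w + S by rewrite /S; lra.
  move: Sw hS hG => /eqP; rewrite subr_eq => /eqP Sb; rewrite /solU /solY Sb.
  move: ((4 * e)^-1) (cum (loss1 v L t)) (cum (loss2 v L t)) => k c1 c2.
  by case: hs => ->; lra.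
rewrite ler_norml; move: (main 1 (or_introl erefl)) (main (-1) (or_intror erefl)).
by move: (U t b - U t a) (e * (Y t b - Y t a) + G0 / (4 * e)) => d r; lra.
Qed.

End Regularity.

Lemma near_id_surjective (R : realType) (f : R -> R) (C : R) : continuous f ->
  (forall x, `|f x - x| <= C) -> forall y, exists x, f x = y.
Proof.
move=> cf hC y.
have C0 : 0 <= C by exact: le_trans (normr_ge0 _) (hC 0).
have ab : y - C <= y + C by lra.
have := hC (y - C); have := hC (y + C); rewrite !ler_norml => /andP[h1 h2] /andP[h3 h4].
have [|x _ xy] := @IVT R f (y - C) (y + C) y ab (continuous_subspaceT cf).
  by rewrite ge_min le_max; apply/andP; split; apply/orP; [left|right]; lra.
by exists x.
Qed.

(** * Stability with respect to the data *)

Section PpartLipschitz.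
Variable R : realType.
Implicit Types (t a b : R).

Lemma ppart_lip t a b : 0 <= t -> `|ppart t a - ppart t b| <= t * `|a - b|.
Proof.
move=> t0; rewrite -[t in leRHS]ger0_norm// -normrM.
have -> : t * (a - b) = - ((- (2 + t * a)) - (- (2 + t * b))) by lra.
rewrite normrN /ppart; move: (- (2 + t * a)) (- (2 + t * b)) => x y.
rewrite ler_norml; have := ler_norm (x - y); have := ler_norm (- (x - y)); rewrite normrN.
by rewrite !maxEle; case: (leP 0 x); case: (leP 0 y) => ? ? ? ?; have := normr_ge0 (x - y); lra.
Qed.

Lemma sqr_ppart_lip t a b : 0 <= t ->
  `|ppart t a ^+ 2 / 2 - ppart t b ^+ 2 / 2| <= t ^+ 2 / 2 * ((`|a| + `|b|) * `|a - b|).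
Proof.
move=> t0; have h1 := ppart_lip a b t0.
have h2 := ppart_le a t0; have h3 := ppart_le b t0.
have pa := ppart_ge0 t a; have pb := ppart_ge0 t b.
have -> : ppart t a ^+ 2 / 2 - ppart t b ^+ 2 / 2 = (ppart t a + ppart t b) * (ppart t a - ppart t b) / 2 by field.
rewrite normrM normrM (ger0_norm (_ : 0 <= ppart t a + ppart t b)) ?addr_ge0//.
rewrite [`|2^-1|]ger0_norm ?invr_ge0//.
have : (ppart t a + ppart t b) * `|ppart t a - ppart t b| <= (t * (`|a| + `|b|)) * (t * `|a - b|).
  by apply: ler_pM => //; [exact: addr_ge0|lra].
by rewrite expr2; move: (ppart t a + ppart t b) => p; lra.
Qed.

Lemma cppart_lip t a b : 0 <= t ->
  `|- a * ppart t a - - b * ppart t b| <= t * ((`|a| + `|b|) * `|a - b|).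
Proof.
move=> t0; have h1 := ppart_lip a b t0.
have h2 := ppart_le a t0.
have pa := ppart_ge0 t a.
have -> : - a * ppart t a - - b * ppart t b = - ((a - b) * ppart t a + b * (ppart t a - ppart t b)) by ring.
rewrite normrN (le_trans (ler_normD _ _))// !normrM (ger0_norm pa).
have i1 := ler_wpM2l (normr_ge0 (a - b)) h2; have i2 := ler_wpM2l (normr_ge0 b) h1.
by move: i1 i2; lra.
Qed.

Lemma ppart_neq0 t T a : 0 <= t <= T -> ppart t a != 0 -> a < 0 /\ 2 + T * a <= 0.
Proof.
move=> /andP[t0 tT]; rewrite /ppart; case: (ltP 0 (- (2 + t * a))); last by rewrite eqxx.
move=> h _; have a0 : a < 0.
  by rewrite ltNge; apply/negP => a0; have := mulr_ge0 t0 a0; lra.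
by split=> //; have := ler_wnM2r (ltW a0) tT; lra.
Qed.

End PpartLipschitz.

Section Stability.
Variable R : realType.
Variables (A U0 G0 T : R).

Let lam := 3 * A * G0 + 1.
(** [CF] bounds the effect of the data on the losses: A times a Lipschitz constant of the position
    in the label, 2 for particles whose slopes are far apart, and A times the speed up to time 2T,
    multiplied by the 2T of [theta_diff]. [CY] and [CU] add the differences of initial position,
    velocity and energy to those of the integrated losses; [CU] already contains the resulting bound
    2 [CY] on positions. *)
Let CF := A * (1 + 2 * T + 4 * T ^+ 2) + 2 + 2 * A * T * (U0 + 2 * T * G0).
Let CY := 1 + T + T ^+ 2 + 3 / 2 * T ^+ 2 * (CF + 1).
Let CU := 1 + 2 * T + 3 / 2 * (A * CY * T * expR (lam * T) * G0) + 3 / 2 * T * (CF + 1).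

Definition stability_constant := 2 * CY * expR (lam * T) + CU.

Variables (u v F uh w Fh : R -> R).
Variables ms mh : {finite_measure set (measurableTypeR R) -> \bar R}.
Variable N Nh : set R.
Hypothesis hd : hs_data u v F G0 ms N.
Hypothesis hdh : hs_data uh w Fh G0 mh Nh.
Variable alpha : R -> R.
Hypotheses (al01 : forall x, 0 <= alpha x < 1) (A0 : 0 <= A)
  (alA : forall x y, `|alpha x - alpha y| <= A * `|x - y|).
Hypothesis T0 : 0 < T.
Variables L Lh : R -> R.
Hypotheses (mL : mfun setT L) (L01 : forall x, 0 <= L x <= 1).
Hypotheses (mLh : mfun setT Lh) (Lh01 : forall x, 0 <= Lh x <= 1).

Notation Y := (solY u v F G0 L).
Notation Yh := (solY uh w Fh G0 Lh).
Notation U := (solU u v F G0 L).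
Notation Uh := (solU uh w Fh G0 Lh).
Notation yb := (yinit F).
Notation yh := (yinit Fh).

Hypothesis hL : {ae (@lebesgue_measure R), forall x, 2 + T * v x <= 0 ->
  L x = alpha (Y (- 2 / v x) (x + F x))}.
Hypothesis hLh : forall x, w x < 0 -> Lh x = alpha (Yh (- 2 / w x) (x + Fh x)).
Hypotheses (hU : forall x, `|u x| <= U0) (hUh : forall x, `|uh x| <= U0).
Variable d : R.
(** [h3] pays for the different limits of integration of a common label, [h4] for the different
    labels [x + F x] and [x + Fh x] of a common position, and [h5] for the different slopes and
    breaking times. *)
Hypotheses (h1 : forall xi, `|yb xi - yh xi| <= d)
  (h2 : forall xi, `|u (yb xi) - uh (yh xi)| <= d)
  (h3 : forall xi a b, a <= b -> `|b - a| = `|yb xi - yh xi| -> 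
     forall i, has_integral `[a, b[ (fun x => v x ^+ 2) i -> i <= d)
  (h4 : exists i, has_integral setT (fun x => `|F x - Fh x| * v x ^+ 2) i /\ i <= d)
  (h5 : exists i, has_integral setT (fun x => (`|v x| + `|w x|) * `|v x - w x|) i /\ i <= d).

Let G00 := hs_G0_ge0 hd.
Let lam1 : 1 <= lam. Proof. by rewrite lerDr !mulr_ge0. Qed.
Let U00 : 0 <= U0. Proof. exact: le_trans (normr_ge0 _) (hU 0). Qed.
Let d0 : 0 <= d. Proof. exact: le_trans (normr_ge0 _) (h1 0). Qed.
Let CF0 : 0 <= CF.
Proof.
have t2 := sqr_ge0 T; have tt := ltW T0.
by rewrite /CF !addr_ge0 ?mulr_ge0// ?addr_ge0 ?mulr_ge0//.
Qed.

Let CF2 : 2 <= CF.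
Proof.
have t2 := sqr_ge0 T; have tt := ltW T0.
have : 0 <= A * (1 + 2 * T + 4 * T ^+ 2) + 2 * A * T * (U0 + 2 * T * G0).
  by rewrite !addr_ge0 ?mulr_ge0// ?addr_ge0 ?mulr_ge0.
by rewrite /CF; lra.
Qed.
Let CF10 : 0 <= CF + 1. Proof. by rewrite addr_ge0. Qed.

Let CY0 : 0 <= CY.
Proof.
rewrite /CY; apply: addr_ge0; first by rewrite !addr_ge0 ?sqr_ge0// ltW.
by apply: mulr_ge0 => //; apply: mulr_ge0 => //; exact: sqr_ge0.
Qed.

Let bounded_by K := forall t xi, 0 <= t <= T -> `|Y t xi - Yh t xi| <= K * expR (lam * t).

Section Step.
Variable K : R.
Hypotheses (K0 : 0 <= K) (hK : bounded_by K).

Let quadratic_le (x t : R) : 0 <= x -> x <= t -> 1 + x + x ^+ 2 <= 1 + 2 * t + 4 * t ^+ 2.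
Proof.
move=> x0 xt; have : x ^+ 2 <= t ^+ 2 by rewrite lerXn2r ?nnegrE ?(le_trans x0 xt).
by have := sqr_ge0 t; move: (x ^+ 2) (t ^+ 2) => a b; lra.
Qed.

Let collect_le (e a1 a2 g r1 r2 f : R) :
  a1 * r1 <= a1 * (e * f) -> a2 * r2 <= a2 * (e * (2 * T * g)) ->
  0 <= e * (2 + 2 * T * a2) * f -> 0 <= e * (a1 + 2) * g ->
  a1 * r1 + a2 * r2 <= e * (a1 + 2 + 2 * T * a2) * (f + g).
Proof. lra. Qed.

(** The left side is 2 |a - b| a / b with a / b <= 2, and breaking by time T means 2 <= T |a|; this
    restores the factor |a| that [h5] provides. *)
Let theta_diff (a b : R) : a < 0 -> b <= a / 2 -> 2 + T * a <= 0 ->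
  `|- 2 / a - - 2 / b| * a ^+ 2 <= 2 * T * (`|a| * `|a - b|).
Proof.
move=> a0 ba aT; have b0 : b < 0 by lra.
have -> : - 2 / a - - 2 / b = 2 * (a - b) / (a * b).
  by field; rewrite !lt_eqF.
have ab : 0 < a * b by rewrite nmulr_rgt0.
rewrite !normrM normfV (gtr0_norm ab) ger0_norm// (ltr0_norm a0).
have n0 := normr_ge0 (a - b).
have k1 : a ^+ 2 <= 2 * (a * b).
  by have := ler_wnM2l (ltW a0) ba; rewrite expr2; lra.
have k2 : (a * b)^-1 * a ^+ 2 <= 2 by rewrite mulrC ler_pdivrMr.
have k3 : 2 * `|a - b| / (a * b) * a ^+ 2 <= 4 * `|a - b|.
  have nn : 0 <= 2 * `|a - b| by rewrite mulr_ge0.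
  by have := ler_wpM2l nn k2; rewrite !mulrA; lra.
have k4 : 2 * `|a - b| <= (T * - a) * `|a - b| by apply: ler_wpM2r => //; lra.
by move: k3 k4; rewrite !mulrA; lra.
Qed.

Let loss_diff_pointwise : {ae (@lebesgue_measure R), forall x, forall q c, 0 <= c ->
  0 <= q -> q <= c * v x ^+ 2 -> (q != 0 -> v x < 0 /\ 2 + T * v x <= 0) ->
  `|L x - Lh x| * q <= A * K * (expR (lam * (- 2 / v x)) * q) +
    c * CF * (`|F x - Fh x| * v x ^+ 2 + `|v x| * `|v x - w x|)}.
Proof.
apply: aeS hL => x hLx q c c0 q0 qc qv.
have e0 := expR_ge0 (lam * (- 2 / v x)); set E := expR _ in e0 *.
have f0 : 0 <= `|F x - Fh x| * v x ^+ 2 by rewrite mulr_ge0 ?sqr_ge0.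
have g0 : 0 <= `|v x| * `|v x - w x| by rewrite mulr_ge0.
have [q00|qn0] := eqVneq q 0.
  rewrite q00 !mulr0 add0r; apply: mulr_ge0; first exact: mulr_ge0.
  exact: addr_ge0.
have [v0 vT] := qv qn0.
have AK0 : 0 <= A * K by exact: mulr_ge0.
have AKE : 0 <= A * K * (E * q) by exact: mulr_ge0 AK0 (mulr_ge0 e0 q0).
have /andP[l0 l1] := L01 x; have /andP[lh0 lh1] := Lh01 x.
(* If w > v/2, then |v| <= 2 |v - w| and it suffices to bound the difference of losses by 1.
   Otherwise the projected particle breaks too, by time 2T, and the two positions at breaking can be
   compared. *)
have [wv|wv] := ltP (v x / 2) (w x).
  have hl : `|L x - Lh x| * q <= q.
    by rewrite -[leRHS]mul1r ler_wpM2r// ler_norml; lra.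
  have hv : v x ^+ 2 <= 2 * (`|v x| * `|v x - w x|).
    rewrite (ltr0_norm v0) -[v x ^+ 2]sqrrN expr2.
    have : - v x * - v x <= - v x * (2 * `|v x - w x|).
      apply: ler_wpM2l; first by lra.
      by have := ler_norm (- (v x - w x)); rewrite normrN; lra.
    by lra.
  have hq : q <= c * 2 * (`|v x| * `|v x - w x|).
    by rewrite (le_trans qc)// -mulrA ler_wpM2l.
  have hC : c * 2 * (`|v x| * `|v x - w x|) <= c * CF * (`|v x| * `|v x - w x|).
    by apply: ler_wpM2r => //; exact: ler_wpM2l.
  have : 0 <= c * CF * (`|F x - Fh x| * v x ^+ 2) by apply: mulr_ge0 => //; exact: mulr_ge0.
  move=> fC; apply: (le_trans (le_trans hl (le_trans hq hC))).
  by rewrite [c * CF * (_ + _)]mulrDr addrA lerDr; exact: addr_ge0.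
have w0 : w x < 0 by lra.
have tT : 0 <= - 2 / v x <= T.
  rewrite ler_ndivrMr// mulNr oppr_ge0 ltW ?pmulr_rlt0 ?invr_lt0//=; lra.
have sT : 0 <= - 2 / w x <= 2 * T.
  rewrite ler_ndivrMr// mulNr oppr_ge0 ltW ?pmulr_rlt0 ?invr_lt0//=.
  by have := ler_wpM2l (ltW T0) wv; lra.
have tT2 : 0 <= - 2 / v x <= 2 * T by lra.
rewrite hLx// hLh//.
set X1 := Y _ _; set X2 := Yh _ _.
have B1 := hK (x + F x) tT; rewrite -/E -/X1 in B1.
have B2 := solY_lip hdh mLh Lh01 (x + F x) (x + Fh x) (proj1 (andP tT)).
have B3 := solY_time_lip hdh mLh Lh01 (x + Fh x) hUh tT2 sT; rewrite -/X2 in B3.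
have TT := quadratic_le (proj1 (andP tT)) (proj2 (andP tT)).
(* Three successive changes: of the evolution, at equal time and label; of the label; and of the
   breaking time. *)
have B4 : `|X1 - X2| <= K * E + (1 + 2 * T + 4 * T ^+ 2) * `|F x - Fh x| +
    (U0 + 2 * T * G0) * `|- 2 / v x - - 2 / w x|.
  apply: (le_trans (ler_distD (Yh (- 2 / v x) (x + Fh x)) _ _)); apply: lerD => //.
  apply: (le_trans (ler_distD (Yh (- 2 / v x) (x + F x)) _ _)); apply: lerD => //.
  rewrite (le_trans B2)// (_ : x + F x - (x + Fh x) = F x - Fh x); last by ring.
  by rewrite ler_wpM2r.
have B5 : `|alpha X1 - alpha X2| * q <= A * `|X1 - X2| * q by rewrite ler_wpM2r.
have B6 : A * `|X1 - X2| * q <= A * (K * E + (1 + 2 * T + 4 * T ^+ 2) * `|F x - Fh x| +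
    (U0 + 2 * T * G0) * `|- 2 / v x - - 2 / w x|) * q by rewrite ler_wpM2r// ler_wpM2l.
apply: (le_trans (le_trans B5 B6)).
have P0 : 0 <= A * (1 + 2 * T + 4 * T ^+ 2).
  by rewrite mulr_ge0// !addr_ge0// ?mulr_ge0 ?sqr_ge0// ltW.
have P1 : 0 <= A * (U0 + 2 * T * G0).
  by rewrite mulr_ge0// addr_ge0// !mulr_ge0// ltW.
have C1 : A * (1 + 2 * T + 4 * T ^+ 2) * (`|F x - Fh x| * q) <=
    A * (1 + 2 * T + 4 * T ^+ 2) * (c * (`|F x - Fh x| * v x ^+ 2)).
  by apply: ler_wpM2l => //; rewrite mulrCA ler_wpM2l.
have C2 : A * (U0 + 2 * T * G0) * (`|- 2 / v x - - 2 / w x| * q) <=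
    A * (U0 + 2 * T * G0) * (c * (2 * T * (`|v x| * `|v x - w x|))).
  apply: ler_wpM2l => //; rewrite (le_trans (ler_wpM2l (normr_ge0 _) qc))// mulrCA ler_wpM2l//.
  exact: theta_diff.
have C3 : 0 <= c * (2 + 2 * T * (A * (U0 + 2 * T * G0))) * (`|F x - Fh x| * v x ^+ 2).
  apply: mulr_ge0 => //; apply: mulr_ge0 => //; apply: addr_ge0 => //.
  by apply: mulr_ge0 => //; rewrite mulr_ge0// ltW.
have C4 : 0 <= c * (A * (1 + 2 * T + 4 * T ^+ 2) + 2) * (`|v x| * `|v x - w x|).
  by apply: mulr_ge0 => //; apply: mulr_ge0 => //; apply: addr_ge0.
have -> : A * (K * E + (1 + 2 * T + 4 * T ^+ 2) * `|F x - Fh x| + (U0 + 2 * T * G0) * `|- 2 / v x - - 2 / w x|) * q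
  = A * K * (E * q) + A * (1 + 2 * T + 4 * T ^+ 2) * (`|F x - Fh x| * q)
    + A * (U0 + 2 * T * G0) * (`|- 2 / v x - - 2 / w x| * q) by ring.
rewrite -addrA lerD2l.
have -> : CF = A * (1 + 2 * T + 4 * T ^+ 2) + 2 + 2 * T * (A * (U0 + 2 * T * G0)) by rewrite /CF; ring.
exact: collect_le.
Qed.

Section Functional.
(** [q] stands for the two kernels [ppart t a ^+ 2 / 2] of [loss2] and [- a * ppart t a] of
    [loss1]. *)
Variables (q : R -> R) (c k : R).
Hypotheses (mq : mfun setT q) (c0 : 0 <= c) (k0 : 0 <= k)
  (q0 : forall a, 0 <= q a) (qc : forall a, q a <= c * a ^+ 2)
  (qT : forall a, q a != 0 -> a < 0 /\ 2 + T * a <= 0)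
  (qlip : forall a b, `|q a - q b| <= c * ((`|a| + `|b|) * `|a - b|))
  (qk : forall a, a < 0 -> expR (lam * (- 2 / a)) * q a <= k * a ^+ 2).

Let Lq x := L x * q (v x).
Let Lhq x := Lh x * q (w x).

Let mLq : mfun setT Lq.
Proof. by apply: measurable_funM => //; exact: measurableT_comp mq (hs_mv hd). Qed.
Let mLhq : mfun setT Lhq.
Proof. by apply: measurable_funM => //; exact: measurableT_comp mq (hs_mv hdh). Qed.
Let Lqc x : 0 <= Lq x <= c * v x ^+ 2.
Proof.
have /andP[l0 l1] := L01 x; rewrite /Lq mulr_ge0//= (le_trans _ (qc (v x)))//.
by rewrite -[leRHS]mul1r ler_wpM2r.
Qed.
Let Lhqc x : 0 <= Lhq x <= c * w x ^+ 2.
Proof.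
have /andP[l0 l1] := Lh01 x; rewrite /Lhq mulr_ge0//= (le_trans _ (qc (w x)))//.
by rewrite -[leRHS]mul1r ler_wpM2r.
Qed.

Lemma loss_integral_diff (S : set R) : mset S ->
  `|\int[leb]_(x in S) Lq x - \int[leb]_(x in S) Lhq x| <= A * K * k * G0 + 2 * c * (CF + 1) * d.
Proof.
move=> mS.
have [i1 _] := dominated_energy hd mLq c0 Lqc.
have [i2 _] := dominated_energy hdh mLhq c0 Lhqc.
have [Q [hQ Q0 QG]] := hs_energy hd.
have [i4 [hi4 id4]] := h4; have [i5 [hi5 id5]] := h5.
have [a1 a1P] := has_integralS measurableT mS (@subsetT _ _) i1.
have [a2 a2P] := has_integralS measurableT mS (@subsetT _ _) i2.
have a12 := has_integralB mS a1P a2P.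
have hg := has_integralD measurableT (has_integralZ (A * K * k) measurableT hQ)
  (has_integralZ (c * (CF + 1)) measurableT (has_integralD measurableT hi4 hi5)).
have g0 x : setT x -> 0 <= A * K * k * v x ^+ 2 + c * (CF + 1) *
   (`|F x - Fh x| * v x ^+ 2 + (`|v x| + `|w x|) * `|v x - w x|).
  move=> _; apply: addr_ge0.
    by apply: mulr_ge0; [exact: mulr_ge0 (mulr_ge0 A0 K0) k0|exact: sqr_ge0].
  apply: mulr_ge0; first exact: mulr_ge0.
  apply: addr_ge0; apply: mulr_ge0 => //; exact: sqr_ge0.
have [w1 [hw1 w10 w1le]] := has_integralS_ge0 measurableT mS (@subsetT _ _) g0 hg.
have pw : {ae (@lebesgue_measure R), forall x, S x -> `|Lq x - Lhq x| <= A * K * k * v x ^+ 2 + c * (CF + 1) *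
   (`|F x - Fh x| * v x ^+ 2 + (`|v x| + `|w x|) * `|v x - w x|)}.
  apply: aeS loss_diff_pointwise => x hx _.
  have := hx (q (v x)) c c0 (q0 _) (qc _) (qT (a := _)) => hx1.
  (* The losses are compared at the slope v, where breaking by time T is known; the change of slope
     is left to [qlip]. *)
  have -> : Lq x - Lhq x = (L x - Lh x) * q (v x) + Lh x * (q (v x) - q (w x)).
    by rewrite /Lq /Lhq; ring.
  rewrite (le_trans (ler_normD _ _))// !normrM (ger0_norm (q0 _)).
  have /andP[l0 l1] := Lh01 x; rewrite (ger0_norm l0).
  have b1 : Lh x * `|q (v x) - q (w x)| <= c * ((`|v x| + `|w x|) * `|v x - w x|).
    by rewrite (le_trans _ (qlip _ _))// -[leRHS]mul1r ler_wpM2r.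
  have b2 : A * K * (expR (lam * (- 2 / v x)) * q (v x)) <= A * K * k * v x ^+ 2.
    have [z|/qT[v0 _]] := eqVneq (q (v x)) 0.
      by rewrite z !mulr0; exact: mulr_ge0 (mulr_ge0 (mulr_ge0 A0 K0) k0) (sqr_ge0 _).
    by rewrite -[leRHS]mulrA ler_wpM2l ?mulr_ge0// qk.
  have b3 : 0 <= c * CF * (`|w x| * `|v x - w x|) by rewrite !mulr_ge0.
  have b4 : 0 <= c * (`|F x - Fh x| * v x ^+ 2).
    by apply: mulr_ge0 => //; apply: mulr_ge0 => //; exact: sqr_ge0.
  move: hx1 b1 b2 b3 b4; move: CF CF0 => C C0.
  move: (`|L x - Lh x| * _) (Lh x * _) (A * K * (_ * _)) (A * K * k * _) => X1 X2 X3 X4.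
  move: (`|F x - Fh x| * _) (`|v x|) (`|w x|) (`|v x - w x|) => f a b e.
  lra.
rewrite a1P.2 a2P.2 in a12.
have hle1 := has_integral_le mS a12 hw1; have hle2 := has_integral_le mS (has_integralZ (-1) mS a12) hw1.
have e1 := hle1 (aeS (fun x h Sx => le_trans (ler_norm _) (h Sx)) pw).
have e2 : -1 * (\int[leb]_(x in S) Lq x - \int[leb]_(x in S) Lhq x) <= w1.
  apply: hle2; apply: aeS pw => x h Sx; apply: le_trans (h Sx).
  by rewrite mulN1r -normrN ler_norm.
have w1G : w1 <= A * K * k * G0 + 2 * c * (CF + 1) * d.
  rewrite (le_trans w1le)//; apply: lerD.
    by apply: ler_wpM2l => //; exact: mulr_ge0 (mulr_ge0 A0 K0) k0.
  rewrite (_ : 2 * c * (CF + 1) * d = c * (CF + 1) * (d + d)); last by ring.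
  by apply: ler_wpM2l; [exact: mulr_ge0|exact: lerD].
by rewrite ler_norml; lra.
Qed.

(** Besides the integrands, the limits [yb xi] and [yh xi] differ; this costs the energy in between,
    bounded by [h3]. *)
Lemma loss_cum_diff xi :
  `|cum Lq (yb xi) - cum Lhq (yh xi)| <= A * K * k * G0 + 2 * c * (CF + 1) * d + c * d.
Proof.
have := loss_integral_diff (mset_itvNyo (yh xi)); rewrite -/(cum Lq _) -/(cum Lhq _) => e1.
have [i1 _] := dominated_energy hd mLq c0 Lqc.
have shift a b : a <= b -> `|b - a| = `|yb xi - yh xi| -> 0 <= cum Lq b - cum Lq a <= c * d.
  move=> ab abE; have hs := has_integral_sub i1 ab.
  have [i [hi _ _]] := hs_energy_itv hd a b.
  rewrite (has_integral_ge0 hs) => [|x _]; last by have /andP[] := Lqc x.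
  rewrite (le_trans _ (ler_wpM2l c0 (h3 ab abE hi)))//.
  apply: (has_integral_leT _ hs (has_integralZ c _ hi)) => // x _.
  by have /andP[] := Lqc x.
have cd : 0 <= c * d by exact: mulr_ge0.
have e2 : `|cum Lq (yb xi) - cum Lq (yh xi)| <= c * d.
  have [h|h] := leP (yb xi) (yh xi).
    by have /andP[q1 q2] := shift _ _ h (distrC _ _); rewrite distrC ger0_norm.
  by have /andP[q1 q2] := shift _ _ (ltW h) (erefl _); rewrite ger0_norm.
rewrite (le_trans (ler_distD (cum Lq (yh xi)) _ _))// addrC; exact: lerD.
Qed.

End Functional.
(** The contraction of the existence proof, with a source term coming from the different data. The
    fixed point of K -> CY d + K/2 is 2 CY d. *)
Lemma solY_step : bounded_by (CY * d + K / 2).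
Proof.
move=> t xi tT; have /andP[t0 tT'] := tT.
have lam0 : 0 < lam by exact: lt_le_trans lam1.
have tt : t ^+ 2 <= T ^+ 2 by rewrite lerXn2r// nnegrE ltW.
have mq : mfun setT (fun a => ppart t a ^+ 2 / 2).
  apply: measurable_funM => //; apply: measurable_funX; apply: measurable_maxr => //.
  apply: measurableT_comp => //; apply: measurable_funD => //; exact: measurable_funM.
have c0 : 0 <= T ^+ 2 / 2 by rewrite divr_ge0// sqr_ge0.
pose k := 2 / lam ^+ 2 * expR (lam * t).
have k0 : 0 <= k by rewrite mulr_ge0 ?expR_ge0// divr_ge0// sqr_ge0.
have q0 a : 0 <= ppart t a ^+ 2 / 2 by rewrite divr_ge0// sqr_ge0.
have qc a : ppart t a ^+ 2 / 2 <= T ^+ 2 / 2 * a ^+ 2.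
  have h := sqr_ppart_le a t0; have := ler_wpM2r (sqr_ge0 a) tt; lra.
have qT a : ppart t a ^+ 2 / 2 != 0 -> a < 0 /\ 2 + T * a <= 0.
  by move=> h; apply: (ppart_neq0 tT); apply: contraNneq h => ->; rewrite expr0n/= mul0r.
have qlip a b : `|ppart t a ^+ 2 / 2 - ppart t b ^+ 2 / 2| <= T ^+ 2 / 2 * ((`|a| + `|b|) * `|a - b|).
  apply: (le_trans (sqr_ppart_lip a b t0)); apply: ler_wpM2r; last by rewrite ler_wpM2r.
  by rewrite mulr_ge0// addr_ge0.
have qk a : a < 0 -> expR (lam * (- 2 / a)) * (ppart t a ^+ 2 / 2) <= k * a ^+ 2.
  by move=> a0; rewrite mulrC; exact: ppart_weight.
have D1 := loss_cum_diff mq c0 k0 q0 qc qT qlip qk xi.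
have D2 := loss_integral_diff mq c0 k0 q0 qc qT qlip qk measurableT.
rewrite -/(tot (loss2 v L t)) -/(tot (loss2 w Lh t)) in D2.
rewrite -/(loss2 v L t) -/(loss2 w Lh t) in D1.
have E1 : 1 <= expR (lam * t).
  by apply: le_trans (expR_ge1Dx _); rewrite lerDl mulr_ge0// ltW.
have Kk : 3 / 4 * (A * K * k * G0) <= K / 2 * expR (lam * t).
  have -> : 3 / 4 * (A * K * k * G0) = (3 * A * G0) * (K / 2 * expR (lam * t)) / lam ^+ 2.
    by rewrite /k; field; rewrite gt_eqF.
  rewrite ler_pdivrMr ?exprn_gt0// mulrC ler_wpM2l//; first by rewrite mulr_ge0 ?expR_ge0// divr_ge0.
  rewrite (@le_trans _ _ lam)//; first by rewrite lerDl.
  by rewrite expr2 ler_pMr.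
have H1 := h1 xi; have H2 := h2 xi.
have CYd : CY * d <= CY * d * expR (lam * t).
  by apply: ler_peMr => //; exact: mulr_ge0.
rewrite mulrDl (le_trans _ (lerD CYd Kk))//.
have M1 := ler_wpM2l t0 H2; have M2 := ler_wpM2r d0 tT'.
have M3 := ler_wpM2l (sqr_ge0 t) H1; have M4 := ler_wpM2r d0 tt.
rewrite -[t in t * `|_|]ger0_norm// -normrM in M1.
rewrite -{1}[t ^+ 2]ger0_norm ?sqr_ge0// -normrM in M3.
have -> : CY * d = d + T * d + T ^+ 2 * d + 3 / 2 * (T ^+ 2 * (CF + 1) * d).
  by rewrite /CY; ring.
have e2 : 2 * (T ^+ 2 / 2) * (CF + 1) * d = T ^+ 2 * (CF + 1) * d by field.
rewrite e2 in D1 D2.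
have P := mulr_ge0 (mulr_ge0 (sqr_ge0 T) CF10) d0.
move: D1 D2 H1 M1 M2 M3 M4 P; rewrite /solY !ler_norml.
move: (T ^+ 2 * (CF + 1) * d) (A * K * k * G0) => z1 z2.
move: (cum _ _) (cum _ _) (tot _) (tot _) => r1 r2 r3 r4.
move: (yb xi) (yh xi) (u _) (uh _) => y1 y2 u1 u2; lra.
Qed.

(** Velocities do not enter the iteration, so no gain in lam is needed: the weight is bounded by its
    value at T. *)
Lemma solU_step t xi : 0 <= t <= T -> `|U t xi - Uh t xi| <=
  d + T * d + 3 / 2 * T * (CF + 1) * d + 3 / 4 * (A * K * T * expR (lam * T) * G0).
Proof.
move=> tT; have /andP[t0 tT'] := tT.
have lam0 : 0 < lam by exact: lt_le_trans lam1.
have TT := ltW T0.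
have mq : mfun setT (fun a => - a * ppart t a).
  apply: measurable_funM; first by apply: continuous_measurable_fun; exact: opp_continuous.
  apply: measurable_maxr => //.
  apply: measurableT_comp => //; apply: measurable_funD => //; exact: measurable_funM.
pose k := T * expR (lam * T).
have k0 : 0 <= k by rewrite mulr_ge0 ?expR_ge0.
have q0 a : 0 <= - a * ppart t a by exact: cppart_ge0.
have qc a : - a * ppart t a <= T * a ^+ 2.
  by rewrite (le_trans (cppart_le a t0))// ler_wpM2r// sqr_ge0.
have qT a : - a * ppart t a != 0 -> a < 0 /\ 2 + T * a <= 0.
  by move=> h; apply: (ppart_neq0 tT); apply: contraNneq h => ->; rewrite mulr0.
have qlip a b : `|- a * ppart t a - - b * ppart t b| <= T * ((`|a| + `|b|) * `|a - b|).
  apply: (le_trans (cppart_lip a b t0)); apply: ler_wpM2r => //.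
have qk a : a < 0 -> expR (lam * (- 2 / a)) * (- a * ppart t a) <= k * a ^+ 2.
  move=> a0; have [z|/qT[_ aT]] := eqVneq (- a * ppart t a) 0.
    by rewrite z mulr0 mulr_ge0// sqr_ge0.
  rewrite /k (mulrC T) -mulrA; apply: ler_pM => //.
  by rewrite ler_expR ler_wpM2l ?(ltW lam0)// ler_ndivrMr//; lra.
have D1 := loss_cum_diff mq TT k0 q0 qc qT qlip qk xi.
have D2 := loss_integral_diff mq TT k0 q0 qc qT qlip qk measurableT.
rewrite -/(tot (loss1 v L t)) -/(tot (loss1 w Lh t)) in D2.
rewrite -/(loss1 v L t) -/(loss1 w Lh t) in D1.
have H1 := h1 xi; have H2 := h2 xi.
have M1 := ler_wpM2l t0 H1; have M2 := ler_wpM2r d0 tT'.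
rewrite -[t in t * `|_|]ger0_norm// -normrM in M1.
have -> : A * K * T * expR (lam * T) * G0 = A * K * k * G0 by rewrite /k; ring.
have -> : 3 / 2 * T * (CF + 1) * d = 3 / 4 * (2 * T * (CF + 1) * d) by field.
move: D1 D2 H2 M1 M2; rewrite /solU !ler_norml.
move: (2 * T * (CF + 1) * d) (A * K * k * G0) => z1 z2.
move: (cum _ _) (cum _ _) (tot _) (tot _) => r1 r2 r3 r4.
move: (yb xi) (yh xi) (u _) (uh _) => y1 y2 u1 u2; lra.
Qed.

End Step.

Lemma solY_stable t xi : 0 <= t <= T -> `|Y t xi - Yh t xi| <= 2 * CY * d * expR (lam * t).
Proof.
(* An a priori bound to start the iteration: both positions stay within half of [K0] from the
   label. *)
move=> tT; pose K0 := 2 * (G0 + T * U0 + T ^+ 2 * G0).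
have K00 : 0 <= K0.
  by rewrite mulr_ge0// !addr_ge0// mulr_ge0 ?sqr_ge0// ltW.
have CYd : 0 <= CY * d by exact: mulr_ge0.
have hn n : bounded_by (2 * (CY * d) + 2 ^- n * K0).
  elim: n => [|n IH].
    move=> s eta sT; have /andP[s0 sT'] := sT; rewrite expr0 invr1 mul1r.
    have s2 : s ^+ 2 <= T ^+ 2 by rewrite lerXn2r// nnegrE ltW.
    have D1 := solY_dist hd mL L01 eta hU s0; have D2 := solY_dist hdh mLh Lh01 eta hUh s0.
    have E1 : 1 <= expR (lam * s).
      by apply: le_trans (expR_ge1Dx _); rewrite lerDl mulr_ge0// (le_trans ler01 lam1).
    rewrite (@le_trans _ _ K0)//; last first.
      have : K0 <= 2 * (CY * d) + K0 by rewrite lerDr mulr_ge0.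
      by move=> /le_trans; apply; apply: ler_peMr => //; rewrite addr_ge0// mulr_ge0.
    have m1 := ler_wpM2r U00 sT'; have m2 := ler_wpM2r G00 s2.
    rewrite /K0; move: D1 D2; rewrite !ler_norml; move: (Y s eta) (Yh s eta) => y1 y2; lra.
  have p0 : 0 <= 2 * (CY * d) + 2 ^- n * K0.
    by apply: addr_ge0; [exact: mulr_ge0|apply: mulr_ge0 => //; rewrite invr_ge0 exprn_ge0].
  have := solY_step p0 IH; congr bounded_by; rewrite exprS invfM.
  by move: (2 ^- n) (CY * d) => a b; field.
have c : (fun n : nat => 2 * CY * d * expR (lam * t) + 2 ^- n * (K0 * expR (lam * t))) @ \oo -->
    2 * CY * d * expR (lam * t) + 0.
  by apply: cvgD; [exact: cvg_cst|exact: half_pow_cvg0].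
rewrite addr0 in c; apply: (cvgr_to_ge c); apply: nearW => n.
by rewrite (le_trans (hn n t xi tT))// mulrDl !mulrA.
Qed.

Lemma solution_stable t xi : 0 <= t <= T ->
  `|Y t xi - Yh t xi| <= stability_constant * d /\ `|U t xi - Uh t xi| <= stability_constant * d.
Proof.
move=> tT; have K0 : 0 <= 2 * CY * d by rewrite !mulr_ge0.
have hY := solY_stable xi tT.
have hUU := solU_step K0 (fun s eta => solY_stable eta) xi tT.
have e0 := expR_ge0 (lam * T).
have q1 : 0 <= 2 * CY * expR (lam * T) * d by rewrite !mulr_ge0.
have CU0 : 0 <= CU * d.
  have TT := ltW T0.
  apply: mulr_ge0 => //; rewrite /CU; apply: addr_ge0; first apply: addr_ge0.
  - by rewrite addr_ge0// mulr_ge0.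
  - by rewrite !mulr_ge0.
  - by rewrite !mulr_ge0.
have /andP[t0 tT'] := tT.
rewrite /stability_constant mulrDl; split.
  rewrite (le_trans hY)// -[leLHS]addr0 lerD// [leRHS]mulrAC; apply: ler_wpM2l => //.
  by rewrite ler_expR ler_wpM2l// (le_trans ler01 lam1).
rewrite (le_trans hUU)// -[leLHS]add0r lerD//.
have -> : CU * d = d + 2 * T * d + 3 / 2 * (A * CY * T * expR (lam * T) * G0) * d + 3 / 2 * T * (CF + 1) * d.
  by rewrite /CU; ring.
have -> : 3 / 4 * (A * (2 * CY * d) * T * expR (lam * T) * G0) = 3 / 2 * (A * CY * T * expR (lam * T) * G0) * d.
  by field.
have := mulr_ge0 (ltW T0) d0.
by move: (3 / 2 * T * (CF + 1) * d) (3 / 2 * _ * d) => a b; lra.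
Qed.

End Stability.

(** * Consequences of Besov regularity *)

Section Translation.
Variable R : realType.

Let mshift (k : R) : measurable_fun setT (fun x : measurableTypeR R => (x + k : measurableTypeR R)).
Proof. exact: measurable_funD. Qed.

Lemma lebesgue_measure_shift (k : R) (S : set R) : mset S ->
  leb ((fun x => x + k) @^-1` S) = leb S.
Proof.
pose py := measure_function_pushforward__canonical__measure_function_Measure
  (@lebesgue_measure R) (mshift k).
have co a b : a <= b -> leb ((fun x : R => x + k) @^-1` `[a, b[%classic) = (b - a)%:E.
  move=> ab; rewrite (_ : _ @^-1` _ = `[(a - k), (b - k)[%classic); last first.
    by apply/seteqP; split => x; rewrite /= !in_itv/= => /andP[h1 h2]; apply/andP; split; lra.
  rewrite lebesgue_measure_itv/= lte_fin; case: ltP => h.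
    by rewrite -EFinD; congr (_%:E); lra.
  by congr (_%:E); lra.
move=> mS; apply: (@measure_unique_co R py (@lebesgue_measure R)) => // a b.
  move=> ab; rewrite /py/= /pushforward co// lebesgue_measure_itv/= lte_fin.
  by case: ltrgtP ab => // ->; rewrite subrr.
rewrite /py/= /pushforward; have [ab|ba] := leP a b; first by rewrite co// ltry.
by rewrite set_itv_ge ?preimage_set0 ?measure0// -leNgt bnd_simp ltW.
Qed.

Lemma has_integral_shiftT (k : R) f a : mfun setT f -> (forall x, 0 <= f x) ->
  has_integral setT f a -> has_integral setT (fun x => f (x + k)) a.
Proof.
move=> mf f0 hf; have mfE : measurable_fun setT (fun x : measurableTypeR R => (f x)%:E).
  exact/measurable_EFinP.
apply: has_integral_ge0P => //; first exact: measurableT_comp mf (mshift k).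
rewrite -(has_integral_EFin measurableT hf).
have := @ge0_integral_pushforward _ _ _ _ _ _ (mshift k) (@lebesgue_measure R)
  setT (EFin \o f) measurableT mfE (fun x _ => f0 x).
rewrite preimage_setT => /= <-.
pose py := measure_function_pushforward__canonical__measure_function_Measure
  (@lebesgue_measure R) (mshift k).
apply: (@eq_measure_integral _ _ _ setT (@lebesgue_measure R) py) => S mS _.
exact: lebesgue_measure_shift.
Qed.

Lemma has_integral_shift (k : R) (D : set R) f a : mset D -> (forall x, 0 <= f x) ->
  mfun setT f ->
  has_integral D f a -> has_integral [set x | D (x + k)] (fun x => f (x + k)) a.
Proof.
move=> mD f0 mf /(has_integral_mkcond _ _ mD) h.
have mD' : mset [set x | D (x + k)].
  by rewrite -[X in measurable X]setTI; exact: (mshift k measurableT).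
apply/(has_integral_mkcond _ _ mD').
have := has_integral_shiftT k _ _ h; rewrite /=.
have -> : (fun x => f (x + k) * \1_D (x + k)) = (fun x => f (x + k) * \1_[set x | D (x + k)] x).
  by apply/funext => x; rewrite !indicE; congr (_ * (nat_of_bool _)%:R); apply/idP/idP => /set_mem h'; exact: mem_set.
apply.
- apply: measurable_funM => //; exact: measurable_indic.
- by move=> x; rewrite mulr_ge0.
Qed.

(** The inner integrals are not given as a function, only bounded; that they are measurable in y
    comes from Tonelli's theorem. *)
Lemma has_integral_tonelli_le (D E : set R) (f : R -> R -> R) (A : R -> R) b V :
  mset D -> mset E ->
  measurable_fun setT (fun p : measurableTypeR R * measurableTypeR R => f p.1 p.2) ->
  (forall x y, E x -> D y -> 0 <= f x y) ->
  (forall x, E x -> has_integral D (f x) (A x)) ->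
  (forall y, D y -> exists i, has_integral E (f ^~ y) i /\ i <= b) ->
  has_integral D (fun _ => b) V -> exists W, [/\ has_integral E A W, 0 <= W & W <= V].
Proof.
move=> mD mE mf f0 fA fB hV.
pose B y := \int[@lebesgue_measure R]_(x in E) f x y.
have hB y : D y -> has_integral E (f ^~ y) (B y) /\ 0 <= B y <= b.
  move=> Dy; have [i [hi ib]] := fB y Dy; rewrite /B -hi.2; split => //.
  by rewrite ib (has_integral_ge0 hi)// => x Ex; exact: f0.
have mB : mfun D B.
  pose g (p : measurableTypeR R * measurableTypeR R) : \bar R :=
    (f p.1 p.2 * (\1_E p.1 * \1_D p.2))%:E.
  have mg : measurable_fun setT g.
    apply/measurable_EFinP; apply: measurable_funM => //; apply: measurable_funM.
      have h : mfun setT (\1_E : R -> R) by exact: measurable_indic.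
      exact: (measurableT_comp h measurable_fst).
    have h : mfun setT (\1_D : R -> R) by exact: measurable_indic.
    exact: (measurableT_comp h measurable_snd).
  have g0 p : (0 <= g p)%E.
    rewrite lee_fin !indicE; case: (boolP (p.1 \in E)) => [/set_mem Ep|_]; last by rewrite mul0r mulr0.
    case: (boolP (p.2 \in D)) => [/set_mem Dp|_]; last by rewrite !mulr0.
    by rewrite !mulr1; exact: f0.
  have mG := @measurable_fun_fubini_tonelli_G _ _ _ _ _ (@lebesgue_measure R) g mg g0.
  have : mfun D (fine \o fubini_G (@lebesgue_measure R) g).
    by apply: (mfunS measurableT) => //; apply: measurableT_comp mG; exact: fine_measurable.
  apply: eq_measurable_fun => y /set_mem Dy; rewrite /= /fubini_G /B /Rintegral; congr fine.
  rewrite [RHS]integral_mkcond; apply: eq_integral => x _.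
  rewrite /g/= patchE !indicE (mem_set Dy) mulr1.
  by case: ifP => _; rewrite ?mulr1 ?mulr0.
have [V' [hV' V'V]] : exists V', has_integral D B V' /\ `|V'| <= V.
  by apply: (has_integral_dom mD mB hV) => y Dy; have [_ /andP[B0 Bb]] := hB y Dy; rewrite ger0_norm.
exists V'; split.
- exact: (has_integral_tonelli mD mE mf f0 fA (fun y Dy => (hB y Dy).1) hV').
- by apply: has_integral_ge0 hV' _ => y Dy; have [_ /andP[]] := hB y Dy.
- exact: le_trans (ler_norm _) V'V.
Qed.

End Translation.

Section Besov.
Variable R : realType.
Variables (v : R -> R) (Q : R).
Hypotheses (mv : mfun setT v) (hQ : has_integral setT (fun x => v x ^+ 2) Q).
Variables (K b : R).
Hypothesis K0 : 0 < K.
Hypothesis hb : forall h, 0 < h <= K ->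
  exists i, has_integral setT (fun x => (v (x + h) - v x) ^+ 2) i /\ i <= b.

Let mv2 : mfun setT (fun x => v x ^+ 2). Proof. exact: measurable_funX. Qed.

Let Q0 : 0 <= Q. Proof. by apply: has_integral_ge0 hQ _ => x _; exact: sqr_ge0. Qed.

Let b0 : 0 <= b.
Proof.
have /hb[i [hi ib]] : 0 < K <= K by rewrite K0 lexx.
by rewrite (le_trans _ ib)// (has_integral_ge0 hi)// => x _; exact: sqr_ge0.
Qed.

Let mdiff k : mfun setT (fun x => (v (x + k) - v x) ^+ 2).
Proof.
apply: measurable_funX; apply: measurable_funB => //.
apply: measurableT_comp mv _; exact: measurable_funD.
Qed.

Lemma besov_diff_int k : -K <= k <= K ->
  exists i, has_integral setT (fun x => (v (x + k) - v x) ^+ 2) i /\ i <= b.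
Proof.
move=> /andP[k1 k2]; case: (ltrgtP k 0) => k0.
- have /hb[i [hi ib]] : 0 < - k <= K by lra.
  exists i; split => //.
  have := has_integral_shiftT k (mdiff (- k)) (fun x => sqr_ge0 _) hi.
  apply: has_integral_eq => // x _.
  by rewrite addrK -sqrrN opprB.
- by apply: hb; rewrite k0.
- exists 0; split => //.
  have /hb[i [hi _]] : 0 < K <= K by rewrite K0 lexx.
  have := has_integralZ 0 measurableT hi; rewrite mul0r.
  by apply: has_integral_eq => // x _; rewrite k0 addr0 subrr expr0n mul0r.
Qed.

Lemma itv_int a c : a <= c -> exists w1 w2,
  [/\ has_integral `[a, c[ v w1, has_integral `[a, c[ (fun x => v x ^+ 2) w2 & w2 <= Q].
Proof.
move=> ac; have [w2 [h2 _ w2Q]] := has_integralS_ge0 measurableT (mset_itvco a c) (@subsetT _ _)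
  (fun x _ => sqr_ge0 (v x)) hQ.
have h1 := has_integral_itvcc_co (has_integral_cst 1 ac).
have [w1 [hw1 _]] : exists w1, has_integral `[a, c[ v w1 /\ `|w1| <= 1 * (c - a) + w2.
  apply: (has_integral_dom _ _ (has_integralD _ h1 h2)) => //; first exact: mfunS mv.
  move=> x _; rewrite -[v x ^+ 2]real_normK ?num_real//.
  by have := sqr_ge0 (`|v x| - 1); have := sqr_ge0 `|v x|; rewrite sqrrB1; lra.
by exists w1, w2.
Qed.

Lemma itv_diff_int a c x : a <= c -> forall w1 w2, has_integral `[a, c[ v w1 ->
  has_integral `[a, c[ (fun x => v x ^+ 2) w2 ->
  has_integral `[a, c[ (fun z => (v z - v x) ^+ 2) (w2 - 2 * v x * w1 + v x ^+ 2 * (c - a)).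
Proof.
move=> ac w1 w2 h1 h2; have hI := mset_itvco a c.
have h0 := has_integral_itvcc_co (has_integral_cst (v x ^+ 2) ac).
have := has_integralD hI (has_integralB hI h2 (has_integralZ (2 * v x) hI h1)) h0.
by apply: has_integral_eq => // z _; ring.
Qed.

(** Turns bounds on translations into local oscillations: with z = x + k, Tonelli's theorem makes
    the integral of [g] an integral over shifts k in a range of length 2K, each contributing at most
    b. *)
Lemma besov_local : exists g i, [/\ forall x, 0 <= g x,
  (forall x, has_integral `[(x - K), (x + K)[ (fun z => (v z - v x) ^+ 2) (g x)),
  has_integral setT g i & i <= 2 * K * b].
Proof.
have KK : - K <= K by have := K0; lra.
have hg x : exists g, has_integral `[(x - K), (x + K)[ (fun z => (v z - v x) ^+ 2) g.
  have xK : x - K <= x + K by have := K0; lra.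
  have [w1 [w2 [h1 h2 _]]] := itv_int xK.
  by eexists; exact: itv_diff_int h1 h2.
have /choice[g {}hg] := hg.
have hk x : has_integral `[(- K), K[ (fun k => (v (x + k) - v x) ^+ 2) (g x).
  have mz : mfun setT (fun z => (v z - v x) ^+ 2) by apply: measurable_funX; exact: measurable_funB.
  have := has_integral_shift x (mset_itvco (x - K) (x + K)) (fun z => sqr_ge0 _) mz (hg x).
  have -> : [set y | `[(x - K), (x + K)[%classic (y + x)] = `[(- K), K[%classic.
    by apply/seteqP; split => y; rewrite /= !in_itv/= => /andP[? ?]; apply/andP; split; lra.
  by apply: has_integral_eq => // y _; rewrite (addrC y x).
have mf : measurable_fun setT (fun p : measurableTypeR R * measurableTypeR R =>
    (v (p.1 + p.2) - v p.1) ^+ 2).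
  apply: measurable_funX; apply: measurable_funB.
    apply: (measurableT_comp mv); apply: measurable_funD; [exact: measurable_fst|exact: measurable_snd].
  exact: (measurableT_comp mv measurable_fst).
have hcst := has_integral_itvcc_co (has_integral_cst b KK).
have [|i [hi i0 ib]] := @has_integral_tonelli_le _ `[(- K), K[%classic setT
  (fun x k => (v (x + k) - v x) ^+ 2) g b _ (mset_itvco _ _) measurableT mf
  (fun x k _ _ => sqr_ge0 _) (fun x _ => hk x) _ hcst.
  move=> k; rewrite /= in_itv/= => /andP[k1 k2]; apply: besov_diff_int; lra.
exists g, i; split => //; last by rewrite (le_trans ib)//; lra.
by move=> x; apply: has_integral_ge0 (hg x) _ => z _; exact: sqr_ge0.
Qed.

(** From v(x)^2 <= 2 (v(z) - v(x))^2 + 2 v(z)^2, averaged over the window of length 2K around x and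
    then integrated over x. Only the oscillation term survives when the interval is short compared
    with K. *)
Lemma besov_small_energy a c w : a <= c -> has_integral `[a, c[ (fun x => v x ^+ 2) w ->
  w <= 2 * b + (c - a) / K * Q.
Proof.
move=> ac hw; have [g [i [g0 hg hi ib]]] := besov_local.
have [j [hj j0 ji]] := has_integralS_ge0 measurableT (mset_itvco a c) (@subsetT _ _) (fun x _ => g0 x) hi.
have hI := mset_itvco a c.
have hQc := has_integral_itvcc_co (has_integral_cst (2 * Q) ac).
have := has_integral_leT hI (has_integralZ (2 * K) hI hw) (has_integralD hI (has_integralZ 2 hI hj) hQc).
have pw x : 2 * K * v x ^+ 2 <= 2 * g x + 2 * Q.
  have xK : x - K <= x + K by have := K0; lra.
  have [w1 [w2 [h1 h2 w2Q]]] := itv_int xK.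
  have hJ := mset_itvco (x - K) (x + K).
  have hc := has_integral_itvcc_co (has_integral_cst (v x ^+ 2) xK).
  have := has_integral_leT hJ hc (has_integralD hJ (has_integralZ 2 hJ (hg x)) (has_integralZ 2 hJ h2)).
  have -> : v x ^+ 2 * (x + K - (x - K)) = 2 * K * v x ^+ 2 by ring.
  move=> /(_ _)/le_trans; apply; last by lra.
  move=> z _; rewrite -subr_ge0.
  have -> : 2 * (v z - v x) ^+ 2 + 2 * v z ^+ 2 - v x ^+ 2 = (2 * v z - v x) ^+ 2 by ring.
  exact: sqr_ge0.
move=> /(_ (fun x _ => pw x)) h.
have : K * w <= K * (2 * b + (c - a) / K * Q).
  have -> : K * (2 * b + (c - a) / K * Q) = 2 * K * b + (c - a) * Q by field; rewrite gt_eqF.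
  by lra.
by rewrite ler_pM2l.
Qed.

(** [2 * K * w2 - 2 * w1 ^+ 2] is the double integral of (v(z) - v(x))^2 over the cell, and the
    window around any x of the cell contains the cell. On a cell of the projection it equals 2 K^2
    q^2. *)
Lemma besov_cell (g : R -> R) a c w1 w2 j : a <= c -> c - a = K ->
  (forall x, has_integral `[(x - K), (x + K)[ (fun z => (v z - v x) ^+ 2) (g x)) ->
  has_integral `[a, c[ v w1 -> has_integral `[a, c[ (fun x => v x ^+ 2) w2 ->
  has_integral `[a, c[ g j -> 2 * K * w2 - 2 * w1 ^+ 2 <= j.
Proof.
move=> ac cK hg h1 h2 hj; have hI := mset_itvco a c.
have hc := has_integral_itvcc_co (has_integral_cst w2 ac).
have hJ := has_integralD hI (has_integralB hI hc (has_integralZ (2 * w1) hI h1)) (has_integralZ K hI h2).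
have := has_integral_leT hI hJ hj.
have -> : w2 * (c - a) - 2 * w1 * w1 + K * w2 = 2 * K * w2 - 2 * w1 ^+ 2 by rewrite cK; ring.
apply=> x; rewrite /= in_itv/= => /andP[ax xc].
have hJx := itv_diff_int x ac h1 h2.
have sub : `[a, c[%classic `<=` (`[(x - K), (x + K)[%classic : set R).
  by move=> z; rewrite /= !in_itv/= => /andP[h3 h4]; apply/andP; split; lra.
have [w [hw _ wg]] := has_integralS_ge0 (mset_itvco _ _) hI sub (fun z _ => sqr_ge0 _) (hg x).
rewrite (le_trans _ wg)// -(has_integral_uniq hJx hw) cK; lra.
Qed.

End Besov.

(** * Projected data *)

Section FinitePushforward.
Variable R : realType.
Variable ms : {finite_measure set (measurableTypeR R) -> \bar R}.
Variable p : R -> R.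
Hypothesis mp : mfun setT p.

Definition push (A : set (measurableTypeR R)) : \bar R := ms (p @^-1` A).

Let mpre (A : set (measurableTypeR R)) : measurable A -> mset (p @^-1` A).
Proof. by move=> mA; rewrite -[X in measurable X]setTI; exact: mp. Qed.

Let push0 : push set0 = 0%E. Proof. by rewrite /push preimage_set0 measure0. Qed.

Let push_ge0 A : (0 <= push A)%E. Proof. exact: measure_ge0. Qed.

Let push_sigma_additive : semi_sigma_additive push.
Proof.
move=> E mE tE mUE; rewrite /push preimage_bigcup; apply: measure_semi_sigma_additive.
- by move=> n; exact: mpre.
- apply/trivIsetP => i j _ _ ij; rewrite -preimage_setI.
  by move/trivIsetP : tE => ->//; rewrite preimage_set0.
- by rewrite -preimage_bigcup; exact: mpre.
Qed.

HB.instance Definition _ := isMeasure.Build _ _ _ push push0 push_ge0 push_sigma_additive.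

Let push_finite : fin_num_fun push.
Proof. by move=> A mA; apply: fin_num_measure; exact: mpre. Qed.

HB.instance Definition _ := @Measure_isFinite.Build _ (measurableTypeR R) R push push_finite.

Lemma finite_pushforward : exists m : {finite_measure set (measurableTypeR R) -> \bar R},
  forall A, m A = ms (p @^-1` A).
Proof. by exists push. Qed.

End FinitePushforward.

Section Cells.
Variable R : realType.
Variable dx : R.
Hypothesis dx0 : 0 < dx.

Let K := 2 * dx.
Let K0 : 0 < K. Proof. by rewrite mulr_gt0. Qed.

Definition cmesh (j : int) : R := mesh dx (2 * j).

Lemma cmeshE j : cmesh j = j%:~R * K.
Proof. by rewrite /cmesh /mesh intrM mulrAC mulrC. Qed.

Lemma cmeshS j : mesh dx (2 * j + 2) = cmesh (j + 1).
Proof. by rewrite /cmesh mulrDr mulr1. Qed.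

Lemma cmesh_succ j : cmesh (j + 1) = cmesh j + K.
Proof. by rewrite !cmeshE intrD mulrDl mul1r. Qed.

Lemma mesh_mid j : mesh dx (2 * j + 1) = cmesh j + dx.
Proof. by rewrite /cmesh /mesh intrD mulrDl mul1r. Qed.

Lemma cell_spec x : cmesh (cell dx x) < x <= cmesh (cell dx x + 1).
Proof.
rewrite !cmeshE /cell subrK -ltr_pdivlMr// ceilB1_lt/= -ler_pdivrMr//.
by rewrite -ceil_le_int.
Qed.

Lemma cell_uniq j x : cmesh j < x <= cmesh (j + 1) -> cell dx x = j.
Proof.
rewrite !cmeshE -ltr_pdivlMr// -ler_pdivrMr// => /andP[h1 h2].
apply/eqP; rewrite /cell subr_eq eq_le ceil_le_int h2/=.
by rewrite -ltzD1 ltrD2r ltNge ceil_le_int -ltNge.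
Qed.

Lemma cmesh_le i j : (cmesh i <= cmesh j) = (i <= j)%R.
Proof. by rewrite !cmeshE ler_pM2r// ler_int. Qed.

Lemma cmesh_lt i j : (cmesh i < cmesh j) = (i < j)%R.
Proof. by rewrite !cmeshE ltr_pM2r// ltr_int. Qed.

Lemma cells_cover x : exists n : nat, cmesh (- n%:Z) <= x < cmesh n%:Z.
Proof.
exists (Num.bound `|x / K|); rewrite !cmeshE mulrNz mulNr.
have := archi_boundP (normr_ge0 (x / K)); rewrite ltr_norml => /andP[h1 h2].
rewrite -ltr_pdivrMr// h2 andbT -mulNr -ler_pdivlMr//.
exact: ltW.
Qed.

Lemma cells_chain (P : R -> R -> Prop) :
  (forall a b c, a <= b -> b <= c -> P a b -> P b c -> P a c) ->
  (forall j a b, cmesh j <= a -> a <= b -> b <= cmesh (j + 1) -> P a b) ->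
  forall a b, a <= b -> P a b.
Proof.
move=> tr cellP a b ab.
have main (n : nat) i : forall a b, cmesh i <= a -> a <= b -> b <= cmesh (i + n%:Z) -> P a b.
  elim: n => [|n IH] {ab} {}a {}b ia ab bn.
    by apply: (cellP i) => //; rewrite (le_trans bn)// cmesh_le addr0 lerDl.
  have e : i + n.+1%:Z = (i + n%:Z) + 1 by rewrite -addrA -addn1 PoszD.
  have [bm|mb] := leP b (cmesh (i + n%:Z)); first exact: IH.
  have [am|ma] := leP a (cmesh (i + n%:Z)).
    apply: (tr _ _ _ am (ltW mb)); first exact: IH.
    by apply: (cellP (i + n%:Z)) => //; [exact: ltW|rewrite -e].
  by apply: (cellP (i + n%:Z)) => //; [exact: ltW|rewrite -e].
have /andP[ca _] := cell_spec a; have /andP[_ cb] := cell_spec b.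
apply: (main (absz (cell dx b + 1 - cell dx a)%R) (cell dx a)) => //; first exact: ltW.
have ab0 : (cell dx a <= cell dx b + 1)%R.
  by rewrite -cmesh_le ltW// (lt_le_trans ca)// (le_trans ab).
have -> : cell dx a + (absz (cell dx b + 1 - cell dx a)%R)%:Z = cell dx b + 1.
  by rewrite gez0_abs ?subr_ge0// addrC subrK.
by [].
Qed.

(* Summation over the cells without series: the bound is telescoping. *)
Lemma cells_integral_le (f Psi : R -> R) M : mfun setT f -> (forall x, 0 <= f x) ->
  (forall x, 0 <= Psi x <= M) ->
  (forall j, exists i, has_integral `[cmesh j, cmesh (j + 1)[ f i /\
     i <= Psi (cmesh (j + 1)) - Psi (cmesh j)) ->
  exists i, [/\ has_integral setT f i, 0 <= i & i <= M].
Proof.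
move=> mf f0 PM hj.
have main (n : nat) j : exists i, has_integral `[cmesh j, cmesh (j + n%:Z)[ f i /\
    i <= Psi (cmesh (j + n%:Z)) - Psi (cmesh j).
  elim: n => [|n [i [hi iP]]].
    exists 0; rewrite addr0 subrr; split => //; rewrite set_itvco0.
    by apply: has_integral_null => //; exact: mfunS mf.
  have [k [hk kP]] := hj (j + n%:Z).
  have e : j + n.+1%:Z = (j + n%:Z) + 1 by rewrite -addrA -addn1 PoszD.
  exists (i + k); rewrite e; split; last by lra.
  by apply: has_integral_cat_co hi hk; rewrite cmesh_le lerDl.
apply: (@has_integral_bound _ (fun n => `[cmesh (- n%:Z), cmesh n%:Z[%classic)) => //.
- move=> n m nm; apply/subsetPset => x; rewrite /= !in_itv/= => /andP[h1 h2].
  by apply/andP; split; [apply: le_trans h1|apply: (lt_le_trans h2)]; rewrite cmesh_le ?lerN2 lez_nat.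
- apply/seteqP; split => // x _; have [n hn] := cells_cover x; exists n => //.
move=> n; have [i [hi iP]] := main (n + n)%N (- n%:Z).
have e : - n%:Z + (n + n)%:Z = n%:Z by rewrite PoszD addKr.
rewrite e in hi iP; exists i; split => //; rewrite (le_trans iP)//.
have /andP[_ h1] := PM (cmesh n%:Z); have /andP[h2 _] := PM (cmesh (- n%:Z)); lra.
Qed.

End Cells.

Section Projected.
Variable R : realType.
Variables (u v F Fac : R -> R) (G0 : R).
Variable ms : {finite_measure set (measurableTypeR R) -> \bar R}.
Variable N : set R.
Hypothesis hd : hs_data u v F G0 ms N.
Hypothesis hFac : forall a b, a <= b ->
  has_integral `[a, b[ (fun x => v x ^+ 2) (Fac b - Fac a).
Variables (dx : R) (s : int -> R).
Hypothesis dx0 : 0 < dx.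
Hypothesis s1 : forall j, s j = 1 \/ s j = -1.

Let K := 2 * dx.
Let K0 : 0 < K. Proof. by rewrite mulr_gt0. Qed.

Notation c := (cmesh dx).
Notation m j := (mesh dx (2 * j + 1)).
Notation uh := (proj_u dx s u Fac).
Notation Fach := (proj_Fac dx s u Fac).
Notation Fh := (proj_F dx s u F Fac).
Notation D j := (Dq dx u j).
Notation q j := (qd dx u Fac j).

Definition proj_v (x : R) : R :=
  let j := cell dx x in
  if x <= mesh dx (2 * j + 1) then D j - s j * q j else D j + s j * q j.

Let Ka j : c (j + 1) = c j + K. Proof. exact: cmesh_succ. Qed.
Let cS j : c j <= c (j + 1). Proof. by rewrite Ka lerDl ltW. Qed.

Let DE j : D j * K = u (c (j + 1)) - u (c j).
Proof. by rewrite /Dq cmeshS mulfVK// gt_eqF. Qed.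

Let DFE j : Dq dx Fac j * K = Fac (c (j + 1)) - Fac (c j).
Proof. by rewrite /Dq cmeshS mulfVK// gt_eqF. Qed.

(** The variance of the slope on a cell is nonnegative; thus the radicand in [qd] is nonnegative and
    the root is not cut off at 0. *)
Lemma proj_jensen j : (u (c (j + 1)) - u (c j)) ^+ 2 <= K * (Fac (c (j + 1)) - Fac (c j)).
Proof.
have h1 := has_integral_itvcc_co (hs_u hd (cS j)); have h2 := hFac (cS j).
have hI := mset_itvco (c j) (c (j + 1)).
move: (u _ - u _) (Fac _ - Fac _) h1 h2 => w1 w2 h1 h2.
have h3 := has_integral_itvcc_co (has_integral_cst ((w1 / K) ^+ 2) (cS j)).
have := has_integralD hI (has_integralB hI h2 (has_integralZ (2 * (w1 / K)) hI h1)) h3.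
move=> /has_integral_ge0; have -> : c (j + 1) - c j = K by rewrite Ka addrAC subrr add0r.
have -> : w2 - 2 * (w1 / K) * w1 + (w1 / K) ^+ 2 * K = (K * w2 - w1 ^+ 2) / K.
  by field; rewrite gt_eqF.
rewrite pmulr_lge0 ?invr_gt0// subr_ge0; apply=> x _.
rewrite (_ : _ - _ + _ = (v x - w1 / K) ^+ 2) ?sqr_ge0//; ring.
Qed.

Lemma qd_sqr j : q j ^+ 2 = Dq dx Fac j - D j ^+ 2.
Proof.
rewrite sqr_sqrtr// -(pmulr_lge0 _ K0) -(pmulr_lge0 _ K0).
have := proj_jensen j; rewrite -DE -DFE; lra.
Qed.

Let s_sqr j : s j ^+ 2 = 1.
Proof. by case: (s1 j) => ->; rewrite ?sqrrN expr1n. Qed.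

Let mE j : m j = c j + dx. Proof. exact: mesh_mid. Qed.

Lemma proj_left j x : c j < x <= m j ->
  [/\ proj_v x = D j - s j * q j, uh x = u (c j) + (D j - s j * q j) * (x - c j) &
      Fach x = Fac (c j) + (D j - s j * q j) ^+ 2 * (x - c j)].
Proof.
move=> /andP[h1 h2]; have cj : cell dx x = j.
  by apply: cell_uniq => //; rewrite h1 (le_trans h2)// mE Ka /K; have := dx0; lra.
by rewrite /proj_v /proj_u /proj_Fac cj h2.
Qed.

(** The right half, too, is expressed from the left end of the cell, which exhibits continuity at
    the midpoint. The agreement with the definition uses s^2 = 1 and q^2 + D^2 = [Dq dx Fac j]: the
    energies of the two halves add up to the increment of [Fac]. *)
Lemma proj_right j x : m j < x <= c (j + 1) ->
  [/\ proj_v x = D j + s j * q j,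
      uh x = u (c j) + (D j - s j * q j) * dx + (D j + s j * q j) * (x - m j) &
      Fach x = Fac (c j) + (D j - s j * q j) ^+ 2 * dx + (D j + s j * q j) ^+ 2 * (x - m j)].
Proof.
move=> /andP[h1 h2]; have cj : cell dx x = j.
  by apply: cell_uniq => //; rewrite h2 andbT (lt_trans _ h1)// mE; have := dx0; lra.
have nh : (x <= m j) = false by rewrite leNgt h1.
rewrite /proj_v /proj_u /proj_Fac cj nh cmeshS; split => //.
  have := DE j; rewrite Ka mE /K => e; apply/eqP; rewrite -subr_eq0; apply/eqP.
  by move: e; move: (u (c j + _)) => u1; lra.
have := DFE j; have := qd_sqr j; have := s_sqr j; rewrite Ka -/(cmesh dx j) /K.
move: (Fac (c j + _)) (Fac (c j)) (Dq dx Fac j) (D j) (s j) (q j) (x - m j) => f1 f0 df d sj qj z e1 e2 e3.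
have -> : (d - sj * qj) ^+ 2 = d ^+ 2 - 2 * sj * d * qj + sj ^+ 2 * qj ^+ 2 by ring.
rewrite e1 e2; lra.
Qed.

Lemma proj_mesh j : uh (c j) = u (c j) /\ Fach (c j) = Fac (c j).
Proof.
(* Cells are open on the left, so that [c j] belongs to the cell of index j - 1. *)
have cj : c j = c (j - 1 + 1) by rewrite subrK.
have h : m (j - 1) < c (j - 1 + 1) <= c (j - 1 + 1).
  by rewrite lexx andbT mE Ka /K; have := dx0; lra.
rewrite cj; have [_ -> ->] := proj_right h.
rewrite mE Ka; have := DE (j - 1); have := DFE (j - 1); have := qd_sqr (j - 1); have := s_sqr (j - 1).
rewrite Ka /K.
move: (u (c _ + _)) (u (c _)) (Fac (c _ + _)) (Fac (c _)) (Dq dx Fac _) (D _) (s _) (q _)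
   => u1 u0 f1 f0 df d sj qj e1 e2 e3 e4; split; first by lra.
have -> : (d - sj * qj) ^+ 2 = d ^+ 2 - 2 * sj * d * qj + sj ^+ 2 * qj ^+ 2 by ring.
have -> : (d + sj * qj) ^+ 2 = d ^+ 2 + 2 * sj * d * qj + sj ^+ 2 * qj ^+ 2 by ring.
rewrite e1 e2; lra.
Qed.

Lemma measurable_proj_v : mfun setT proj_v.
Proof.
have main (n : nat) j : mfun `]c j, c (j + n%:Z)] proj_v.
  elim: n => [|n IH].
    by rewrite addr0 set_itvoc0; exact: measurable_fun_set0.
  have e : j + n.+1%:Z = (j + n%:Z) + 1 by rewrite -addrA -addn1 PoszD.
  set k := j + n%:Z in e IH; have ck : c k <= m k by rewrite mE lerDl ltW.
  have mk : m k <= c (k + 1) by rewrite mE Ka /K; have := dx0; lra.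
  have jk : c j <= c k by rewrite cmesh_le// lerDl.
  rewrite e (_ : `]c j, c (k + 1)]%classic = (`]c j, c k] `|` `]c k, m k]) `|` `]m k, c (k + 1)]); last first.
    apply/seteqP; split => x /=; rewrite !in_itv/=.
      move=> /andP[h1 h2]; case: (leP x (m k)) => h3; last by right.
      by left; case: (leP x (c k)) => h4; [left; rewrite h1|right].
    by move=> [[]|] /andP[h1 h2]; apply/andP; split; lra.
  apply/measurable_funU => //; first by apply: measurableU; exact: measurable_itv.
  split; first (apply/measurable_funU => //; split=> //).
    apply: (@eq_measurable_fun _ _ _ _ _ (cst (D k - s k * q k))); last exact: measurable_cst.
    by move=> x /set_mem /=; rewrite in_itv/= => /proj_left[].
  apply: (@eq_measurable_fun _ _ _ _ _ (cst (D k + s k * q k))); last exact: measurable_cst.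
  by move=> x /set_mem /=; rewrite in_itv/= => /proj_right[].
rewrite (_ : setT = \bigcup_n `]c (- n%:Z), c n%:Z]%classic).
  apply/measurable_fun_bigcup => [n|n]; first exact: measurable_itv.
  by have := main (n + n)%N (- n%:Z); rewrite PoszD addKr.
apply/seteqP; split => // x _; have [n /andP[h1 h2]] := cells_cover dx0 x.
exists n.+1 => //; rewrite /= in_itv/=; apply/andP; split.
  by rewrite (lt_le_trans _ h1)// cmesh_lt// ltrN2 ltz_nat.
by rewrite (le_trans (ltW h2))// cmesh_le// lez_nat.
Qed.

Let cm j : c j <= m j. Proof. by rewrite mE lerDl ltW. Qed.
Let mc j : m j <= c (j + 1). Proof. by rewrite mE Ka /K; have := dx0; lra. Qed.

Lemma proj_left_closed j x : c j <= x <= m j ->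
  uh x = u (c j) + (D j - s j * q j) * (x - c j) /\
  Fach x = Fac (c j) + (D j - s j * q j) ^+ 2 * (x - c j).
Proof.
rewrite le_eqVlt => /andP[/orP[/eqP <- _|h1 h2]].
  by rewrite subrr !mulr0 !addr0; exact: proj_mesh.
have /proj_left[_ -> ->] : c j < x <= m j by rewrite h1.
by [].
Qed.

Lemma proj_right_closed j x : m j <= x <= c (j + 1) ->
  uh x = u (c j) + (D j - s j * q j) * dx + (D j + s j * q j) * (x - m j) /\
  Fach x = Fac (c j) + (D j - s j * q j) ^+ 2 * dx + (D j + s j * q j) ^+ 2 * (x - m j).
Proof.
rewrite le_eqVlt => /andP[/orP[/eqP <- _|h1 h2]].
  have /proj_left_closed[-> ->] : c j <= m j <= m j by rewrite cm lexx.
  by rewrite subrr !mulr0 !addr0 mE addrAC subrr add0r.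
have /proj_right[_ -> ->] : m j < x <= c (j + 1) by rewrite h1.
by [].
Qed.

Let half_const (f : R -> R) lo hi k a b : mfun setT f ->
  (forall x, lo < x <= hi -> f x = k) -> lo <= a -> a <= b -> b <= hi ->
  has_integral `[a, b[ f (k * (b - a)).
Proof.
move=> mf fk la ab bh; have := has_integral_itvcc_co (has_integral_cst k ab).
apply: has_integral_ae => //; first exact: mfunS mf.
apply: aeS (ae_neq lo) => x xl; rewrite /= in_itv/= => /andP[ax xb].
rewrite fk// (le_trans (ltW xb) bh) andbT lt_neqAle (le_trans la ax) andbT.
by rewrite eq_sym; exact/eqP.
Qed.

Let cell_primitive (f P : R -> R) (kl kr : int -> R) : mfun setT f ->
  (forall j x, c j < x <= m j -> f x = kl j) ->
  (forall j x, m j < x <= c (j + 1) -> f x = kr j) ->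
  (forall j x, c j <= x <= m j -> P x = P (c j) + kl j * (x - c j)) ->
  (forall j x, m j <= x <= c (j + 1) -> P x = P (c j) + kl j * dx + kr j * (x - m j)) ->
  forall a b, a <= b -> has_integral `[a, b[ f (P b - P a).
Proof.
move=> mf fl fr Pl Pr; apply: (cells_chain dx0) => //.
  move=> a b e ab be h1 h2; have := has_integral_cat_co ab be h1 h2.
  by rewrite addrC addrA subrK.
move=> j a b ja ab bj.
have left a' b' : c j <= a' -> a' <= b' -> b' <= m j -> has_integral `[a', b'[ f (P b' - P a').
  move=> h1 h2 h3; have := half_const mf (fl j) h1 h2 h3.
  rewrite (Pl j b') ?(Pl j a') ?h1 ?(le_trans h2 h3) ?(le_trans h1 h2)//.
  by rewrite [X in _ -> has_integral _ _ X](_ : _ = kl j * (b' - a')); last by ring.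
have right a' b' : m j <= a' -> a' <= b' -> b' <= c (j + 1) -> has_integral `[a', b'[ f (P b' - P a').
  move=> h1 h2 h3; have := half_const mf (fr j) h1 h2 h3.
  rewrite (Pr j b') ?(Pr j a') ?h1 ?(le_trans h2 h3) ?(le_trans h1 h2)//.
  by rewrite [X in _ -> has_integral _ _ X](_ : _ = kr j * (b' - a')); last by ring.
have [bm|mb] := leP b (m j); first exact: left.
have [am|ma] := leP a (m j); last by apply: right => //; exact: ltW.
have := has_integral_cat_co am (ltW mb) (left _ _ ja am (lexx _)) (right _ _ (lexx _) (ltW mb) bj).
by rewrite addrC addrA subrK.
Qed.

Lemma proj_u_primitive a b : a <= b -> has_integral `[a, b] proj_v (uh b - uh a).
Proof.
move=> ab; apply: has_integral_itvco_cc; first exact: measurable_proj_v.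
apply: (cell_primitive (kl := fun j => D j - s j * q j) (kr := fun j => D j + s j * q j)) => //.
- exact: measurable_proj_v.
- by move=> j x /proj_left[].
- by move=> j x /proj_right[].
- by move=> j x h; have [-> _] := proj_mesh j; have [] := proj_left_closed h.
- by move=> j x h; have [-> _] := proj_mesh j; have [] := proj_right_closed h.
Qed.

Lemma proj_Fac_primitive a b : a <= b ->
  has_integral `[a, b[ (fun x => proj_v x ^+ 2) (Fach b - Fach a).
Proof.
apply: (cell_primitive (kl := fun j => (D j - s j * q j) ^+ 2) (kr := fun j => (D j + s j * q j) ^+ 2)) => //.
- by apply: measurable_funX; exact: measurable_proj_v.
- by move=> j x /proj_left[->].
- by move=> j x /proj_right[->].
- by move=> j x h; have [_ ->] := proj_mesh j; have [] := proj_left_closed h.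
- by move=> j x h; have [_ ->] := proj_mesh j; have [] := proj_right_closed h.
Qed.

Lemma proj_F_mesh j : Fh (c j) = F (c j).
Proof.
have cj : cell dx (c j) = j - 1.
  by apply: cell_uniq => //; rewrite subrK lexx andbT cmesh_lt// gtrBl.
rewrite /proj_F /proj_Fsing cj cmeshS subrK; have [_ ->] := proj_mesh j.
by rewrite addrC subrK.
Qed.

Let Fs x := F x - Fac x.

Let ms_co a b : a <= b -> ms `[a, b[ = (Fs b - Fs a)%:E.
Proof.
move=> ab; have := hs_F hd ab.
rewrite (has_integral_EFin (mset_itvco a b) (hFac ab)) /Fs.
have := fin_num_measure ms _ (mset_itvco a b); case: (ms _) => // r _ [] h.
by congr (_%:E); lra.
Qed.

(** The projection gathers the singular mass of [[c j, c (j + 1)[] in an atom at [c j]; the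
    projected singular measure is the image of [ms] under this map. *)
Let p x : R := c (Num.floor (x / K)).

Let mp : mfun setT p.
Proof.
apply: nondecreasing_measurable => // x y xy; rewrite /p cmesh_le//; apply: le_floor.
by rewrite ler_pM2r ?invr_gt0.
Qed.

Let p_co a b : p @^-1` `[a, b[%classic = `[c (cell dx a + 1), c (cell dx b + 1)[%classic.
Proof.
have key a' x : (p x < a') = (x < c (cell dx a' + 1)).
  rewrite /p !cmeshE /cell subrK -[LHS]ltr_pdivlMr// -[RHS]ltr_pdivrMr// -floor_lt_int.
  by rewrite !ltNge -ceil_le_int.
by apply/seteqP; split => x; rewrite /= !in_itv/= !leNgt !key.
Qed.

Let Nh : set R := range c.

Let mNh : mset Nh /\ leb Nh = 0%E.
Proof.
have cN : countable Nh by apply: (sub_countable (card_image_le _ _)).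
split; last exact: countable_lebesgue_measure0.
exact: countable_measurable.
Qed.

Lemma proj_F_nd a b : a <= b -> 0 <= Fh b - Fh a.
Proof.
move=> ab; have h1 := has_integral_ge0 (proj_Fac_primitive ab) (fun x _ => sqr_ge0 _).
suff : 0 <= proj_Fsing dx F Fac b - proj_Fsing dx F Fac a by rewrite /proj_F; lra.
have h : c (cell dx a + 1) <= c (cell dx b + 1).
  by rewrite cmesh_le// lerD2r /cell lerD2r; apply: le_ceil; rewrite ler_pM2r ?invr_gt0.
rewrite /proj_Fsing !cmeshS -lee_fin -/(Fs _) -/(Fs _) -ms_co//.
Qed.

Lemma proj_hs_data : exists (mh : {finite_measure set (measurableTypeR R) -> \bar R}) (Nh : set R),
  hs_data uh proj_v Fh G0 mh Nh.
Proof.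
have [mh mhE] := finite_pushforward ms mp.
exists mh, Nh; split.
- exact: measurable_proj_v.
- exact: proj_u_primitive.
- move=> a b ab; rewrite (has_integral_EFin (mset_itvco a b) (proj_Fac_primitive ab)) mhE p_co.
  rewrite ms_co ?cmesh_le ?lerD2r//; last first.
    by apply: le_ceil; rewrite ler_pM2r ?invr_gt0.
  rewrite -EFinD; congr (_%:E); rewrite /proj_F /proj_Fsing !cmeshS /Fs; lra.
- move=> x; have /andP[h _] := cell_spec dx0 x.
  by have := proj_F_nd (ltW h); rewrite proj_F_mesh; have := hs_F_ge0 hd (c (cell dx x)); lra.
- move=> x; have /andP[_ h] := cell_spec dx0 x.
  by have := proj_F_nd h; rewrite proj_F_mesh; have := hs_F_le hd (c (cell dx x + 1)); lra.
- move=> e /(hs_Fy hd)[x hx]; exists (c (cell dx x + 1)); rewrite proj_F_mesh.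
  by apply: (lt_le_trans hx); apply: (hs_F_nd hd); have /andP[] := cell_spec dx0 x.
- move=> e /(hs_FNy hd)[x hx]; exists (c (cell dx x)); rewrite proj_F_mesh.
  by apply: le_lt_trans hx; apply: (hs_F_nd hd); have /andP[/ltW] := cell_spec dx0 x.
- by have [] := mNh.
- by have [] := mNh.
- rewrite mhE (_ : _ @^-1` _ = set0) ?measure0//.
  by apply/seteqP; split => // x /= []; exists (Num.floor (x / K)).
Qed.

End Projected.

(** * Distance between the data and their projection *)

Section Estimates.
Variable R : realType.
Variables (u v F Fac : R -> R) (G0 : R).
Variable ms : {finite_measure set (measurableTypeR R) -> \bar R}.
Variable N : set R.
Hypothesis hd : hs_data u v F G0 ms N.
Hypothesis hFac : forall a b, a <= b ->
  has_integral `[a, b[ (fun x => v x ^+ 2) (Fac b - Fac a).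
Variables (beta B : R).
Hypotheses (beta01 : 0 < beta <= 1) (B0 : 0 <= B).
Hypothesis hB : forall h, 0 < h <= 2 ->
  exists i, has_integral setT (fun x => (v (x + h) - v x) ^+ 2) i /\ i <= (B * h `^ beta) ^+ 2.
Variables (dx : R) (s : int -> R).
Hypothesis dx01 : 0 < dx <= 1.
Hypothesis s1 : forall j, s j = 1 \/ s j = -1.
Variables (mh : {finite_measure set (measurableTypeR R) -> \bar R}) (Nh : set R).
Hypothesis hdh : hs_data (proj_u dx s u Fac) (proj_v u Fac dx s) (proj_F dx s u F Fac) G0 mh Nh.

Let dx0 : 0 < dx. Proof. by have /andP[] := dx01. Qed.
Let K := 2 * dx.
Let K0 : 0 < K. Proof. by rewrite mulr_gt0. Qed.

Notation c := (cmesh dx).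
Notation uh := (proj_u dx s u Fac).
Notation w := (proj_v u Fac dx s).
Notation Fh := (proj_F dx s u F Fac).
Notation yb := (yinit F).
Notation yh := (yinit Fh).

Let G00 := hs_G0_ge0 hd.

Lemma cell_floor x : exists j, c j <= x < c (j + 1).
Proof.
exists (Num.floor (x / K)); rewrite !cmeshE -ler_pdivlMr// floor_le/= -ltr_pdivrMr//.
by rewrite -floor_lt_int ltzD1.
Qed.

(** The maps [x + F x] and [x + Fh x] agree at the mesh points [c j], so their inverses send a label
    into the same cell. *)
Lemma yinit_same_cell xi : exists j,
  [/\ c j <= yb xi, yb xi <= c (j + 1), c j <= yh xi & yh xi <= c (j + 1)].
Proof.
have FhE j : Fh (c j) = F (c j) by exact: (proj_F_mesh hd hFac dx0 s1).
have [j /andP[h1 h2]] := cell_floor (yb xi); exists j; split => //; first exact: ltW.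
  rewrite -[leLHS](yinitK hdh); apply: (yinit_nd hdh); rewrite FhE.
  by rewrite (le_trans (hs_e_nd hd h1))// (e_yinit_le hd).
by apply: (yinit_le hdh); rewrite FhE; exact: (yinit_lt_e hd).
Qed.

Let cS j : c (j + 1) - c j = K.
Proof. by rewrite cmesh_succ addrAC subrr add0r. Qed.

Lemma yinit_proj_dist xi : `|yb xi - yh xi| <= 2 * dx.
Proof.
have [j [h1 h2 h3 h4]] := yinit_same_cell xi; have := cS j.
by rewrite -/K ler_norml => e; lra.
Qed.

Let r := Num.sqrt dx.
Let r0 : 0 < r. Proof. by rewrite sqrtr_gt0. Qed.
Let rr : r ^+ 2 = dx. Proof. by rewrite sqr_sqrtr// ltW. Qed.
Let r1 : r <= 1.
Proof. by rewrite -sqrtr1 ler_wsqrtr//; have /andP[] := dx01. Qed.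

(** Both velocities are compared with their common value at the left end of the cell, by
    [hs_u_young] at e = r, the square root of dx: each difference is at most r + r G0 / 2. *)
Lemma uinit_proj_dist xi : `|u (yb xi) - uh (yh xi)| <= (2 + G0) * r.
Proof.
have [j [h1 h2 h3 h4]] := yinit_same_cell xi; have cj := cS j.
have [ue _] := proj_mesh hd hFac dx0 s1 j.
have H1 := hs_u_young hd (c j) (yb xi) r0; have H2 := hs_u_young hdh (c j) (yh xi) r0.
rewrite ue in H2.
have b y : c j <= y -> y <= c (j + 1) -> `|y - c j| / (2 * r) <= r.
  move=> y1 y2; rewrite ler_pdivrMr ?mulr_gt0// ger0_norm ?subr_ge0//.
  have -> : r * (2 * r) = K by rewrite /K -rr; ring.
  by lra.
have b1 := b _ h1 h2; have b2 := b _ h3 h4.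
have -> : u (yb xi) - uh (yh xi) = (u (yb xi) - u (c j)) - (uh (yh xi) - u (c j)) by ring.
rewrite (le_trans (ler_normB _ _))// (le_trans (lerD H1 H2))//.
by have := G00; move: b1 b2; move: (`|yb xi - c j| / _) (`|yh xi - c j| / _) => a1 a2; lra.
Qed.

(** The bound of [besov_small_energy] for an interval of length 2 dx and the window r: the
    oscillation (B r^beta)^2 is B^2 dx^beta, and the ratio 2 dx / r is 2 r. *)
Let sigma := 2 * B ^+ 2 * dx `^ beta + 2 * G0 * r.

Let b_r : (B * r `^ beta) ^+ 2 = B ^+ 2 * dx `^ beta.
Proof.
rewrite exprMn; congr (_ * _).
by rewrite -powR_mulrn ?powR_ge0// -powRrM mulrC powRrM powR_mulrn ?ltW// rr.
Qed.

Let powR_mono h k : 0 < h -> h <= k -> (B * h `^ beta) ^+ 2 <= (B * k `^ beta) ^+ 2.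
Proof.
move=> h0 hk; have /andP[be0 _] := beta01.
rewrite lerXn2r ?nnegrE ?mulr_ge0 ?powR_ge0// ler_wpM2l// ge0_ler_powR// ?nnegrE; [exact: ltW|lra..].
Qed.

Let hB' k : 0 < k -> k <= 2 -> forall h, 0 < h <= k ->
  exists i, has_integral setT (fun x => (v (x + h) - v x) ^+ 2) i /\ i <= (B * k `^ beta) ^+ 2.
Proof.
move=> k0 k2 h /andP[h0 hk]; have [|i [hi ih]] := hB (h := h); first by rewrite h0 (le_trans hk).
by exists i; split => //; rewrite (le_trans ih)// powR_mono.
Qed.

Lemma small_energy a b i : a <= b -> b - a <= K ->
  has_integral `[a, b[ (fun x => v x ^+ 2) i -> i <= sigma.
Proof.
move=> ab abK hi; have [Q [hQ Q0 QG]] := hs_energy hd.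
have r2 : r <= 2 by rewrite (le_trans r1)// ler1n.
have := besov_small_energy (hs_mv hd) hQ r0 (hB' r0 r2) ab hi.
move/le_trans; apply; rewrite b_r /sigma mulrA lerD2l.
apply: (@le_trans _ _ (2 * r * Q)).
  apply: ler_wpM2r => //; rewrite ler_pdivrMr//.
  by rewrite -mulrA -expr2 rr.
by rewrite [leRHS]mulrAC ler_wpM2l// mulr_ge0// ltW.
Qed.

Lemma small_energy_yinit xi a b : a <= b -> `|b - a| = `|yb xi - yh xi| ->
  forall i, has_integral `[a, b[ (fun x => v x ^+ 2) i -> i <= sigma.
Proof.
move=> ab abE i; apply: small_energy => //.
rewrite -[leLHS]ger0_norm ?subr_ge0// abE; exact: yinit_proj_dist.
Qed.

Let sigma0 : 0 <= sigma.
Proof. by rewrite /sigma addr_ge0// ?mulr_ge0 ?sqr_ge0 ?powR_ge0// ltW. Qed.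

Let mF : mfun setT F.
Proof. by apply: nondecreasing_measurable => // x y; exact: (hs_F_nd hd). Qed.
Let mFh : mfun setT Fh.
Proof. by apply: nondecreasing_measurable => // x y; exact: (hs_F_nd hdh). Qed.

(** On a cell |F - Fh| is at most the increment of [F], and the energy of v is at most [sigma]; the
    increments telescope to at most [G0]. *)
Lemma energy_weighted_diff : exists i,
  has_integral setT (fun x => `|F x - Fh x| * v x ^+ 2) i /\ i <= sigma * G0.
Proof.
have mf : mfun setT (fun x => `|F x - Fh x| * v x ^+ 2).
  apply: measurable_funM; last by apply: measurable_funX; exact: hs_mv hd.
  by apply: measurableT_comp => //; exact: measurable_funB.
have [x|x||i [hi _ iG]] := cells_integral_le dx0 (Psi := fun x => sigma * F x) (M := sigma * G0) mf.
- by rewrite mulr_ge0 ?sqr_ge0.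
- by rewrite mulr_ge0 ?(hs_F_ge0 hd)//= ler_wpM2l// (hs_F_le hd).
- move=> j; have cj := cS j; have cc : c j <= c (j + 1) by have := K0; lra.
  have hI := mset_itvco (c j) (c (j + 1)).
  have [e [he e0 _]] := hs_energy_itv hd (c j) (c (j + 1)).
  have es : e <= sigma by apply: small_energy he => //; rewrite cj.
  set k := F (c (j + 1)) - F (c j).
  have k0 : 0 <= k by rewrite subr_ge0 (hs_F_nd hd).
  have [i [hi iP]] : exists i, has_integral `[c j, c (j + 1)[ (fun x => `|F x - Fh x| * v x ^+ 2) i /\ `|i| <= k * e.
    apply: (has_integral_dom hI _ (has_integralZ k hI he)); first exact: mfunS mf.
    move=> x; rewrite /= in_itv/= => /andP[x1 x2].
    rewrite normrM normr_id [`|v x ^+ 2|]ger0_norm ?sqr_ge0// ler_wpM2r ?sqr_ge0//.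
    have FhE l : Fh (c l) = F (c l) by exact: (proj_F_mesh hd hFac dx0 s1).
    have := hs_F_nd hd x1; have := hs_F_nd hd (ltW x2).
    have := hs_F_nd hdh x1; have := hs_F_nd hdh (ltW x2).
    by rewrite !FhE /k ler_norml; move: (Fh x) => f; lra.
  exists i; split => //; rewrite -mulrBr -/k (le_trans (ler_norm _))// (le_trans iP)//.
  by rewrite mulrC ler_wpM2r.
by exists i.
Qed.

Let mvw : mfun setT (fun x => (v x - w x) ^+ 2).
Proof. by apply: measurable_funX; apply: measurable_funB; [exact: hs_mv hd|exact: hs_mv hdh]. Qed.

(** On a cell w is D + q or D - q, whence (v - w)^2 <= 2 (v - D)^2 + 2 q^2, with integral at most 4
    K q^2 because q^2 is the variance of v. Besov regularity bounds this variance, whatever the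
    signs [s j]. *)
Lemma slope_diff_sqr : exists i, has_integral setT (fun x => (v x - w x) ^+ 2) i /\
  0 <= i <= 4 * (B * K `^ beta) ^+ 2.
Proof.
have [Q [hQ Q0 QG]] := hs_energy hd; have [Qh [hQh Qh0 QhG]] := hs_energy hdh.
have K2 : K <= 2 by rewrite /K; have /andP[_ ] := dx01; lra.
have [g [i [g0 hg hi ib]]] := besov_local (hs_mv hd) hQ K0 (hB' K0 K2).
have [M [hM _]] : exists M, has_integral setT (fun x => (v x - w x) ^+ 2) M /\ `|M| <= 2 * Q + 2 * Qh.
  apply: (has_integral_dom measurableT mvw (has_integralD measurableT
    (has_integralZ 2 measurableT hQ) (has_integralZ 2 measurableT hQh))) => x _.
  rewrite ger0_norm ?sqr_ge0// -subr_ge0.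
  have -> : 2 * v x ^+ 2 + 2 * w x ^+ 2 - (v x - w x) ^+ 2 = (v x + w x) ^+ 2 by ring.
  exact: sqr_ge0.
have k0 : 0 <= 2 / K by rewrite divr_ge0// ltW.
have [x|x||l [hl l0 lG]] := cells_integral_le dx0 (Psi := fun x => 2 / K * cum g x) (M := 4 * (B * K `^ beta) ^+ 2) mvw.
- exact: sqr_ge0.
- rewrite mulr_ge0 ?(cum_ge0 g0 hi)//=.
  apply: (@le_trans _ _ (2 / K * (2 * K * (B * K `^ beta) ^+ 2))).
    by rewrite ler_wpM2l// (le_trans (cum_le g0 hi x)).
  by rewrite le_eqVlt; apply/orP; left; apply/eqP; field; rewrite gt_eqF.
- move=> j; have cj := cS j; have cc : c j <= c (j + 1) by have := K0; lra.
  have hI := mset_itvco (c j) (c (j + 1)).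
  have h1 := has_integral_itvcc_co (hs_u hd cc); have h2 := hFac cc.
  have [l hl] := has_integralS measurableT hI (@subsetT _ _) hM.
  exists l; split => //.
  have hgj := has_integral_sub hi cc.
  have bc := besov_cell cc cj hg h1 h2 hgj.
  set D := Dq dx u j; set q := qd dx u Fac j.
  have hc := has_integral_itvcc_co (has_integral_cst (2 * D ^+ 2 + 2 * q ^+ 2) cc).
  have hb := has_integralD hI (has_integralB hI (has_integralZ 2 hI h2) (has_integralZ (4 * D) hI h1)) hc.
  have := has_integral_le hI hl hb.
  have qE : q ^+ 2 = Dq dx Fac j - D ^+ 2 by exact: (qd_sqr hd hFac dx0).
  have DE : u (c (j + 1)) - u (c j) = D * K by rewrite /D /Dq cmeshS mulfVK// gt_eqF.
  have DFE : Fac (c (j + 1)) - Fac (c j) = Dq dx Fac j * K by rewrite /Dq cmeshS mulfVK// gt_eqF.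
  rewrite -mulrBr; move: bc; rewrite DE DFE cj qE; move: (cum g _ - cum g _) => gj bc.
  (* Both sides are 4 K q^2; the right one is in the form that [besov_cell] bounds. *)
  have e1 : 2 * (Dq dx Fac j * K) - 4 * D * (D * K) + (2 * D ^+ 2 + 2 * (Dq dx Fac j - D ^+ 2)) * K
    = 2 / K * (2 * K * (Dq dx Fac j * K) - 2 * (D * K) ^+ 2) by field; rewrite gt_eqF.
  rewrite e1 => /(_ _)/le_trans; apply; last by rewrite ler_wpM2l.
  apply: aeS (ae_neq (c j)) => x xc; rewrite /= in_itv/= => /andP[x1 x2].
  have x1' : c j < x by rewrite lt_neqAle x1 andbT eq_sym; exact/eqP.
  have ss : s j ^+ 2 = 1 by case: (s1 j) => ->; rewrite ?sqrrN expr1n.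
  have qs : q ^+ 2 = s j ^+ 2 * q ^+ 2 by rewrite ss mul1r.
  have [xm|mx] := leP x (mesh dx (2 * j + 1)).
    have /(proj_left u Fac s dx0)[-> _ _] : c j < x <= mesh dx (2 * j + 1) by rewrite x1'.
    rewrite -/D -/q -subr_ge0.
    have -> : 2 * v x ^+ 2 - 4 * D * v x + (2 * D ^+ 2 + 2 * (Dq dx Fac j - D ^+ 2)) - (v x - (D - s j * q)) ^+ 2
      = (v x - D - s j * q) ^+ 2 by rewrite -qE [q ^+ 2]qs; ring.
    exact: sqr_ge0.
  have /(proj_right hd hFac dx0 s1)[-> _ _] : mesh dx (2 * j + 1) < x <= c (j + 1) by rewrite mx ltW.
  rewrite -/D -/q -subr_ge0.
  have -> : 2 * v x ^+ 2 - 4 * D * v x + (2 * D ^+ 2 + 2 * (Dq dx Fac j - D ^+ 2)) - (v x - (D + s j * q)) ^+ 2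
    = (v x - D + s j * q) ^+ 2 by rewrite -qE [q ^+ 2]qs; ring.
  exact: sqr_ge0.
by exists l; rewrite l0.
Qed.

(** Young's inequality in place of Cauchy-Schwarz: since the squared norm of v - w is O(dx^(2
    beta)), the parameter rho = dx^beta balances the two terms. *)
Lemma slope_product_diff : exists i,
  has_integral setT (fun x => (`|v x| + `|w x|) * `|v x - w x|) i /\
  i <= (2 * G0 + 8 * B ^+ 2) * dx `^ beta.
Proof.
have [Q [hQ Q0 QG]] := hs_energy hd; have [Qh [hQh Qh0 QhG]] := hs_energy hdh.
have [e [he /andP[e0 eB]]] := slope_diff_sqr.
set rho := dx `^ beta; have rho0 : 0 < rho by exact: powR_gt0.
have hb := has_integralD measurableT (has_integralZ rho measurableT (has_integralD measurableT hQ hQh))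
  (has_integralZ ((2 * rho)^-1) measurableT he).
have mf : mfun setT (fun x => (`|v x| + `|w x|) * `|v x - w x|).
  have mv := hs_mv hd; have mw := hs_mv hdh.
  apply: measurable_funM; last by apply: measurableT_comp => //; exact: measurable_funB.
  by apply: measurable_funD; exact: measurableT_comp.
have pw x : setT x -> `| (`|v x| + `|w x|) * `|v x - w x| | <=
    rho * (v x ^+ 2 + w x ^+ 2) + (2 * rho)^-1 * (v x - w x) ^+ 2.
  move=> _; rewrite ger0_norm; last by rewrite mulr_ge0// addr_ge0.
  rewrite -[v x ^+ 2]real_normK ?num_real// -[w x ^+ 2]real_normK ?num_real//.
  rewrite -[(v x - w x) ^+ 2]real_normK ?num_real//.
  move: (`|v x|) (`|w x|) (`|v x - w x|) => a b d; rewrite -subr_ge0.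
  have -> : rho * (a ^+ 2 + b ^+ 2) + (2 * rho)^-1 * d ^+ 2 - (a + b) * d =
    (2 * rho)^-1 * (d - rho * (a + b)) ^+ 2 + rho / 2 * (a - b) ^+ 2.
    by field; rewrite gt_eqF.
  by rewrite addr_ge0// mulr_ge0 ?sqr_ge0 ?divr_ge0 ?invr_ge0 ?mulr_ge0// ltW.
have [i [hi ib]] := has_integral_dom measurableT mf hb pw.
exists i; split => //; rewrite (le_trans (ler_norm _))// (le_trans ib)//.
have KB : (B * K `^ beta) ^+ 2 <= 4 * B ^+ 2 * rho ^+ 2.
  have /andP[be0 be1] := beta01.
  rewrite /K powRM ?(ltW dx0)// mulrA exprMn mulrC mulrC ler_wpM2r ?sqr_ge0//.
  rewrite exprMn mulrC ler_wpM2r ?sqr_ge0//.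
  have -> : 4 = 2 ^+ 2 :> R by ring.
  rewrite lerXn2r ?nnegrE ?powR_ge0// -[leRHS]powRr1// ler_powR// ler1n//.
have : (2 * rho)^-1 * e <= 8 * B ^+ 2 * rho.
  rewrite mulrC ler_pdivrMr ?mulr_gt0// (le_trans eB)//.
  by have := KB; rewrite expr2; lra.
have : rho * (Q + Qh) <= rho * (2 * G0) by rewrite ler_wpM2l ?(ltW rho0)//; lra.
by move: (rho * _) (_ * e) => a b; lra.
Qed.

End Estimates.

(** * Continuity of numerical evolutions *)

Section Continuity.
Variable R : realType.

Lemma primitive_continuous (h H : R -> R) :
  (forall a b, a <= b -> has_integral `[a, b] h (H b - H a)) -> continuous H.
Proof.
move=> hH x.
have ab : x - 1 <= x + 1 by lra.
have [hi _] := hH _ _ ab.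
have := parameterized_integral_continuous ab hi.
pose I y := parameterized_integral (@lebesgue_measure R) (x - 1) y h.
rewrite -/I => cI.
have IE y : x - 1 <= y -> H y = H (x - 1) + I y.
  by move=> xy; have [_] := hH _ _ xy; rewrite /I /parameterized_integral => <-; rewrite addrC subrK.
have xin : x \in `]x - 1, x + 1[%R by rewrite in_itv/=; apply/andP; split; lra.
have cx : {for x, continuous I}.
  have ab' : x - 1 < x + 1 by lra.
  by have [/(_ _ xin)] := (continuous_within_itvP I ab').1 cI.
have IEx : H x = H (x - 1) + I x by apply: IE; lra.
rewrite /continuous_at IEx.
have : H (x - 1) + I y @[y --> x] --> H (x - 1) + I x by apply: cvgD; [exact: cvg_cst|exact: cx].
apply: cvg_trans; apply: near_eq_cvg; near=> y; apply/esym/IE.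
near: y; apply: (@cvgr_ge _ _ _ _ id x cvg_id); rewrite ltrBlDr ltrDl; exact: ltr01.
Unshelve. all: by end_near. Qed.

Lemma dominated_continuous (f g1 g2 g3 : R -> R) (c1 c2 c3 : R) :
  continuous g1 -> continuous g2 -> continuous g3 ->
  (forall x y, `|f x - f y| <= c1 * `|g1 x - g1 y| + c2 * `|g2 x - g2 y| + c3 * `|g3 x - g3 y|) ->
  continuous f.
Proof.
move=> h1 h2 h3 hf x.
have c g : continuous g -> (fun y => `|g x - g y|) @ x --> (0 : R).
  move=> hg; have : (fun y => `|g x - g y|) @ x --> `|g x - g x|.
    by apply: cvg_norm; apply: cvgB; [exact: cvg_cst|exact: hg].
  by rewrite subrr normr0.
have : (fun y => c1 * `|g1 x - g1 y| + c2 * `|g2 x - g2 y| + c3 * `|g3 x - g3 y|) @ x --> (c1 * 0 + c2 * 0 + c3 * 0 : R).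
  by apply: cvgD; [apply: cvgD|]; (apply: cvgM; [exact: cvg_cst|exact: c]).
rewrite !mulr0 !addr0 => hc; apply/cvgrPdist_le => e e0.
move/cvgrPdist_le : hc => /(_ _ e0); apply: filterS => y.
rewrite sub0r normrN => h; apply: le_trans (hf x y) _; apply: le_trans h; exact: ler_norm.
Qed.

Lemma ae_itv (P : R -> Prop) a b : a < b -> {ae (@lebesgue_measure R), forall x, P x} ->
  exists2 x, a < x < b & P x.
Proof.
move=> ab [Z [mZ Z0 PZ]]; apply: contrapT => nP.
have sub : `]a, b[%classic `<=` Z.
  move=> x /=; rewrite in_itv/= => xab; apply: PZ => /= Px; apply: nP; by exists x.
have : (leb `]a, b[%classic <= leb Z)%E by apply: le_measure => //; rewrite inE//; exact: measurable_itv.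
by rewrite Z0 lebesgue_measure_itv/= lte_fin ab -EFinD lee_fin subr_le0 leNgt ab.
Qed.

(** The norm of exponent [+oo] is the essential supremum under the condition that the whole space
    has positive measure. *)
Lemma lebT_gt0 : (0 < @lebesgue_measure R setT)%E.
Proof.
apply: (@lt_le_trans _ _ (leb `[(0 : R), 1]%classic)); first by rewrite lebesgue_measure_itv/= lte_fin ltr01 oppr0 adde0 lte_fin ltr01.
by apply: le_measure => //; rewrite inE//; exact: measurable_itv.
Qed.

Lemma Lpnorm_oo_ae (f : R -> R) (C : R) :
  (Lpnorm +oo%E f <= C%:E)%E <-> {ae (@lebesgue_measure R), forall x, `|f x| <= C}.
Proof.
rewrite /Lpnorm unlock lebT_gt0; split => [/ess_supP|h].
  by apply: aeS => x; rewrite /= lee_fin.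
by apply/ess_supP; apply: aeS h => x; rewrite /= lee_fin.
Qed.

Lemma Lpnorm_oo_continuous (f : R -> R) (C : R) : continuous f ->
  (Lpnorm +oo%E f <= C%:E)%E -> forall x, `|f x| <= C.
Proof.
move=> cf /Lpnorm_oo_ae h x; rewrite leNgt; apply/negP => hx.
have : \forall y \near x, C < `|f y|.
  have cn : `|f y| @[y --> x] --> `|f x| by apply: cvg_norm; exact: cf.
  exact: (cvgr_gt _ cn).
move=> /nbhs_ballP[e /= e0 he].
have xe : x - e < x + e by lra.
have [y /andP[y1 y2] hy] := ae_itv xe h.
have : C < `|f y| by apply: he; rewrite -ball_normE /= ltr_norml; apply/andP; split; lra.
by rewrite ltNge hy.
Qed.

Lemma has_integral_norm (D : set R) (f : R -> R) a : has_integral D f a ->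
  exists b, has_integral D (fun x => `|f x|) b.
Proof.
move=> [h _]; exists (\int[@lebesgue_measure R]_(x in D) `|f x|); split => //.
exact: (integrable_norm h).
Qed.

End Continuity.

Section NumericalContinuity.
Variable R : realType.
Variables (Xbar : lagr R) (a b : R).
Hypothesis ab : a <= b.

(** During one time step all V(t, .) share a modulus of continuity, that of the primitive [H] of a
    common dominating density. Integration in time passes it on to U and then to y. *)
Lemma iterate_continuous (X0 : lagr R) (loss : R -> R) (X : R -> lagr R) :
  iterate_eqs Xbar a b X0 loss X -> continuous (ly X0) -> continuous (lU X0) ->
  forall t, a <= t <= b -> continuous (ly (X t)) /\ continuous (lU (X t)).
Proof.
move=> [X0E hX] cy cU.
pose br t eta : R := if (a%:E < tau Xbar eta <= t%:E)%E then 1 else 0.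
pose g t eta := (1 - loss eta * br t eta) * derive1 (lV X0) eta.
have hg t xi : a <= t <= b -> has_integral `]-oo, xi] (g t) (lV (X t) xi).
  by move=> /hX[_]; exact.
have aab : a <= a <= b by rewrite lexx.
have bab : a <= b <= b by rewrite lexx ab.
have mg t : a <= t <= b -> mfun setT (g t).
  by move=> h; apply: mfun_itvNy => c; exact: has_integral_measurable (hg t c h).
pose h eta := `|g a eta| + `|g b eta|.
have gaE eta : g a eta = derive1 (lV X0) eta.
  rewrite /g /br; case: ifP => [/andP[h1 h2]|_]; last by rewrite mulr0 subr0 mul1r.
  by move: (lt_le_trans h1 h2); rewrite ltxx.
(* The breaking indicator is 0 or 1 and nondecreasing in time, so each density is
   that of time [a] or that of time [b]: no bound on [loss] is needed. *)
have gh t eta : a <= t <= b -> `|g t eta| <= h eta.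
  move=> /andP[at_ tb]; rewrite /h gaE /g /br; case: ifP => [/andP[-> h2]|_]; last by rewrite mulr0 subr0 mul1r lerDl.
  by rewrite (le_trans h2) ?lee_fin//= lerDr.
have /choice[H hH] : forall xi, exists w, has_integral `]-oo, xi[ h w.
  move=> xi; have [w1 h1] := has_integral_norm (has_integral_itvNy_co (hg a xi aab)).
  have [w2 h2] := has_integral_norm (has_integral_itvNy_co (hg b xi bab)).
  by exists (w1 + w2); exact: has_integralD (mset_itvNyo xi) h1 h2.
have co (f P : R -> R) : (forall xi, has_integral `]-oo, xi[ f (P xi)) ->
    forall x y, x <= y -> has_integral `[x, y[ f (P y - P x).
  move=> hf x y xy; have sub : `[x, y[%classic `<=` (`]-oo, y[%classic : set R).
    by move=> z; rewrite /= !in_itv/= => /andP[_ ->].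
  have [w hw] := has_integralS (mset_itvNyo y) (mset_itvco x y) sub (hf y).
  have := has_integral_uniq (has_integral_catNy xy (hf x) hw) (hf y).
  by move=> <-; rewrite addrAC subrr add0r.
have mh : mfun setT h by apply: measurable_funD; apply: measurableT_comp => //; exact: mg.
have cH : continuous H.
  apply: (primitive_continuous (h := h)) => x y xy; apply: has_integral_itvco_cc => //.
  exact: co.
have VH t xi xi' : a <= t <= b -> `|lV (X t) xi - lV (X t) xi'| <= `|H xi - H xi'|.
  move=> tab; wlog xx : xi xi' / xi' <= xi.
    move=> hw; have [|/ltW] := leP xi' xi; first exact: hw.
    by rewrite distrC (distrC (H _)); exact: hw.
  have h1 := co _ _ (fun z => has_integral_itvNy_co (hg t z tab)) _ _ xx.
  have h2 := co _ _ hH _ _ xx.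
  have [w [hw wle]] := has_integral_dom (mset_itvco xi' xi) (has_integral_measurable h1) h2
    (fun z _ => gh t z tab).
  by rewrite (has_integral_uniq h1 hw) (le_trans wle)// ler_norm.
have dom (f1 f2 : R -> R) t w1 w2 k : a <= t <= b -> has_integral `[a, t] f1 w1 ->
    has_integral `[a, t] f2 w2 -> (forall r, a <= r <= t -> `|f1 r - f2 r| <= k) ->
    `|w1 - w2| <= k * (b - a).
  move=> /andP[at_ tb] h1 h2 hk; have h12 := has_integralB (measurable_itv _) h1 h2.
  have k0 : 0 <= k by apply: le_trans (hk a _); rewrite ?lexx.
  have hk' r : `[a, t]%classic r -> `|f1 r - f2 r| <= k by rewrite /= in_itv/=; exact: hk.
  have [w [hw wle]] := has_integral_dom (measurable_itv _) (has_integral_measurable h12)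
    (has_integral_cst k at_) hk'.
  rewrite (has_integral_uniq h12 hw) (le_trans wle)// ler_wpM2l//; lra.
have dU t xi xi' : a <= t <= b -> `|lU (X t) xi - lU (X t) xi'| <=
    `|lU X0 xi - lU X0 xi'| + (b - a) / 2 * `|H xi - H xi'|.
  move=> tab; have [tr _] := hX t tab.
  have [_ h1 _] := tr xi; have [_ h2 _] := tr xi'; have /andP[at_ tb] := tab.
  have hk r : a <= r <= t -> `|(lV (X r) xi / 2 - Vinf (X r) / 4) - (lV (X r) xi' / 2 - Vinf (X r) / 4)|
      <= `|H xi - H xi'| / 2.
    move=> /andP[ar rt]; have rab : a <= r <= b by rewrite ar (le_trans rt).
    have := VH r xi xi' rab; move: (lV (X r) xi) (lV (X r) xi') (Vinf _) (`|H _ - _|) => x y z k.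
    by rewrite !ler_norml; lra.
  have := dom _ _ _ _ _ _ tab h1 h2 hk; rewrite X0E.
  have -> : lU (X t) xi - lU (X t) xi' = (lU X0 xi - lU X0 xi') +
    ((lU (X t) xi - lU X0 xi) - (lU (X t) xi' - lU X0 xi')) by ring.
  move=> hle; rewrite (le_trans (ler_normD _ _))// lerD2l (le_trans hle)//; lra.
have dY t xi xi' : a <= t <= b -> `|ly (X t) xi - ly (X t) xi'| <=
    `|ly X0 xi - ly X0 xi'| + (b - a) * `|lU X0 xi - lU X0 xi'| + (b - a) ^+ 2 / 2 * `|H xi - H xi'|.
  move=> tab; have [tr _] := hX t tab.
  have [h1 _ _] := tr xi; have [h2 _ _] := tr xi'; have /andP[at_ tb] := tab.
  have hk r : a <= r <= t -> `|lU (X r) xi - lU (X r) xi'| <=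
      `|lU X0 xi - lU X0 xi'| + (b - a) / 2 * `|H xi - H xi'|.
    by move=> /andP[ar rt]; apply: dU; rewrite ar (le_trans rt).
  have := dom _ _ _ _ _ _ tab h1 h2 hk; rewrite X0E.
  have -> : ly (X t) xi - ly (X t) xi' = (ly X0 xi - ly X0 xi') +
    ((ly (X t) xi - ly X0 xi) - (ly (X t) xi' - ly X0 xi')) by ring.
  move=> hle; rewrite (le_trans (ler_normD _ _))// -[leRHS]addrA lerD2l (le_trans hle)//.
  by rewrite le_eqVlt; apply/orP; left; apply/eqP; field.
move=> t tab; split.
  apply: (dominated_continuous (c1 := 1) (c2 := b - a) (c3 := (b - a) ^+ 2 / 2) cy cU cH) => x y.
  by rewrite mul1r; exact: dY.
apply: (dominated_continuous (c1 := 1) (c2 := (b - a) / 2) (c3 := 0) cU cH cH) => x y.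
by rewrite mul1r mul0r addr0; exact: dU.
Qed.

End NumericalContinuity.

Section Evolution.
Variable R : realType.
Variables (alpha : R -> R) (T dx : R) (P : euler R) (ts : seq R) (X : R -> lagr R).

Lemma numerical_continuous :
  continuous (ly (Lmap P)) -> continuous (lU (Lmap P)) ->
  ~ (exists c, forall x, alpha x = c) ->
  numerical_evolution alpha T dx P ts X ->
  forall t, 0 <= t <= T -> continuous (ly (X t)) /\ continuous (lU (X t)).
Proof.
move=> cy cU nc [_ /(_ nc)[[srt h0 lastT _] X0 step]].
have s0 : (0 < size ts)%N by case: ts h0.
have ts0 : ts`_0 = 0 by case: ts h0 => //= x l [].
have ts_ge0 k : (k < size ts)%N -> 0 <= ts`_k.
  elim: k => [|k IH] ks; first by rewrite ts0.
  by rewrite (le_trans (IH (ltn_trans (ltnSn _) ks)))// ltW// (sortedP 0 srt).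
have main k : (k < size ts)%N -> forall t, 0 <= t <= ts`_k ->
    continuous (ly (X t)) /\ continuous (lU (X t)).
  elim: k => [|k IH] ks t /andP[t0 tk].
    have -> : t = 0 by apply/eqP; rewrite eq_le t0 andbT -ts0.
    by rewrite X0.
  have ks' : (k < size ts)%N by exact: ltn_trans ks.
  have [tk'|tk'] := leP t ts`_k; first by apply: IH; rewrite // t0.
  have [Xn [loss [M [M2 hit _ _ XE]]]] := step k ks.
  have ab : ts`_k <= ts`_k.+1 by exact: le_trans (ltW tk') tk.
  have tk0 := ts_ge0 k ks'.
  have [c1 c2] := IH ks' ts`_k (introT andP (conj tk0 (lexx _))).
  rewrite XE ?tk' ?tk//; apply: (iterate_continuous ab (hit M _)) => //.
    by rewrite leqnn andbT (leq_trans _ M2).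
  by rewrite (ltW tk') tk.
move=> t tT; apply: (main (size ts).-1); first by rewrite prednK.
by rewrite nth_last lastT.
Qed.

End Evolution.

(** * Exact data *)

Section CumulativeMass.
Variable R : realType.
Variable m : {finite_measure set (measurableTypeR R) -> \bar R}.

Lemma cumulE x : m `]-oo, x[%classic = (cumul m x)%:E.
Proof. by rewrite /cumul fineK// fin_num_measure//; exact: mset_itvNyo. Qed.

Lemma cumul_sub a b : a <= b -> m `[a, b[%classic = (cumul m b - cumul m a)%:E.
Proof.
move=> ab; have := cumulE b.
have -> : `]-oo, b[%classic = `]-oo, a[ `|` `[a, b[ :> set R.
  apply/seteqP; split => x /=; rewrite !in_itv/=; first by case: (ltP x a) => h; [left|right].
  by case=> [/lt_le_trans|/andP[_]]//; apply.
have dis : `]-oo, a[ `&` `[a, b[ = set0 :> set R.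
  apply/seteqP; split => x //= []; rewrite !in_itv/= => h /andP[h' _].
  by move: h; rewrite ltNge h'.
have -> : m (`]-oo, a[%classic `|` `[a, b[%classic) = (m `]-oo, a[%classic + m `[a, b[%classic)%E.
  exact: measureU.
rewrite cumulE; have := fin_num_measure m _ (mset_itvco a b); case: (m `[a, b[) => // r _ [] h.
by congr (_%:E); lra.
Qed.

Lemma cumul_ge0 x : 0 <= cumul m x.
Proof. by rewrite -lee_fin -cumulE. Qed.

Lemma cumul_le M x : m setT = M%:E -> cumul m x <= M.
Proof.
move=> mM; rewrite -lee_fin -cumulE -mM; apply: le_measure => //; rewrite inE//.
Qed.

Lemma cumul_top M e : m setT = M%:E -> 0 < e -> exists x, M - e < cumul m x.
Proof.
move=> mM e0; pose E (n : nat) : set (measurableTypeR R) := `]-oo, n%:R[%classic.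
have ET : \bigcup_n E n = setT.
  by apply: (bigcup_itv_nat (T := fun r => `]-oo, r[%classic)) => r x /=; rewrite !in_itv/= => /andP[].
have h : m (E n) @[n --> \oo] --> m (\bigcup_n E n).
  apply: nondecreasing_cvg_mu => [n||]; first exact: mset_itvNyo.
    by rewrite ET; exact: measurableT.
  move=> n k nk; apply/subsetPset => x; rewrite /E/= !in_itv/= => /lt_le_trans; apply.
  by rewrite ler_nat.
rewrite ET mM in h.
have h' : (fun n : nat => cumul m n%:R) @ \oo --> M.
  exact: (fine_cvg h).
have /cvgrPdist_lt /(_ _ e0)[n _ /(_ n (leqnn n)) hn] := h'.
by exists n%:R; move: hn; rewrite /= ltr_norml; lra.
Qed.

Lemma cumul_bot e : 0 < e -> exists x, cumul m x < e.
Proof.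
move=> e0; pose E (n : nat) : set (measurableTypeR R) := `]-oo, (- n%:R)[%classic.
have E0 : \bigcap_n E n = set0.
  apply/seteqP; split => // x hx; have := hx (Num.bound `|x|) I.
  rewrite /E/= in_itv/=; have := archi_boundP (normr_ge0 x).
  by rewrite ltr_norml => /andP[h1 _] h2; move: (lt_trans h1 h2); rewrite ltxx.
have h : m (E n) @[n --> \oo] --> m (\bigcap_n E n).
  apply: nonincreasing_cvg_mu => [|n||].
  - have h0 : (m `]-oo, (- 0%:R)%R[%classic < +oo)%E by rewrite cumulE ltry.
    exact: h0.
  - exact: mset_itvNyo.
  - by rewrite E0; exact: measurable0.
  move=> n k nk; apply/subsetPset => x; rewrite /E/= !in_itv/= => /lt_le_trans; apply.
  by rewrite lerN2 ler_nat.
rewrite E0 measure0 in h.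
have h' : (fun n : nat => cumul m (- n%:R)) @ \oo --> 0.
  exact: (fine_cvg h).
have /cvgrPdist_lt /(_ _ e0)[n _ /(_ n (leqnn n)) hn] := h'.
by exists (- n%:R); move: hn; rewrite /= ltr_norml; lra.
Qed.

End CumulativeMass.

Section ExactData.
Variable R : realType.
Variables (thetap thetam ubar : R -> R).
Hypothesis htheta : cutoff_pair thetap thetam.

Lemma smooth_primitive (f : R -> R) : smooth f -> loc_abs_cont f.
Proof.
move=> sf a b ab; apply: has_integral_FTC2 => // x.
  have d := sf 0%N x; rewrite derive1n0 in d.
  rewrite derive1E; exact: derivableP.
have := sf 1%N x; rewrite derive1n1 => d.
by apply: differentiable_continuous; apply/derivable1_diffP.
Qed.

Lemma E2_primitive : E2 thetap thetam ubar ->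
  continuous ubar /\ loc_abs_cont ubar.
Proof.
have [sp sm _ _ _] := htheta.
move=> [f [a [b [[lf _ _] uE]]]].
pose h x := derive1 f x + (a * derive1 thetap x + b * derive1 thetam x).
have hu x y : x <= y -> has_integral `[x, y] h (ubar y - ubar x).
  move=> xy; have hI : mset `[x, y]%classic by exact: measurable_itv.
  have := has_integralD hI (lf _ _ xy) (has_integralD hI
    (has_integralZ a hI (smooth_primitive sp xy)) (has_integralZ b hI (smooth_primitive sm xy))).
  by rewrite !uE [X in has_integral _ _ X -> _](_ : _ = f y + a * thetap y + b * thetam y - (f x + a * thetap x + b * thetam x)); last ring.
have cu := primitive_continuous hu; split; first exact: cu.
move=> x y xy.
apply: has_integral_ae (hu x y xy) => //; first by apply: (mfunS measurableT) => //; exact: measurable_derive1.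
by apply: aeS (ae_derive1 hu) => z [_ ->].
Qed.

Variables (mu nu mu_ac : {finite_measure set (measurableTypeR R) -> \bar R}) (G0 : R).
Hypothesis hD : D0 thetap thetam ubar mu nu mu_ac.
Hypothesis hG : nu setT = G0%:E.

Let v := derive1 ubar.

Lemma D0_Fac a b : a <= b -> has_integral `[a, b[ (fun x => v x ^+ 2) (cumul mu_ac b - cumul mu_ac a).
Proof.
have [hE _ _ hac _] := hD; have [cu _] := E2_primitive hE.
move=> ab; apply: has_integral_ge0P.
- exact: mset_itvco.
- by apply: (mfunS measurableT) => //; apply: measurable_funX; exact: measurable_derive1.
- by move=> x _; exact: sqr_ge0.
- by rewrite -hac ?cumul_sub//; exact: mset_itvco.
Qed.

Lemma D0_hs_data : exists (ms : {finite_measure set (measurableTypeR R) -> \bar R}) N,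
  hs_data ubar v (cumul mu) G0 ms N.
Proof.
have [hE hmn [_ [ms [[N [mN N0 msN]] hms]]] hac _] := hD; have [cu lu] := E2_primitive hE.
have muT : mu setT = G0%:E by rewrite hmn.
exists ms, N; split => //.
- exact: measurable_derive1.
- move=> a b ab; rewrite -cumul_sub// hms ?hac//; exact: mset_itvco.
- by move=> x; exact: cumul_ge0.
- by move=> x; exact: cumul_le.
- by move=> e; exact: cumul_top.
- by move=> e; exact: cumul_bot.
Qed.

End ExactData.

Section SeminormBounds.
Variable R : realType.

Lemma W1infty_lipschitz (alpha : R -> R) A : W1infty alpha ->
  Lpnorm +oo%E (derive1 alpha) = A%:E ->
  0 <= A /\ forall x y, `|alpha x - alpha y| <= A * `|x - y|.
Proof.
move=> [la _ _] hA.
have A0 : 0 <= A by rewrite -lee_fin -hA; exact: Lnorm_ge0.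
have /Lpnorm_oo_ae hae : (Lpnorm +oo%E (derive1 alpha) <= A%:E)%E by rewrite hA.
split => // x y; wlog xy : x y / x <= y.
  move=> h; have [|/ltW] := leP x y; first exact: h.
  by rewrite distrC (distrC x); exact: h.
have hI : mset `[x, y]%classic by exact: measurable_itv.
have h1 := la _ _ xy; have hc := has_integral_cst A xy.
have l1 := has_integral_le hI h1 hc; have l2 := has_integral_le hI (has_integralZ (-1) hI h1) hc.
have := l1 (aeS (fun z hz _ => le_trans (ler_norm _) hz) hae).
have : -1 * (alpha y - alpha x) <= A * (y - x).
  by apply: l2; apply: aeS hae => z hz _; rewrite mulN1r (le_trans _ hz)// -normrN ler_norm.
by rewrite distrC (distrC x) [`|y - x|]ger0_norm ?subr_ge0// ler_norml; lra.
Qed.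

Lemma B2_seminorm_bound (beta B : R) (v : R -> R) : mfun setT v ->
  B2_seminorm beta v = B%:E -> 0 <= B /\ forall h, 0 < h <= 2 ->
  exists i, has_integral setT (fun x => (v (x + h) - v x) ^+ 2) i /\ i <= (B * h `^ beta) ^+ 2.
Proof.
move=> mv hB.
have bound h : 0 < h <= 2 -> ((h `^ (- beta))%:E * Lpnorm 2%:E (shift_diff h v) <= B%:E)%E.
  move=> h02; rewrite -hB; apply: ereal_sup_ubound; exists h => //.
have B0 : 0 <= B.
  rewrite -lee_fin; apply: le_trans (bound 2 _); last by rewrite ltr0n lexx.
  by apply: mule_ge0; [rewrite lee_fin powR_ge0|exact: Lnorm_ge0].
split => // h h02; have /andP[h0 _] := h02.
have md : mfun setT (shift_diff h v).
  apply: measurable_funB => //; apply: measurableT_comp mv _; exact: measurable_funD.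
have hp : 0 < h `^ beta by exact: powR_gt0.
have := bound h h02; rewrite powRN.
have := @powR_Lnorm _ _ _ (@lebesgue_measure R) (EFin \o shift_diff h v) 2.
rewrite pnatr_eq0 => /(_ isT).
rewrite (@eq_integral _ _ _ (@lebesgue_measure R) setT (fun x : R => ((v (x + h) - v x) ^+ 2)%:E)); last first.
  by move=> x _; rewrite /= ?poweR_EFin powR_mulrn// real_normK// num_real.
rewrite -/(Lpnorm 2%:E (shift_diff h v)).
have := Lnorm_ge0 (@lebesgue_measure R) 2%:E (EFin \o shift_diff h v).
rewrite -/(Lpnorm 2%:E (shift_diff h v)).
(* An infinite norm is excluded because the seminorm is the real [B] and the factor in front is
   positive. *)
case: (Lpnorm _ _) => [n| |]//=; last first.
  by move=> _ _; rewrite gt0_muley ?lte_fin ?invr_gt0// leye_eq.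
rewrite lee_fin => n0 hn; rewrite -EFinM lee_fin mulrC ler_pdivrMr// => nB.
exists (n ^+ 2); split; last by rewrite lerXn2r// ?nnegrE ?mulr_ge0// ltW.
apply: has_integral_ge0P => //.
- by apply: measurable_funX.
- by move=> x _; exact: sqr_ge0.
- by rewrite -hn ?poweR_EFin powR_mulrn.
Qed.

End SeminormBounds.

(** * Comparison in Eulerian coordinates *)

Section Eulerian.
Variable R : realType.
Variables (u v F : R -> R) (G0 : R).
Variable ms : {finite_measure set (measurableTypeR R) -> \bar R}.
Variable N : set R.
Hypothesis hd : hs_data u v F G0 ms N.
Variable L : R -> R.
Hypotheses (mL : mfun setT L) (L01 : forall x, 0 <= L x <= 1).

Lemma continuous_solY t : 0 <= t -> continuous (solY u v F G0 L t).
Proof.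
move=> t0; have ci : continuous (@id R) by move=> x; exact: cvg_id.
apply: (dominated_continuous (c1 := 1 + t + t ^+ 2) (c2 := 0) (c3 := 0) ci ci ci) => x y.
by rewrite !mul0r !addr0; exact: (solY_lip hd mL L01).
Qed.

Lemma continuous_solU t : 0 <= t -> continuous (solU u v F G0 L t).
Proof.
move=> t0; have ci : continuous (@id R) by move=> x; exact: cvg_id.
apply: (dominated_continuous (c1 := 1 + t) (c2 := 0) (c3 := 0) ci ci ci) => x y.
by rewrite !mul0r !addr0; exact: (solU_lip hd mL L01).
Qed.

(* Both uu x and ud x are read off Lagrangian labels xi and xi', whose exact
   positions differ by at most the error of the characteristics. *)
Lemma eulerian_difference (U0 t k p : R) (yd Ud uu ud : R -> R) :
  (forall x, `|u x| <= U0) -> 0 <= t -> 0 < p <= 2 -> 0 <= k ->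
  continuous yd ->
  (forall xi, `|solY u v F G0 L t xi - yd xi| <= k * p ^+ 2) ->
  (forall xi, `|solU u v F G0 L t xi - Ud xi| <= k * p ^+ 2) ->
  (forall x xi, x = solY u v F G0 L t xi -> uu x = solU u v F G0 L t xi) ->
  (forall x xi, x = yd xi -> ud x = Ud xi) ->
  forall x, `|uu x - ud x| <= (3 * k + G0 / 4) * p.
Proof.
move=> hU t0 /andP[p0 p2] k0 cyd hY hUd huu hud x.
have hdist := solY_dist hd mL L01 _ hU t0.
have [xi hxi] := near_id_surjective (continuous_solY t0) hdist x.
have [|xi' hxi'] := near_id_surjective (C := k * p ^+ 2 + (G0 + t * U0 + t ^+ 2 * G0)) cyd _ x.
  move=> z; have -> : yd z - z = - (solY u v F G0 L t z - yd z) + (solY u v F G0 L t z - z) by ring.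
  by rewrite (le_trans (ler_normD _ _))// normrN lerD.
rewrite (huu x xi)// (hud x xi')//.
have E1 : `|solY u v F G0 L t xi - solY u v F G0 L t xi'| <= k * p ^+ 2.
  by rewrite hxi -hxi' distrC.
(* The Hoelder estimate is used with e = 1/p: an error k p^2 in position becomes k p, and the
   remaining term is G0 p / 4. *)
have p10 : 0 < p^-1 by rewrite invr_gt0.
have E2 : `|solU u v F G0 L t xi - solU u v F G0 L t xi'| <=
    p^-1 * `|solY u v F G0 L t xi - solY u v F G0 L t xi'| + G0 / (4 * p^-1).
  wlog xx : xi xi' hxi hxi' E1 / xi' <= xi.
    move=> h; have [c|/ltW c] := leP xi' xi.
      have := solU_holder hd mL L01 p10 t0 c => /le_trans; apply.
      by rewrite lerD2r ler_wpM2l ?ler_norm// ltW.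
    have := solU_holder hd mL L01 p10 t0 c; rewrite distrC => /le_trans; apply.
    by rewrite lerD2r ler_wpM2l ?(ltW p10)// distrC ler_norm.
  have := solU_holder hd mL L01 p10 t0 xx => /le_trans; apply.
  by rewrite lerD2r ler_wpM2l ?ler_norm// ltW.
have E3 : p^-1 * `|solY u v F G0 L t xi - solY u v F G0 L t xi'| <= k * p.
  by rewrite mulrC ler_pdivrMr// -mulrA -expr2.
have E4 : G0 / (4 * p^-1) = G0 / 4 * p by field; rewrite gt_eqF.
have E5 : k * p ^+ 2 <= 2 * k * p.
  have kp : 0 <= k * p by rewrite mulr_ge0// ltW.
  by have := ler_wpM2l kp p2; rewrite expr2; lra.
rewrite E4 in E2; apply: (le_trans (ler_distD (solU u v F G0 L t xi') _ _)).
apply: (le_trans (lerD E2 (hUd xi'))).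
by move: E3 E5; move: (p^-1 * _) (k * p ^+ 2) => a b; lra.
Qed.

End Eulerian.

(** * Collection of the estimates and choice of the exponents *)

Lemma powR_sqr (R : realType) (x a b : R) : 0 < x <= 1 -> a * 2 <= b ->
  x `^ b <= (x `^ a) ^+ 2.
Proof.
move=> /andP[x0 x1] ab; rewrite -powR_mulrn ?powR_ge0// -powRrM.
rewrite /powR gt_eqF// ler_expR; apply: ler_wnM2r => //; exact: ln_le0.
Qed.

Lemma powR_le1 (R : realType) (x a : R) : 0 < x <= 1 -> 0 <= a -> x `^ a <= 1.
Proof.
move=> /andP[x0 x1] a0; rewrite /powR gt_eqF// -expR0 ler_expR.
by rewrite mulr_ge0_le0// ln_le0.
Qed.

Section Projection.
Variable R : realType.
Variables (A U0 G0 T B : R).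

(** The first factor dominates the constants of the distances between the data and their projection;
    1 + G0 is there for [energy_weighted_diff], whose bound has the extra factor [G0]. *)
Definition data_constant := (2 + 2 * G0 + 8 * B ^+ 2) * (1 + G0).

Lemma projection_stable (beta : R) (u v F Fac alpha L : R -> R)
    (ms : {finite_measure set (measurableTypeR R) -> \bar R}) N
    (mh : {finite_measure set (measurableTypeR R) -> \bar R}) Nh (dx : R) (s : int -> R) (Lh : R -> R) :
  hs_data u v F G0 ms N ->
  (forall a b, a <= b -> has_integral `[a, b[ (fun x => v x ^+ 2) (Fac b - Fac a)) ->
  0 < beta <= 1 -> 0 <= B ->
  (forall h, 0 < h <= 2 -> exists i,
     has_integral setT (fun x => (v (x + h) - v x) ^+ 2) i /\ i <= (B * h `^ beta) ^+ 2) ->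
  0 < dx <= 1 -> (forall j, s j = 1 \/ s j = -1) ->
  let uh := proj_u dx s u Fac in
  let w := proj_v u Fac dx s in
  let Fh := proj_F dx s u F Fac in
  hs_data uh w Fh G0 mh Nh ->
  0 <= A -> (forall x y, `|alpha x - alpha y| <= A * `|x - y|) -> 0 < T ->
  mfun setT L -> (forall x, 0 <= L x <= 1) ->
  mfun setT Lh -> (forall x, 0 <= Lh x <= 1) ->
  {ae (@lebesgue_measure R), forall x, 2 + T * v x <= 0 ->
     L x = alpha (solY u v F G0 L (- 2 / v x) (x + F x))} ->
  (forall x, w x < 0 -> Lh x = alpha (solY uh w Fh G0 Lh (- 2 / w x) (x + Fh x))) ->
  (forall x, `|u x| <= U0) ->
  forall t xi, 0 <= t <= T ->
  let d := data_constant * (dx `^ 2^-1 + dx `^ beta) in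
  `|solY u v F G0 L t xi - solY uh w Fh G0 Lh t xi| <= stability_constant A (U0 + 1 + G0) G0 T * d /\
  `|solU u v F G0 L t xi - solU uh w Fh G0 Lh t xi| <= stability_constant A (U0 + 1 + G0) G0 T * d.
Proof.
move=> hd hFac be B0 hB dx01 s1 uh w Fh hdh A0 alA T0 mL L01 mLh Lh01 hL hLh hU t xi tT.
set r := dx `^ 2^-1; set q := dx `^ beta => d.
have /andP[dx0 dx1] := dx01; have G00 := hs_G0_ge0 hd.
have rE : Num.sqrt dx = r by rewrite /r powR12_sqrt ?ltW.
have r0 : 0 <= r by exact: powR_ge0.
have q0 : 0 <= q by exact: powR_ge0.
have r1 : r <= 1 by apply: powR_le1.
have rr : r ^+ 2 = dx by rewrite -rE sqr_sqrtr// ltW.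
have B2 := sqr_ge0 B.
have M0 : 0 <= 2 + 2 * G0 + 8 * B ^+ 2 by rewrite !addr_ge0// mulr_ge0.
have dE : (2 + 2 * G0 + 8 * B ^+ 2) * (r + q) <= d.
  rewrite /d /data_constant -mulrA ler_wpM2l//.
  by rewrite ler_peMl ?addr_ge0// lerDl.
have dG : (2 + 2 * G0 + 8 * B ^+ 2) * (r + q) * G0 <= d.
  rewrite /d /data_constant (mulrDr _ 1) mulrDl mulr1 [X in _ <= _ + X]mulrAC lerDr.
  by rewrite mulr_ge0// addr_ge0.
have p1 := mulr_ge0 G00 r0; have p2 := mulr_ge0 G00 q0; have p3 := mulr_ge0 B2 r0; have p4 := mulr_ge0 B2 q0.
have sg : 2 * B ^+ 2 * q + 2 * G0 * r <= (2 + 2 * G0 + 8 * B ^+ 2) * (r + q).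
  by move: p1 p2 p3 p4; move: (B ^+ 2) => b; lra.
apply: (solution_stable hd hdh A0 alA T0 mL L01 mLh Lh01 hL hLh) => //.
- by move=> x; rewrite (le_trans (hU x))// -addrA lerDl addr_ge0.
(* The projected velocity is at most U0 at mesh points and varies by at most 1 + G0 / 2 on a cell,
   which has length at most 2: this is [hs_u_young] at e = 1, and the origin of U0 + 1 + G0. *)
- move=> x; have [j /andP[j1 j2]] := cell_floor dx01 x.
  have [e _] := proj_mesh hd hFac dx0 s1 j.
  have := hs_u_young hdh (cmesh dx j) x ltr01; rewrite -/uh in e *; rewrite e => h.
  have hx : `|x - cmesh dx j| <= 2.
    by move: j2; rewrite cmesh_succ ger0_norm ?subr_ge0//; lra.
  have := hU (cmesh dx j); have := ler_normD (uh x - u (cmesh dx j)) (u (cmesh dx j)).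
  by rewrite subrK => h1 h2; lra.
- move=> z; apply: (le_trans (yinit_proj_dist hd hFac dx01 s1 hdh z)); apply: le_trans dE.
  have : dx <= r by rewrite -rr expr2 ler_piMl.
  by move: p1 p2 p3 p4; move: (B ^+ 2) => b; lra.
- move=> z; apply: (le_trans (uinit_proj_dist hd hFac dx01 s1 hdh z)); apply: le_trans dE.
  by rewrite rE; move: p1 p2 p3 p4; move: (B ^+ 2) => b; lra.
- move=> z a b ab abE i hi.
  have := small_energy_yinit hd hFac be B0 hB dx01 s1 hdh ab abE hi.
  by rewrite rE => /le_trans; apply; exact: le_trans sg dE.
- have [i [hi ile]] := energy_weighted_diff hd hFac be B0 hB dx01 s1 hdh.
  exists i; split => //; rewrite (le_trans ile)// (le_trans _ dG)// rE; exact: ler_wpM2r.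
- have [i [hi ile]] := slope_product_diff hd hFac be B0 hB dx01 s1 hdh.
  exists i; split => //; rewrite (le_trans ile)// (le_trans _ dE)// -/q.
  by move: p1 p2 p3 p4; move: (B ^+ 2) => b; lra.
Qed.

End Projection.

Theorem theorem3p20 (R : realType) (thetap thetam : R -> R)
    (htheta : cutoff_pair thetap thetam)
    (grid : grid_rule R)
    (hlocal : local_error_estimate thetap thetam grid)
    (T A U0 G0 beta B : R) (hT : 0 < T) (hbeta : 0 < beta <= 1) :
  exists D : R,
  forall (alpha : R -> R) (ubar : R -> R) (mubar nubar mubar_ac : finmeas R),
    W1infty alpha -> (forall x, 0 <= alpha x < 1) ->
    D0 thetap thetam ubar mubar nubar mubar_ac ->
    B2 beta (derive1 ubar) ->
    Lpnorm +oo%E (derive1 alpha) = A%:E ->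
    Lpnorm +oo%E ubar = U0%:E ->
    nubar setT = G0%:E ->
    B2_seminorm beta (derive1 ubar) = B%:E ->
  forall (dx : R) (s : int -> R), 0 < dx <= 1 ->
    (forall j, s j = 1 \/ s j = -1) ->
  forall (u : R -> R -> R) (mu nu : R -> finmeas R),
    dissipative_solution alpha ubar mubar nubar u mu nu ->
  forall (udx : R -> R -> R) (mudx nudx : R -> finmeas R),
    numerical_solution grid alpha T dx
      (proj_data dx s ubar (cumul mubar) (cumul mubar_ac)) udx mudx nudx ->
    (ereal_sup [set Lpnorm +oo%E (u t \- udx t)%R | t in `[0%R, T]]
       <= (D * (dx `^ (1 / 8) + dx `^ (beta / 4)))%:E)%E.
Proof.
have [C hC] := hlocal A U0 G0 T hT.
set S := stability_constant A (U0 + 1 + G0) G0 T * data_constant G0 B.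
(* The constant of [eulerian_difference] for k = C + 2 S: the error on characteristics is at most C
   dx^(1/4) + S (dx^(1/2) + dx^beta), and each of the three powers is at most p^2 for the rate p. *)
exists (3 * (C + 2 * S) + G0 / 4).
move=> alpha ubar mu0 nu0 mu_ac W al01 hD _ hA hU0 hG hB dx s dx01 s1 u mu nu [X [hX hM]]
  udx mudx nudx [Xd [hXd hMd]].
have [A0 alA] := W1infty_lipschitz W hA.
have [hE hmn _ _ _] := hD; have [cu lu] := E2_primitive htheta hE.
have [ms [N hd]] := D0_hs_data htheta hD hG.
have hFac := D0_Fac htheta hD.
have [B0 hBes] := B2_seminorm_bound (hs_mv hd) hB.
have hU : forall x, `|ubar x| <= U0 by apply: Lpnorm_oo_continuous => //; rewrite hU0.
have /andP[dx0 dx1] := dx01.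
have [mh [Nh hdh]] := proj_hs_data hd hFac dx0 s1.
have GF : cumul nu0 = cumul mu0 by apply/funext => x; rewrite /cumul hmn//; exact: mset_itvNyo.
have mal := lipschitz_measurable A0 alA.
have mL := measurable_exact_loss hd GF hT hX.
have L01 := exact_loss01 ubar (cumul mu0) (cumul nu0) X T al01.
have hL := exact_lossE hd GF al01 hT hX.
set L := exact_loss _ _ _ _ _ _ in mL L01 hL.
have [Lh [mLh Lh01 hLh]] := breaking_loss_fixpoint hdh al01 A0 alA.
(* The exact evolution of the projected data, which the local error estimate takes as an
   argument. *)
have hXh := solution_exact hdh (erefl _) mal mLh Lh01 hLh.
have stab := projection_stable hd hFac hbeta B0 hBes dx01 s1 hdh A0 alA hT mL L01 mLh Lh01 hL hLh hU.
(* The local error is bounded in essential supremum; continuity turns this into a bound at every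
   label. For constant [alpha] the numerical evolution is an exact one, hence given by the explicit
   formulas. *)
have cXd t : 0 <= t <= T -> continuous (ly (Xd t)) /\ continuous (lU (Xd t)).
  move=> tT; have /andP[t0 _] := tT.
  have [cst|ncst] := pselect (exists c, forall x, alpha x = c).
    have [/(_ cst) hXe _] := hXd.
    have mL' := measurable_exact_loss hdh (erefl _) hT hXe.
    have L01' := exact_loss01 (proj_u dx s ubar (cumul mu_ac))
      (proj_F dx s ubar (cumul mu0) (cumul mu_ac)) (proj_F dx s ubar (cumul mu0) (cumul mu_ac)) Xd T al01.
    have EY := exact_solY hdh (erefl _) al01 hT hXe.
    have EU := exact_solU hdh (erefl _) al01 hT hXe.
    split.
      have -> := funext (fun xi => EY t xi tT); exact: (continuous_solY hdh mL' L01').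
    have -> := funext (fun xi => EU t xi tT); exact: (continuous_solU hdh mL' L01').
  apply: (numerical_continuous _ _ ncst hXd) => //.
    by rewrite (lyE (proj_u dx s ubar (cumul mu_ac)) (erefl _)); exact: (continuous_yinit hdh).
  by rewrite (lUE (proj_u dx s ubar (cumul mu_ac)) (erefl _)); exact: (continuous_uinit hdh).
have local t xi : 0 <= t <= T ->
    `|solY (proj_u dx s ubar (cumul mu_ac)) (proj_v ubar (cumul mu_ac) dx s)
        (proj_F dx s ubar (cumul mu0) (cumul mu_ac)) G0 Lh t xi - ly (Xd t) xi| <= C * dx `^ (1 / 4) /\
    `|solU (proj_u dx s ubar (cumul mu_ac)) (proj_v ubar (cumul mu_ac) dx s)
        (proj_F dx s ubar (cumul mu0) (cumul mu_ac)) G0 Lh t xi - lU (Xd t) xi| <= C * dx `^ (1 / 4).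
  move=> tT; have /andP[t0 _] := tT; have [c1 c2] := cXd t tT.
  have hle := hC alpha ubar mu0 nu0 mu_ac W al01 hD hA hU0 hG dx s dx01 s1 _ Xd hXh hXd t tT.
  have n1 := Lnorm_ge0 (@lebesgue_measure R) +oo%E (EFin \o (solY (proj_u dx s ubar (cumul mu_ac)) (proj_v ubar (cumul mu_ac) dx s)
        (proj_F dx s ubar (cumul mu0) (cumul mu_ac)) G0 Lh t \- ly (Xd t))%R).
  have n2 := Lnorm_ge0 (@lebesgue_measure R) +oo%E (EFin \o (solU (proj_u dx s ubar (cumul mu_ac)) (proj_v ubar (cumul mu_ac) dx s)
        (proj_F dx s ubar (cumul mu0) (cumul mu_ac)) G0 Lh t \- lU (Xd t))%R).
  have l1 := le_trans (leeDl _ n2) hle; have l2 := le_trans (leeDr _ n1) hle.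
  split.
    apply: (Lpnorm_oo_continuous _ l1).
    by move=> x; apply: cvgB; [exact: (continuous_solY hdh mLh Lh01)|exact: c1].
  apply: (Lpnorm_oo_continuous _ l2).
  by move=> x; apply: cvgB; [exact: (continuous_solU hdh mLh Lh01)|exact: c2].
apply: ge_ereal_sup => _ [t /= + <-]; rewrite in_itv/= => tT.
have /andP[t0 _] := tT.
apply/Lpnorm_oo_ae; apply: aeW => x.
have [be0 be1] := andP hbeta.
(* The announced rate serves as the parameter of the Hoelder estimate: its square dominates
   dx^(1/4), dx^(1/2) and dx^beta. *)
set p := dx `^ (1 / 8) + dx `^ (beta / 4).
have a0 : 0 < dx `^ (1 / 8) by exact: powR_gt0.
have b0 : 0 < dx `^ (beta / 4) by exact: powR_gt0.
have p0 : 0 < p by exact: addr_gt0.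
have p2 : p <= 2.
  have := powR_le1 (a := 1 / 8) dx01; have := powR_le1 (a := beta / 4) dx01.
  by rewrite /p => h1 h2; have := h1 (divr_ge0 (ltW be0) (ler0n _ _)); have := h2 (divr_ge0 ler01 (ler0n _ _)); lra.
have pa : (dx `^ (1 / 8)) ^+ 2 <= p ^+ 2 by rewrite lerXn2r ?nnegrE ?(ltW a0) ?(ltW p0)// lerDl ltW.
have pb : (dx `^ (beta / 4)) ^+ 2 <= p ^+ 2 by rewrite lerXn2r ?nnegrE ?(ltW b0) ?(ltW p0)// lerDr ltW.
have e1 : dx `^ (1 / 4) <= p ^+ 2 by apply: le_trans pa; apply: powR_sqr => //; lra.
have e2 : dx `^ 2^-1 <= p ^+ 2 by apply: le_trans pa; apply: powR_sqr => //; lra.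
have e3 : dx `^ beta <= p ^+ 2 by apply: le_trans pb; apply: powR_sqr => //; lra.
(* [C] is only given as a real number; its sign follows from the estimate itself, as it bounds an
   absolute value. *)
have C0 : 0 <= C.
  have [h _] := local t 0 tT; have := le_trans (normr_ge0 _) h.
  by rewrite pmulr_lge0// powR_gt0.
have S0 : 0 <= S.
  have [h _] := stab t 0 tT; have := le_trans (normr_ge0 _) h.
  by rewrite mulrA pmulr_lge0// addr_gt0// powR_gt0.
have k1 : S * (dx `^ 2^-1 + dx `^ beta) + C * dx `^ (1 / 4) <= (C + 2 * S) * p ^+ 2.
  have := ler_wpM2l S0 (lerD e2 e3); have := ler_wpM2l C0 e1; lra.
have {}k1 : forall y : R, y <= S * (dx `^ 2^-1 + dx `^ beta) + C * dx `^ (1 / 4) -> y <= (C + 2 * S) * p ^+ 2.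
  by move=> y /le_trans; apply.
apply: (eulerian_difference hd mL L01 hU t0 _ _ (yd := ly (Xd t)) (Ud := lU (Xd t))).
- by rewrite p0.
- by rewrite addr_ge0// mulr_ge0.
- by have [] := cXd t tT.
- move=> xi; apply: k1; have [h1 _] := stab t xi tT; have [h2 _] := local t xi tT.
  rewrite mulrA -/S in h1; move: h1 h2; set y1 := solY _ _ _ _ _ _ _; set y2 := solY _ _ _ _ _ _ _.
  move=> h1 h2; have -> : y1 - ly (Xd t) xi = (y1 - y2) + (y2 - ly (Xd t) xi) by ring.
  by rewrite (le_trans (ler_normD _ _))// lerD.
- move=> xi; apply: k1; have [_ h1] := stab t xi tT; have [_ h2] := local t xi tT.
  rewrite mulrA -/S in h1; move: h1 h2; set y1 := solU _ _ _ _ _ _ _; set y2 := solU _ _ _ _ _ _ _.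
  move=> h1 h2; have -> : y1 - lU (Xd t) xi = (y1 - y2) + (y2 - lU (Xd t) xi) by ring.
  by rewrite (le_trans (ler_normD _ _))// lerD.
- move=> z xi; rewrite -(exact_solY hd GF al01 hT hX)// -(exact_solU hd GF al01 hT hX)//.
  by have [h _ _] := hM t t0; exact: h.
- by have [h _ _] := hMd t tT.
Qed.
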